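(* Let $\varepsilon>0$, $\eta\in(0,1)$ and consider an instance of the stochastic variational inequality or stochastic saddle-point problem. Let $\mathcal A$ be the sampled-with-replacement variant of the NSEG method with $$\gamma_t=\gamma=\frac{\min\{D/M,1/L\}}{n\max\{\sqrt n,\sqrt{d\ln(1/\eta)}/\varepsilon\}},\qquad \sigma_t^2=\frac{8M^2\log(1/\eta)}{\varepsilon^2},\qquad T=n^2.$$ Then $\mathrm{WeakGap}_{\mathrm{VI}}(\mathcal A,F)$ (for SVI) or $\mathrm{WeakGap}_{\mathrm{SP}}(\mathcal A,f)$ (for SSP) is bounded by $$O\Big((MD+LD^2)\max\Big\{\frac1{\sqrt n},\frac{\sqrt{d\ln(1/\eta)}}{n\varepsilon}\Big\}+\frac{MLD}{n^{5/2}}\Big).$$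
   Context: Setting (SVI). $\mathcal W\subseteq\mathbb R^d$ is a compact convex set of Euclidean diameter $D>0$, $\|\cdot\|$ is the Euclidean norm, $\Pi_{\mathcal W}$ the Euclidean projection. $\mathcal M^1_{\mathcal W}(L,M)$ is the set of operators $G:\mathcal W\to\mathbb R^d$ that are monotone ($\langle G(w_1)-G(w_2),w_1-w_2\rangle\ge0$), $L$-Lipschitz, and $M$-bounded ($\sup_{\mathcal W}\|G\|\le M$). $\mathcal P$ is an unknown distribution on a set $\mathcal Z$; $F_\beta\in\mathcal M^1_{\mathcal W}(L,M)$ for $\beta\in\mathcal Z$ and $F(w)=\mathbb E_{\beta\sim\mathcal P}[F_\beta(w)]$. The data set is $\mathbf S=(\beta_1,\dots,\beta_n)\sim\mathcal P^n$. Setting (SSP). $\mathcal W=\mathcal X\times\mathcal Y$ with $\mathcal X\subseteq\mathbb R^{d_1},\mathcal Y\subseteq\mathbb R^{d_2}$ compact convex, $d=d_1+d_2$; $f_\beta:\mathcal X\times\mathcal Y\to\mathbb R$ is convex in $x$ and concave in $y$, with $\nabla_xf_\beta$ $L_x$-Lipschitz, $\nabla_yf_\beta$ $L_y$-Lipschitz, $L=\sqrt{L_x^2+L_y^2}$; $f=\mathbb E_{\beta\sim\mathcal P}[f_\beta]$. An SVI algorithm is applied to the SSP problem by using the operators $F_\beta=(\nabla_xf_\beta,-\nabla_yf_\beta)$ on $\mathcal W$, which are assumed to lie in $\mathcal M^1_{\mathcal W}(L,M)$. Sampled-with-replacement NSEG. From $u_0\in\mathcal W$, for $t=1,\dots,T$: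 $F_{1,t}(\cdot)=F_{\beta_{i(1,t)}}(\cdot)+\xi_1^t$, $w_t=\Pi_{\mathcal W}(u_{t-1}-\gamma_tF_{1,t}(u_{t-1}))$, $F_{2,t}(\cdot)=F_{\beta_{i(2,t)}}(\cdot)+\xi_2^t$, $u_t=\Pi_{\mathcal W}(u_{t-1}-\gamma_tF_{2,t}(w_t))$, with $i(1,t),i(2,t)\sim\mathrm{Unif}(\{1,\dots,n\})$ and $\xi_1^t,\xi_2^t\sim\mathcal N(0,\sigma_t^2\mathbb I_d)$, all independent. Output $\mathcal A(\mathbf S)=\big(\sum_{t=1}^T\gamma_t\big)^{-1}\sum_{t=1}^T\gamma_tw_t$. Weak gaps. $\mathbb E_{\mathcal A}$ denotes expectation over internal randomness of $\mathcal A$ (independent of $\mathbf S$). $\mathrm{WeakGap}_{\mathrm{VI}}(\mathcal A,F)=\mathbb E_{\mathcal A}\sup_{w\in\mathcal W}\mathbb E_{\mathbf S}[\langle F(w),\mathcal A(\mathbf S)-w\rangle]$; with $\mathcal A(\mathbf S)=(x(\mathbf S),y(\mathbf S))$, $\mathrm{WeakGap}_{\mathrm{SP}}(\mathcal A,f)=\mathbb E_{\mathcal A}\sup_{x\in\mathcal X,y\in\mathcal Y}\mathbb E_{\mathbf S}[f(x(\mathbf S),y)-f(x,y(\mathbf S))]$. The constant in $O(\cdot)$ is absolute. *)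

(* Defs.v *)
From HB Require Import structures.
From mathcomp Require Import all_boot all_order all_algebra.
From mathcomp Require Import all_classical all_reals all_analysis.
Set Implicit Arguments.
Unset Strict Implicit.
Unset Printing Implicit Defensive.
Import Order.TTheory GRing.Theory Num.Theory numFieldNormedType.Exports.
Local Open Scope classical_set_scope.
Local Open Scope ring_scope.

(** The library norm [`|v|] on ['rV[R]_d] is the max norm, so the Euclidean
    structure is introduced here; both norms induce the same topology. *)

Definition dotv (R : realType) (d : nat) (u v : 'rV[R]_d) : R :=
  \sum_(j < d) u 0 j * v 0 j.

Definition enorm (R : realType) (d : nat) (v : 'rV[R]_d) : R :=
  Num.sqrt (dotv v v).

Definition diameter (R : realType) (d : nat) (W : set 'rV[R]_d) : R :=
  sup [set enorm (w1 - w2) | w1 in W & w2 in W].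

(** Unique nearest point of [W] to [v] when [W] is nonempty, closed and
    convex. *)
Definition euclid_proj (R : realType) (d : nat) (W : set 'rV[R]_d) (v : 'rV[R]_d) :
    'rV[R]_d :=
  xget 0 [set p | W p /\ forall q, W q -> enorm (v - p) <= enorm (v - q)].

(** The class $\mathcal{M}^1_W(L,M)$; only the values of [G] on [W] matter. *)
Definition monotone_class (R : realType) (d : nat) (W : set 'rV[R]_d)
    (L M : R) (G : 'rV[R]_d -> 'rV[R]_d) : Prop :=
  [/\ forall w1 w2, W w1 -> W w2 -> 0 <= dotv (G w1 - G w2) (w1 - w2),
      forall w1 w2, W w1 -> W w2 -> enorm (G w1 - G w2) <= L * enorm (w1 - w2)
    & forall w, W w -> enorm (G w) <= M].

(** [g] is a gradient at [x] of [f] seen as a function on [X], i.e., the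
    increments of [f] are taken within [X]. *)
Definition is_gradient (R : realType) (d : nat) (X : set 'rV[R]_d)
    (f : 'rV[R]_d -> R) (x g : 'rV[R]_d) : Prop :=
  (f z - f x - dotv g (z - x)) / enorm (z - x) @[z --> within X x^'] --> (0 : R).

(** The i.i.d. law $P^n$ of the data set. *)

Definition tcons (d : measure_display) (T : measurableType d) (n : nat)
    (p : T * n.-tuple T) : n.+1.-tuple T := [tuple of p.1 :: p.2].

Lemma measurable_tcons (d : measure_display) (T : measurableType d) (n : nat) :
  measurable_fun [set: T * n.-tuple T] (@tcons d T n).
Proof.
exact: (measurable_cons (f := fst) (g := snd)).
Qed.

HB.instance Definition _ (d : measure_display) (T : measurableType d)
    (n : nat) :=
  isMeasurableFun.Build _ _ _ _ (@tcons d T n) (@measurable_tcons d T n).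

Fixpoint iid (R : realType) (d : measure_display) (T : measurableType d)
    (P : probability T R) (n : nat) : probability (n.-tuple T) R :=
  if n is m.+1 then distribution (P \x iid P m)%E (@tcons d T m)
  else \d_ [tuple].

(** Mutual independence of the finite family of event systems [G k]. *)
Definition mutually_independent (R : realType) (d : measure_display)
    (T : measurableType d) (P : probability T R) (K : finType)
    (G : K -> set_system T) : Prop :=
  forall (J : {set K}) (A : K -> set T), (forall k, k \in J -> G k (A k)) ->
    P (\bigcap_(k in [set k | k \in J]) A k) = (\prod_(k in J) P (A k))%E.

Definition unif_rv (R : realType) (d : measure_display) (T : measurableType d)
    (P : probability T R) (n : nat) (i : T -> 'I_n) : Prop :=
  forall k, measurable (i @^-1` [set k]) /\
    P (i @^-1` [set k]) = (n%:R^-1)%:E.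

Definition normal_rv (R : realType) (d : measure_display)
    (T : measurableType d) (P : probability T R) (m s : R) (X : T -> R) :
    Prop :=
  measurable_fun setT X /\
  forall A, measurable A -> P (X @^-1` A) = normal_prob m s A.

(** Internal randomness of the method, for steps $1\le t\le T$: the indices
    [i1 t], [i2 t] are uniform on $\{1,\dots,n\}$ (here ['I_n]), [xi1 t], [xi2 t]
    follow $N(0,\sigma_t^2 I_d)$, and everything is independent.  As
    $N(0,\sigma^2 I_d)$ is the law of $d$ independent $N(0,\sigma^2)$
    coordinates, this amounts to the independence of the indices and of all the
    coordinates of the noise vectors. *)
Definition nseg_randomness (R : realType) (dO : measure_display)
    (O : measurableType dO) (PA : probability O R) (n d T : nat)
    (sigma : nat -> R) (i1 i2 : nat -> O -> 'I_n)
    (xi1 xi2 : nat -> O -> 'rV[R]_d) : Prop :=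
  [/\ forall t, (1 <= t <= T)%N -> unif_rv PA (i1 t) /\ unif_rv PA (i2 t),
      forall t (j : 'I_d), (1 <= t <= T)%N ->
        normal_rv PA 0 (sigma t) (fun o => xi1 t o 0 j) /\
        normal_rv PA 0 (sigma t) (fun o => xi2 t o 0 j)
    & mutually_independent PA
        (fun k : ('I_T + 'I_T) + ('I_T * 'I_d + 'I_T * 'I_d) =>
           match k with
           | inl (inl t) => preimage_set_system setT (i1 t.+1) setT
           | inl (inr t) => preimage_set_system setT (i2 t.+1) setT
           | inr (inl (t, j)) =>
               preimage_set_system setT (fun o => xi1 t.+1 o 0 j) measurable
           | inr (inr (t, j)) =>
               preimage_set_system setT (fun o => xi2 t.+1 o 0 j) measurable
           end)].

(** Extragradient iterates [u_t] ($t\ge0$) and [w_t] ($t\ge1$) driven by the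
    stochastic operators [F1 t], [F2 t] of step $t\ge1$. *)

Definition half_step (R : realType) (d : nat) (W : set 'rV[R]_d) (gamma : R)
    (G : 'rV[R]_d -> 'rV[R]_d) (u v : 'rV[R]_d) : 'rV[R]_d :=
  euclid_proj W (u - gamma *: G v).

Fixpoint nseg_u (R : realType) (d : nat) (W : set 'rV[R]_d)
    (gamma : nat -> R) (F1 F2 : nat -> 'rV[R]_d -> 'rV[R]_d)
    (u0 : 'rV[R]_d) (t : nat) : 'rV[R]_d :=
  if t is s.+1 then
    let u := nseg_u W gamma F1 F2 u0 s in
    let w := half_step W (gamma t) (F1 t) u u in
    half_step W (gamma t) (F2 t) u w
  else u0.

Definition nseg_w (R : realType) (d : nat) (W : set 'rV[R]_d)
    (gamma : nat -> R) (F1 F2 : nat -> 'rV[R]_d -> 'rV[R]_d)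
    (u0 : 'rV[R]_d) (t : nat) : 'rV[R]_d :=
  let u := nseg_u W gamma F1 F2 u0 t.-1 in half_step W (gamma t) (F1 t) u u.

(** Output $\mathcal{A}(\mathbf{S})$ of sampled-with-replacement NSEG on the data
    set [S], for the outcome [o] of the internal randomness. *)
Definition nseg (R : realType) (d n : nat) (Z O : Type) (W : set 'rV[R]_d)
    (F : Z -> 'rV[R]_d -> 'rV[R]_d) (u0 : 'rV[R]_d) (gamma : nat -> R)
    (T : nat) (i1 i2 : nat -> O -> 'I_n) (xi1 xi2 : nat -> O -> 'rV[R]_d)
    (o : O) (S : n.-tuple Z) : 'rV[R]_d :=
  let F1 t v := F (tnth S (i1 t o)) v + xi1 t o in
  let F2 t v := F (tnth S (i2 t o)) v + xi2 t o in
  (\sum_(1 <= t < T.+1) gamma t)^-1 *: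
    \sum_(1 <= t < T.+1) gamma t *: nseg_w W gamma F1 F2 u0 t.

Definition mean_operator (R : realType) (d : nat) (dZ : measure_display)
    (Z : measurableType dZ) (P : probability Z R)
    (F : Z -> 'rV[R]_d -> 'rV[R]_d) (w : 'rV[R]_d) : 'rV[R]_d :=
  \row_j fine 'E_P[fun b => F b w 0 j].

Definition mean_function (R : realType) (d1 d2 : nat) (dZ : measure_display)
    (Z : measurableType dZ) (P : probability Z R)
    (f : Z -> 'rV[R]_d1 -> 'rV[R]_d2 -> R) (x : 'rV[R]_d1) (y : 'rV[R]_d2) :
    R :=
  fine 'E_P[fun b => f b x y].

(** Weak gaps.  [PA] is the law of the internal randomness and [PS] that of the
    data; the iterated expectation encodes their independence. *)

Definition weak_gap_VI (R : realType) (d : nat) (dO dS : measure_display)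
    (O : measurableType dO) (DS : measurableType dS) (PA : probability O R)
    (PS : probability DS R) (W : set 'rV[R]_d)
    (A : O -> DS -> 'rV[R]_d) (F : 'rV[R]_d -> 'rV[R]_d) : \bar R :=
  (\int[PA]_o
     ereal_sup [set 'E_PS[fun S => (dotv (F w) (A o S - w))%R] | w in W])%E.

Definition weak_gap_SP (R : realType) (d1 d2 : nat) (dO dS : measure_display)
    (O : measurableType dO) (DS : measurableType dS) (PA : probability O R)
    (PS : probability DS R) (X : set 'rV[R]_d1) (Y : set 'rV[R]_d2)
    (A : O -> DS -> 'rV[R]_(d1 + d2)) (f : 'rV[R]_d1 -> 'rV[R]_d2 -> R) :
    \bar R :=
  (\int[PA]_o
     ereal_sup [set 'E_PS[fun S => (f (lsubmx (A o S)) y - f x (rsubmx (A o S)))%R]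
               | x in X & y in Y])%E.

(** The saddle-point operators on $X\times Y\subseteq\mathbb{R}^{d_1+d_2}$. *)

Definition setXmx (R : realType) (d1 d2 : nat) (X : set 'rV[R]_d1)
    (Y : set 'rV[R]_d2) : set 'rV[R]_(d1 + d2) :=
  [set row_mx x y | x in X & y in Y].

Definition sp_operator (R : realType) (d1 d2 : nat) (Z : Type)
    (gx : Z -> 'rV[R]_d1 -> 'rV[R]_d2 -> 'rV[R]_d1)
    (gy : Z -> 'rV[R]_d1 -> 'rV[R]_d2 -> 'rV[R]_d2)
    (b : Z) (w : 'rV[R]_(d1 + d2)) : 'rV[R]_(d1 + d2) :=
  row_mx (gx b (lsubmx w) (rsubmx w)) (- gy b (lsubmx w) (rsubmx w)).

(** Stochastic variational inequality instance. *)
Definition svi_instance (R : realType) (d : nat) (dZ : measure_display)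
    (Z : measurableType dZ) (W : set 'rV[R]_d) (D L M : R)
    (F : Z -> 'rV[R]_d -> 'rV[R]_d) : Prop :=
  [/\ compact W, convex_set W, D = diameter W,
      forall b, monotone_class W L M (F b)
    & forall w (j : 'I_d), W w -> measurable_fun setT (fun b => F b w 0 j)].

(** Stochastic saddle-point instance; [gx], [gy] are the partial gradients
    $\nabla_x f_\beta$, $\nabla_y f_\beta$. *)
Definition ssp_instance (R : realType) (d1 d2 : nat) (dZ : measure_display)
    (Z : measurableType dZ) (P : probability Z R) (X : set 'rV[R]_d1)
    (Y : set 'rV[R]_d2) (D Lx Ly M : R)
    (f : Z -> 'rV[R]_d1 -> 'rV[R]_d2 -> R)
    (gx : Z -> 'rV[R]_d1 -> 'rV[R]_d2 -> 'rV[R]_d1)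
    (gy : Z -> 'rV[R]_d1 -> 'rV[R]_d2 -> 'rV[R]_d2) : Prop :=
  [/\ [/\ compact X, convex_set X, compact Y & convex_set Y],
      (forall b y, Y y -> convex_function X (f b ^~ y)) /\
      (forall b x, X x -> convex_function Y (fun y => - f b x y)),
      forall b x y, X x -> Y y ->
        is_gradient X (f b ^~ y) x (gx b x y) /\
        is_gradient Y (f b x) y (gy b x y),
      forall b x y x' y', X x -> Y y -> X x' -> Y y' ->
        let r := enorm (row_mx x y - row_mx x' y') in
        enorm (gx b x y - gx b x' y') <= Lx * r /\
        enorm (gy b x y - gy b x' y') <= Ly * r
    & (forall x y, X x -> Y y ->
        P.-integrable setT (fun b => (f b x y)%:E)) /\
      svi_instance (setXmx X Y) D (Num.sqrt (Lx ^+ 2 + Ly ^+ 2)) M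
        (sp_operator gx gy)].

Definition nseg_stepsize (R : realType) (d n : nat) (D L M eps eta : R) : R :=
  Num.min (D / M) L^-1 /
  (n%:R * Num.max (Num.sqrt n%:R) (Num.sqrt (d%:R * ln eta^-1) / eps)).

(** Standard deviation $\sigma_t$. *)
Definition nseg_sigma (R : realType) (M eps eta : R) : R :=
  Num.sqrt (8 * M ^+ 2 * ln eta^-1 / eps ^+ 2).

Definition nseg_rate (R : realType) (d n : nat) (D L M eps eta : R) : R :=
  (M * D + L * D ^+ 2) *
    Num.max (Num.sqrt n%:R)^-1 (Num.sqrt (d%:R * ln eta^-1) / (n%:R * eps)) +
  M * L * D / n%:R `^ (5 / 2).

(* Main.v *)
From HB Require Import structures.
Require Import Defs.
From mathcomp Require Import all_boot all_order all_algebra.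
From mathcomp Require Import all_classical all_reals all_analysis.
From mathcomp Require Import measurable_realfun ring lra.
Set Implicit Arguments.
Unset Strict Implicit.
Unset Printing Implicit Defensive.
Import Order.TTheory GRing.Theory Num.Theory numFieldNormedType.Exports.
Local Open Scope classical_set_scope.
Local Open Scope ring_scope.

(** Fix the internal randomness.  The output is evaluated against the true mean
    operator, and the comparator does not see the data.  Redrawing the $k$-th data
    point turns it into a fresh one, so the expected loss at a fresh point is at
    most the expected empirical loss plus the amount by which the output moves
    when one data point is redrawn ([generalization]).

    The output moves little.  When both runs use the same operators, a step is
    nonexpansive up to second order in $\gamma$, thanks to monotonicity
    ([extragradient_step_stable]); a step that uses the redrawn point separates
    the runs by at most $2\gamma M$ per use.  Averaged over the $n$ positions of
    the redrawn point, the $T=n^2$ steps use it $2T/n=2n$ times, whatever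
    the sampled indices are ([mean_drift]), which costs $O(\gamma Mn)=O(D/\sqrt n)$.

    The empirical loss is a regret.  The points $u_t$ are projected gradient
    steps along the sampled operators, whence the usual bound
    $D^2/\gamma T+\gamma(M^2+|\xi|^2)$.  Passing from the sampled to the empirical
    operator leaves $\sum_t\langle\Delta_t,w_t-w\rangle$, where the comparator $w$
    may depend on the internal randomness.  A second projected gradient sequence $v_t$,
    driven by the deviations $\Delta_t$, absorbs this dependence at the cost of another regret
    ([extragradient_gap]); the remaining sum
    $\sum_t\langle\Delta_t,w_t-v_{t-1}\rangle$ does not involve $w$.

    The resulting bound is uniform in $w$, so the supremum disappears
    ([weak_gap_fixed]), and only then is the internal randomness averaged
    ([weak_gap_bound]).  The last sum has mean zero: after averaging over the
    data, each of its terms is a centered index or Gaussian coordinate of the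
    second half of a step times a function of the other coordinates
    ([random_noise_centered]).  For this the iterates must be jointly measurable in
    randomness and data, which holds because every operator is measurable in its
    random argument and Lipschitz in the point ([measurable_caratheodory]).

    Variational inequalities and saddle points enter through their losses
    $g_\beta(v,w)$, namely $\langle F_\beta(w),v-w\rangle$ and
    $f_\beta(v_x,w_y)-f_\beta(w_x,v_y)$.  Both are convex and $2M$-Lipschitz in $v$,
    vanish for $v=w$ and are at most $\langle F_\beta(v),v-w\rangle$ ([gap_function]). *)

(** * Euclidean geometry of row vectors *)

Section euclidean.
Variables (R : realType) (d : nat).
Implicit Types (u v w : 'rV[R]_d) (a : R).

Lemma dotvC u v : dotv u v = dotv v u.
Proof. by apply: eq_bigr => j _; rewrite mulrC. Qed.

Lemma dotvDl u v w : dotv (u + v) w = dotv u w + dotv v w.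
Proof. by rewrite -big_split; apply: eq_bigr => j _; rewrite mxE mulrDl. Qed.

Lemma dotvZl a u v : dotv (a *: u) v = a * dotv u v.
Proof. by rewrite /dotv mulr_sumr; apply: eq_bigr => j _; rewrite mxE mulrA. Qed.

Lemma dotvNl u v : dotv (- u) v = - dotv u v.
Proof. by rewrite -scaleN1r dotvZl mulN1r. Qed.

Lemma dotvBl u v w : dotv (u - v) w = dotv u w - dotv v w.
Proof. by rewrite dotvDl dotvNl. Qed.

Lemma dotvDr u v w : dotv u (v + w) = dotv u v + dotv u w.
Proof. by rewrite !(dotvC u) dotvDl. Qed.

Lemma dotvZr a u v : dotv u (a *: v) = a * dotv u v.
Proof. by rewrite !(dotvC u) dotvZl. Qed.

Lemma dotvNr u v : dotv u (- v) = - dotv u v.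
Proof. by rewrite !(dotvC u) dotvNl. Qed.

Lemma dotvBr u v w : dotv u (v - w) = dotv u v - dotv u w.
Proof. by rewrite !(dotvC u) dotvBl. Qed.

Definition dotvE := (dotvDl, dotvDr, dotvNl, dotvNr, dotvZl, dotvZr).

Lemma dot0v v : dotv 0 v = 0.
Proof. by rewrite -(scale0r v) dotvZl mul0r. Qed.

Lemma dotv0 v : dotv v 0 = 0.
Proof. by rewrite dotvC dot0v. Qed.

Lemma dotv_suml (I : Type) (r : seq I) (P : pred I) (f : I -> 'rV[R]_d) v :
  dotv (\sum_(i <- r | P i) f i) v = \sum_(i <- r | P i) dotv (f i) v.
Proof.
by elim/big_rec2 : _ => [|i x y _ <-]; rewrite ?dot0v// dotvDl.
Qed.

Lemma dotvv_ge0 v : 0 <= dotv v v.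
Proof. by apply: sumr_ge0 => j _; rewrite -expr2 sqr_ge0. Qed.

Lemma enorm_ge0 v : 0 <= enorm v.
Proof. exact: sqrtr_ge0. Qed.

Lemma enorm2 v : enorm v ^+ 2 = dotv v v.
Proof. by rewrite sqr_sqrtr ?dotvv_ge0. Qed.

Lemma enorm2_sum v : enorm v ^+ 2 = \sum_(j < d) v 0 j ^+ 2.
Proof. by rewrite enorm2; apply: eq_bigr => j _; rewrite expr2. Qed.

Lemma enorm0 : enorm (0 : 'rV[R]_d) = 0.
Proof. by rewrite /enorm dot0v sqrtr0. Qed.

Lemma dotvv_eq0 v : dotv v v = 0 -> v = 0.
Proof.
move=> v0; apply/rowP => j; rewrite mxE.
have := @psumr_eq0P R _ predT (fun j => v 0 j * v 0 j) _ v0 j erefl.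
by move=> /(_ (fun i _ => sqr_ge0 (v 0 i)))/eqP; rewrite mulf_eq0 orbb => /eqP.
Qed.

Lemma enorm_gt0 v : (0 < enorm v) = (v != 0).
Proof.
have [->|v0] := eqVneq v 0; first by rewrite enorm0 ltxx.
rewrite lt_neqAle enorm_ge0 andbT eq_sym; apply: contra_neq v0 => e0.
by apply: dotvv_eq0; rewrite -enorm2 e0 expr0n.
Qed.

Lemma enormN v : enorm (- v) = enorm v.
Proof. by rewrite /enorm dotvNl dotvNr opprK. Qed.

Lemma enormZ a v : enorm (a *: v) = `|a| * enorm v.
Proof.
by rewrite /enorm dotvZl dotvZr mulrA -expr2 sqrtrM ?sqr_ge0// sqrtr_sqr.
Qed.

Lemma enormBC u v : enorm (u - v) = enorm (v - u).
Proof. by rewrite -enormN opprB. Qed.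

(** Cauchy-Schwarz, read off $0 \le |{|v|}u - {|u|}v|^2$. *)
Lemma dotv_le u v : dotv u v <= enorm u * enorm v.
Proof.
have [->|v0] := eqVneq v 0; first by rewrite dotv0 enorm0 mulr0.
have [->|u0] := eqVneq u 0; first by rewrite dot0v enorm0 mul0r.
have uv : 0 < enorm u * enorm v by rewrite mulr_gt0 ?enorm_gt0.
have := dotvv_ge0 (enorm v *: u - enorm u *: v).
rewrite !dotvE (dotvC v u) -!enorm2 => h.
rewrite -(ler_pM2l uv); move: h.
set x := enorm u; set y := enorm v; set z := dotv u v => h.
nra.
Qed.

Lemma normr_dotv_le u v : `|dotv u v| <= enorm u * enorm v.
Proof. by rewrite ler_norml dotv_le andbT lerNl -dotvNl -(enormN u) dotv_le. Qed.

Lemma enormD u v : enorm (u + v) <= enorm u + enorm v.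
Proof.
rewrite -(@ler_pXn2r _ 2) ?nnegrE ?addr_ge0 ?enorm_ge0//.
rewrite enorm2 !dotvE (dotvC v u) sqrrD -!enorm2.
have := dotv_le u v; lra.
Qed.

Lemma enormB u v : enorm (u - v) <= enorm u + enorm v.
Proof. by rewrite -(enormN v) enormD. Qed.

Lemma enorm_sum (I : Type) (r : seq I) (P : pred I) (f : I -> 'rV[R]_d) :
  enorm (\sum_(i <- r | P i) f i) <= \sum_(i <- r | P i) enorm (f i).
Proof.
elim/big_ind2 : _ => [|x1 x2 y1 y2 h1 h2|//]; first by rewrite enorm0.
by rewrite (le_trans (enormD _ _))// lerD.
Qed.

Lemma sqr_enormD u v : enorm (u + v) ^+ 2 <= 2 * enorm u ^+ 2 + 2 * enorm v ^+ 2.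
Proof.
have := enormD u v; have := enorm_ge0 (u + v).
set x := enorm u; set y := enorm v; set z := enorm (u + v) => z0 h.
have : z ^+ 2 <= (x + y) ^+ 2 by rewrite ler_pXn2r ?nnegrE ?(le_trans z0).
have := sqr_ge0 (x - y); nra.
Qed.

Lemma normr_coord_le v j : `|v 0 j| <= enorm v.
Proof.
rewrite -sqrtr_sqr ler_wsqrtr// -enorm2 enorm2_sum (bigD1 j)//= lerDl.
by apply: sumr_ge0 => i _; rewrite sqr_ge0.
Qed.

Lemma enorm_le_sum v : enorm v <= \sum_(j < d) `|v 0 j|.
Proof.
rewrite {1}(row_sum_delta v) (le_trans (enorm_sum _ _ _))//.
apply: ler_sum => j _; rewrite enormZ -[leRHS]mulr1 ler_wpM2l//.
rewrite /enorm /dotv (bigD1 j)//= big1 => [|i /negbTE ij].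
  by rewrite !mxE !eqxx mulr1 addr0 sqrtr1.
by rewrite !mxE ij mulr0.
Qed.

Lemma enorm_le_bound v e : 0 <= e -> (forall j, `|v 0 j| <= e) ->
  enorm v <= d%:R * e.
Proof.
move=> e0 ve; rewrite (le_trans (enorm_le_sum v))//.
rewrite (le_trans (ler_sum _ (fun j _ => ve j)))//.
by rewrite sumr_const card_ord mulr_natl.
Qed.

(** Although ['rV[R]_d] carries the topology of the max norm, the Euclidean
    norm is continuous for it, being polynomial in the coordinates. *)
Lemma continuous_dotv (f g : 'rV[R]_d -> 'rV[R]_d) :
  continuous f -> continuous g -> continuous (fun v => dotv (f v) (g v)).
Proof.
move=> cf cg.
apply: (@continuous_big _ _ _ _ predT _ _ _ (fun j v => f v 0 j * g v 0 j)).
  by move=> x; apply: cvgD; [exact: cvg_fst|exact: cvg_snd].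
move=> j _ x; apply: cvgM; first exact: nbhs_filter.
  apply: (@continuous_comp _ _ _ f (fun M : 'rV[R]_d => M 0 j)); first exact: cf.
  exact: coord_continuous.
apply: (@continuous_comp _ _ _ g (fun M : 'rV[R]_d => M 0 j)); first exact: cg.
exact: coord_continuous.
Qed.

Lemma continuous_enorm (f : 'rV[R]_d -> 'rV[R]_d) :
  continuous f -> continuous (fun v => enorm (f v)).
Proof.
move=> cf x.
apply: (@continuous_comp _ _ _ (fun v => dotv (f v) (f v)) Num.sqrt).
  exact: continuous_dotv.
exact: sqrt_continuous.
Qed.

End euclidean.

(** * Projections on a compact convex set *)

Lemma convex_set_comb (R : realType) (d : nat) (W : set 'rV[R]_d) x y (t : R) :
  convex_set W -> W x -> W y -> 0 <= t <= 1 -> W (t *: x + (1 - t) *: y).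
Proof.
move=> cW Wx Wy /andP[t0 t1].
have := cW x y (Itv01 t0 t1); rewrite !inE => /(_ Wx Wy).
by rewrite /conv/= /Itv.num_sem.
Qed.

(** Jensen's inequality for uniform averages. *)
Lemma convex_mean (R : realType) (d : nat) (W : set 'rV[R]_d)
    (h : 'rV[R]_d -> R) (v : nat -> 'rV[R]_d) (n : nat) :
  (0 < n)%N -> convex_set W ->
  (forall x y t, W x -> W y -> 0 <= t <= 1 ->
    h (t *: x + (1 - t) *: y) <= t * h x + (1 - t) * h y) ->
  (forall i, (i < n)%N -> W (v i)) ->
  W (n%:R^-1 *: \sum_(i < n) v i) /\
  h (n%:R^-1 *: \sum_(i < n) v i) <= n%:R^-1 * \sum_(i < n) h (v i).
Proof.
case: n => // n _ cW hconv; elim: n => [|n IHn] Wv.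
  by rewrite !big_ord1 invr1 scale1r mul1r; split => //; exact: Wv.
have [Wm hm] := IHn (fun i ik => Wv i (ltnW ik)).
set m := _ *: _ in Wm hm.
pose t : R := n.+1%:R / n.+2%:R.
have n1 : n.+1%:R != 0 :> R by rewrite pnatr_eq0.
have n2 : n.+2%:R != 0 :> R by rewrite pnatr_eq0.
have t01 : 0 <= t <= 1.
  by rewrite divr_ge0//= ler_pdivrMr ?ltr0Sn// mul1r ler_nat.
have t1 : 1 - t = n.+2%:R^-1.
  by rewrite /t; apply: (mulIf n2); rewrite mulVf// mulrBl mul1r divfK// -natrB// subSnn.
have tm : t * n.+1%:R^-1 = n.+2%:R^-1 by rewrite /t mulrAC divff// mul1r.
have eqm : n.+2%:R^-1 *: \sum_(i < n.+2) v i = t *: m + (1 - t) *: v n.+1.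
  by rewrite big_ord_recr/= scalerDr t1 /m scalerA tm.
rewrite eqm; split; first by apply: convex_set_comb => //; exact: Wv.
have := hconv _ _ _ Wm (Wv n.+1 (leqnn _)) t01 => /le_trans; apply.
rewrite big_ord_recr/= mulrDr t1 lerD2r -tm -(mulrA t) ler_wpM2l//.
by case/andP: t01.
Qed.

Section projection.
Variables (R : realType) (d : nat) (W : set 'rV[R]_d).
Hypotheses (cW : compact W) (convW : convex_set W) (W0 : W !=set0).
Local Notation Pi := (euclid_proj W).

Lemma euclid_projP v :
  W (Pi v) /\ forall q, W q -> enorm (v - Pi v) <= enorm (v - q).
Proof.
rewrite /euclid_proj; case: xgetP => [p _ []//|noP]; exfalso.
have [|p pW pmin] := @EVT_min_rV R d (fun q => enorm (v - q)) W W0 cW.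
  apply: continuous_subspaceT.
  apply: (@continuous_enorm _ _ (fun q => v - q)) => x.
  by apply: cvgB; [exact: nbhs_filter|exact: cst_continuous|exact: cvg_id].
apply: (noP p); split; first exact: set_mem.
by move=> q Wq; apply: pmin; exact: mem_set.
Qed.

Lemma euclid_proj_in v : W (Pi v).
Proof. by case: (euclid_projP v). Qed.

(** Were $a=\langle v-p,q-p\rangle>0$ for the nearest point $p$, moving from
    $p$ towards $q$ by the fraction $a/|q-p|^2$ would come closer to $v$. *)
Lemma euclid_proj_obtuse v q : W q -> dotv (v - Pi v) (q - Pi v) <= 0.
Proof.
move=> Wq; have [Wp pmin] := euclid_projP v.
set p := Pi v in Wp pmin *; set a := dotv _ _.
have key t : 0 <= t <= 1 -> 2 * a * t <= enorm (q - p) ^+ 2 * t ^+ 2.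
  move=> t01; have /pmin := convex_set_comb convW Wq Wp t01.
  rewrite -(@ler_pXn2r _ 2) ?nnegrE ?enorm_ge0// !enorm2.
  have -> : v - (t *: q + (1 - t) *: p) = (v - p) - t *: (q - p).
    by apply/rowP => j; rewrite !mxE; ring.
  by rewrite !(dotvDl (v - p)) !(dotvDr _ (v - p)) !dotvNl !dotvNr !dotvZl !dotvZr
    (dotvC (q - p) (v - p)) -/a; nra.
rewrite leNgt; apply/negP => a0.
have := key 1; rewrite lexx ler01 => /(_ isT); set N := enorm _ ^+ 2 => h1.
have N0 : 0 < N by nra.
have aN : 0 <= a / N <= 1.
  by rewrite (divr_ge0 (ltW a0) (ltW N0))/= ler_pdivrMr// mul1r; nra.
have := key _ aN.
have -> : N * (a / N) ^+ 2 = a * (a / N) by field; rewrite gt_eqF.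
have : 0 < a / N by rewrite divr_gt0.
by nra.
Qed.

(** Adding the obtuse angle inequalities at the projections $p$ of $u$ and $q$ of
    $v$ gives $|p-q|^2\le\langle u-v,p-q\rangle$. *)
Lemma euclid_proj_nonexp u v : enorm (Pi u - Pi v) <= enorm (u - v).
Proof.
have h1 := euclid_proj_obtuse u (euclid_proj_in v).
have h2 := euclid_proj_obtuse v (euclid_proj_in u).
set p := Pi u in h1 h2 *; set q := Pi v in h1 h2 *.
have h : enorm (p - q) ^+ 2 <= dotv (u - v) (p - q).
  rewrite enorm2; move: h1 h2; rewrite !dotvE (dotvC q p); lra.
have [->|pq0] := eqVneq (p - q) 0; first by rewrite enorm0 enorm_ge0.
have pq : 0 < enorm (p - q) by rewrite enorm_gt0.
by rewrite -(ler_pM2r pq) -expr2 (le_trans h)// dotv_le.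
Qed.

Lemma euclid_proj_id v : W v -> Pi v = v.
Proof.
move=> Wv; have [_ /(_ _ Wv)] := euclid_projP v.
rewrite subrr enorm0 => h; apply/esym/eqP; rewrite -subr_eq0.
by apply: contraTT h; rewrite -enorm_gt0 ltNge.
Qed.

(** Compactness makes the set of distances bounded, so that the supremum that
    defines the diameter is an upper bound. *)
Lemma le_diameter w1 w2 : W w1 -> W w2 -> enorm (w1 - w2) <= diameter W.
Proof.
move=> Ww1 Ww2.
have [|c cinW cmax] := @EVT_max_rV R d (fun q => enorm (q - w1)) W W0 cW.
  apply: continuous_subspaceT.
  apply: (@continuous_enorm _ _ (fun q => q - w1)) => x.
  by apply: cvgB; [exact: nbhs_filter|exact: cvg_id|exact: cst_continuous].
apply: ub_le_sup; last by exists w1 => //; exists w2.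
exists (enorm (c - w1) + enorm (c - w1)) => _ [a Wa [b Wb <-]].
have -> : a - b = (a - w1) - (b - w1) by rewrite opprB addrA subrK.
rewrite (le_trans (enormB _ _))// lerD//; apply: cmax; exact: mem_set.
Qed.

End projection.

(** * Regret of projected gradient steps and of the extragradient method *)

Section regret.
Variables (R : realType) (d : nat) (W : set 'rV[R]_d) (D gamma : R).
Hypotheses (cW : compact W) (convW : convex_set W).
Hypothesis DW : forall w1 w2, W w1 -> W w2 -> enorm (w1 - w2) <= D.
Hypothesis gamma0 : 0 < gamma.
Local Notation Pi := (euclid_proj W).

(** The distance to $p$ decreases by $2\gamma\langle h,v-p\rangle$ at each
    step, up to $\gamma^2|h|^2$. *)
Lemma gradient_regret (v h : nat -> 'rV[R]_d) (p : 'rV[R]_d) (T : nat) :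
  W (v 0%N) -> W p ->
  (forall t, v t.+1 = Pi (v t - gamma *: h t)) ->
  \sum_(t < T) dotv (h t) (v t - p) <=
    D ^+ 2 / (2 * gamma) + gamma / 2 * \sum_(t < T) enorm (h t) ^+ 2.
Proof.
move=> Wv0 Wp vE; have W0 : W !=set0 by exists p.
have tele : 2 * gamma * \sum_(t < T) dotv (h t) (v t - p) <=
    enorm (v 0%N - p) ^+ 2 - enorm (v T - p) ^+ 2 +
    gamma ^+ 2 * \sum_(t < T) enorm (h t) ^+ 2.
  elim: T => [|T IHT]; first by rewrite !big_ord0 !mulr0 subrr addr0.
  rewrite !big_ord_recr/= !mulrDr.
  have : enorm (v T.+1 - p) ^+ 2 <= enorm (v T - gamma *: h T - p) ^+ 2.
    rewrite ler_pXn2r ?nnegrE ?enorm_ge0// vE.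
    by rewrite -{1}(euclid_proj_id cW W0 Wp) euclid_proj_nonexp.
  have -> : v T - gamma *: h T - p = (v T - p) - gamma *: h T by rewrite addrAC.
  move: IHT; move: (v T - p) => a IHT.
  rewrite [enorm (a - _) ^+ 2]enorm2 !dotvE -!enorm2 (dotvC a (h T)).
  by move: IHT; set S1 := \sum_(_ < T) _; nra.
have D2 : enorm (v 0%N - p) ^+ 2 <= D ^+ 2.
  have := DW Wv0 Wp; have := enorm_ge0 (v 0%N - p); nra.
have g2 : 0 < 2 * gamma by rewrite mulr_gt0.
rewrite -(ler_pM2l g2) (le_trans tele)//.
have -> : 2 * gamma * (D ^+ 2 / (2 * gamma) + gamma / 2 * \sum_(t < T) enorm (h t) ^+ 2)
   = D ^+ 2 + gamma ^+ 2 * \sum_(t < T) enorm (h t) ^+ 2.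
  by field; rewrite gt_eqF.
by rewrite lerD2r; have := sqr_ge0 (enorm (v T - p)); lra.
Qed.

Variables (F1 F2 : nat -> 'rV[R]_d -> 'rV[R]_d) (u0 : 'rV[R]_d).
Hypothesis Wu0 : W u0.
Local Notation u := (nseg_u W (fun=> gamma) F1 F2 u0).
Local Notation w := (nseg_w W (fun=> gamma) F1 F2 u0).

Let W0 : W !=set0. Proof. by exists u0. Qed.

Lemma nseg_uS t : u t.+1 = Pi (u t - gamma *: F2 t.+1 (w t.+1)).
Proof. by []. Qed.

Lemma nseg_wS t : w t.+1 = Pi (u t - gamma *: F1 t.+1 (u t)).
Proof. by []. Qed.

Lemma nseg_u_in t : W (u t).
Proof. by case: t => [//|t]; exact: euclid_proj_in. Qed.

Lemma nseg_w_in t : W (w t).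
Proof. exact: euclid_proj_in. Qed.

Lemma nseg_w_near t : enorm (w t.+1 - u t) <= gamma * enorm (F1 t.+1 (u t)).
Proof.
have := euclid_proj_nonexp cW convW W0 (u t - gamma *: F1 t.+1 (u t)) (u t).
rewrite -nseg_wS (euclid_proj_id cW W0 (nseg_u_in t)) addrAC subrr add0r.
by rewrite enormN enormZ gtr0_norm.
Qed.

(** The gradient is evaluated at the extrapolated point $w_t$ instead of
    $u_{t-1}$, which costs $\langle h_t,w_t-u_{t-1}\rangle\le
    \gamma|h_t||F_{1,t}(u_{t-1})|$. *)
Lemma extragradient_regret (p : 'rV[R]_d) (T : nat) : W p ->
  \sum_(t < T) dotv (F2 t.+1 (w t.+1)) (w t.+1 - p) <=
    D ^+ 2 / (2 * gamma) +
    gamma * \sum_(t < T) (enorm (F2 t.+1 (w t.+1)) ^+ 2 +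
                          enorm (F1 t.+1 (u t)) ^+ 2 / 2).
Proof.
move=> Wp; pose h t := F2 t.+1 (w t.+1).
have reg := @gradient_regret u h p T Wu0 Wp nseg_uS.
have -> : \sum_(t < T) dotv (F2 t.+1 (w t.+1)) (w t.+1 - p) =
   \sum_(t < T) dotv (h t) (u t - p) + \sum_(t < T) dotv (h t) (w t.+1 - u t).
  rewrite -big_split/=; apply: eq_bigr => t _.
  by rewrite -dotvDr; congr (dotv _ _); rewrite [RHS]addrC addrA subrK.
have extra : \sum_(t < T) dotv (h t) (w t.+1 - u t) <=
    \sum_(t < T) gamma / 2 * (enorm (h t) ^+ 2 + enorm (F1 t.+1 (u t)) ^+ 2).
  apply: ler_sum => t _; rewrite (le_trans (dotv_le _ _))//.
  have := nseg_w_near t; have := enorm_ge0 (h t); have := enorm_ge0 (w t.+1 - u t).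
  set a := enorm (h t); set b := enorm _; set c := enorm (F1 _ _) => b0 a0 bc.
  rewrite (@le_trans _ _ (a * (gamma * c)))// ?ler_wpM2l//.
  by have := mulr_ge0 (ltW gamma0) (sqr_ge0 (a - c)); nra.
rewrite (le_trans (lerD reg extra))// -addrA lerD2l -!mulr_sumr !big_split/=.
rewrite -mulr_suml -/h; set S1 := \sum_(_ < T) _; set S2 := \sum_(_ < T) _.
by rewrite le_eqVlt; apply/orP; left; apply/eqP; field.
Qed.

Variable Phi : 'rV[R]_d -> 'rV[R]_d.

(** The deviation of the sampled operator from the operator [Phi] of interest,
    at the points produced by the method. *)
Definition deviation t := Phi (w t.+1) - F2 t.+1 (w t.+1).

(** Auxiliary projected steps along the deviations.  In the sum
    $\sum_t\langle\Delta_t,w_t-p\rangle$ the comparator $p$ may be chosen after the noise,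
    so the sum is not centered; replacing $p$ by these points, which only
    depend on the past, leaves a centered sum, at the price of a regret. *)
Fixpoint ghost t := if t is s.+1 then Pi (ghost s - gamma *: deviation s) else u0.

Lemma ghost_in t : W (ghost t).
Proof. by case: t => [//|t]; exact: euclid_proj_in. Qed.

(** Split $\langle\Phi(w_t),w_t-p\rangle$ into the sampled operator against $w_t-p$,
    the deviation against $v_{t-1}-p$ and the deviation against $w_t-v_{t-1}$,
    where $v$ are the auxiliary points.  The first two sums are regrets. *)
Lemma extragradient_gap (p : 'rV[R]_d) (T : nat) : W p ->
  \sum_(t < T) dotv (Phi (w t.+1)) (w t.+1 - p) <=
    D ^+ 2 / gamma +
    gamma * \sum_(t < T) (enorm (F2 t.+1 (w t.+1)) ^+ 2 +
       enorm (F1 t.+1 (u t)) ^+ 2 / 2 + enorm (deviation t) ^+ 2 / 2) +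
    \sum_(t < T) dotv (deviation t) (w t.+1 - ghost t).
Proof.
move=> Wp.
have reg1 := extragradient_regret T Wp.
have reg2 := @gradient_regret ghost deviation p T Wu0 Wp (fun=> erefl).
have -> : \sum_(t < T) dotv (Phi (w t.+1)) (w t.+1 - p) =
   \sum_(t < T) dotv (F2 t.+1 (w t.+1)) (w t.+1 - p) +
   \sum_(t < T) dotv (deviation t) (ghost t - p) +
   \sum_(t < T) dotv (deviation t) (w t.+1 - ghost t).
  rewrite -!big_split/=; apply: eq_bigr => t _.
  rewrite -addrA -dotvDr.
  have -> : ghost t - p + (w t.+1 - ghost t) = w t.+1 - p.
    by rewrite addrC addrA subrK.
  by rewrite -dotvDl /deviation [F2 _ _ + _]addrC subrK.
rewrite lerD2r (le_trans (lerD reg1 reg2))// [leRHS]addrC.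
rewrite [X in _ <= _ * X + _]big_split/= -[X in _ <= _ * (_ + X) + _]mulr_suml.
set S1 := \sum_(_ < T) _; set S2 := \sum_(_ < T) _.
by rewrite le_eqVlt; apply/orP; left; apply/eqP; field; rewrite gt_eqF.
Qed.

End regret.

(** * Stability of the extragradient method *)

Section stability.
Variables (R : realType) (d : nat) (W : set 'rV[R]_d) (D L M gamma : R).
Hypotheses (cW : compact W) (convW : convex_set W).
Hypothesis DW : forall w1 w2, W w1 -> W w2 -> enorm (w1 - w2) <= D.
Hypotheses (gamma0 : 0 < gamma) (L0 : 0 < L) (M0 : 0 < M) (gL : gamma * L <= 1).
Local Notation Pi := (euclid_proj W).

(** With the same operators, a step is nonexpansive up to second order in
    $\gamma$.  By monotonicity at $w,w'$ the cross term
    $-2\gamma\langle G_2w-G_2w',u-u'\rangle$ is at most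
    $2\gamma L|w-w'|\cdot|(u-w)-(u'-w')|$, where the last factor is
    $O(\gamma(M+|\xi_1|))$. *)
Lemma extragradient_step_stable (G1 G2 : 'rV[R]_d -> 'rV[R]_d)
    (x1 x2 u u' w w' : 'rV[R]_d) :
  monotone_class W L M G1 -> monotone_class W L M G2 -> W u -> W u' ->
  w = Pi (u - gamma *: (G1 u + x1)) -> w' = Pi (u' - gamma *: (G1 u' + x1)) ->
  enorm (Pi (u - gamma *: (G2 w + x2)) - Pi (u' - gamma *: (G2 w' + x2))) <=
    enorm (u - u') + 2 * gamma ^+ 2 * L ^+ 2 * D +
    4 * gamma ^+ 2 * L * (M + enorm x1).
Proof.
move=> [_ lip1 bnd1] [mon2 lip2 _] Wu Wu' wE w'E.
have W0 : W !=set0 by exists u.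
have nonexp := euclid_proj_nonexp cW convW W0.
have projW := euclid_proj_in cW W0.
have projK := euclid_proj_id cW W0.
have Ww : W w by rewrite wE.
have Ww' : W w' by rewrite w'E.
set a := enorm (u - u').
have a0 : 0 <= a by exact: enorm_ge0.
have aD : a <= D by exact: DW.
have gL0 : 0 < gamma * L by exact: mulr_gt0.
have dist_w v : W v -> enorm (v - Pi (v - gamma *: (G1 v + x1))) <= gamma * (M + enorm x1).
  move=> Wv; rewrite -{1}(projK _ Wv) (le_trans (nonexp _ _))//.
  rewrite opprD opprK addrA subrr add0r enormZ gtr0_norm// ler_pM2l//.
  by rewrite (le_trans (enormD _ _))// lerD2r bnd1.
set m := M + enorm x1 in dist_w *.
have m0 : 0 < m by rewrite ltr_wpDr ?enorm_ge0.
have b_le : enorm (w - w') <= 2 * a.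
  rewrite wE w'E (le_trans (nonexp _ _))//.
  have -> : u - gamma *: (G1 u + x1) - (u' - gamma *: (G1 u' + x1)) =
      (u - u') - gamma *: (G1 u - G1 u').
    by apply/rowP => j; rewrite !mxE; ring.
  rewrite (le_trans (enormB _ _))// enormZ gtr0_norm//.
  have := lip1 _ _ Wu Wu'; rewrite -/a => h.
  have : gamma * enorm (G1 u - G1 u') <= gamma * (L * a) by rewrite ler_pM2l.
  have : gamma * L * a <= 1 * a by rewrite ler_wpM2r.
  rewrite -/a; lra.
have c_le : enorm ((u - w) - (u' - w')) <= 2 * gamma * m.
  rewrite (le_trans (enormB _ _))//.
  have := dist_w _ Wu; have := dist_w _ Wu'; rewrite -wE -w'E; lra.
have Y0 : 0 <= a + 2 * gamma ^+ 2 * L ^+ 2 * a + 4 * gamma ^+ 2 * L * m.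
  rewrite !addr_ge0// !mulr_ge0 ?(ltW gamma0) ?(ltW L0) ?(ltW M0) ?(ltW m0)//.
suff : enorm (Pi (u - gamma *: (G2 w + x2)) - Pi (u' - gamma *: (G2 w' + x2)))
    <= a + 2 * gamma ^+ 2 * L ^+ 2 * a + 4 * gamma ^+ 2 * L * m.
  move=> /le_trans; apply; rewrite lerD2r lerD2l ler_wpM2l//.
  by rewrite !mulr_ge0 ?(ltW gamma0) ?(ltW L0) ?(ltW M0).
rewrite (le_trans (nonexp _ _))//.
have -> : u - gamma *: (G2 w + x2) - (u' - gamma *: (G2 w' + x2)) =
    (u - u') - gamma *: (G2 w - G2 w').
  by apply/rowP => j; rewrite !mxE; ring.
rewrite -(@ler_pXn2r _ 2) ?nnegrE ?enorm_ge0//.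
have mono := mon2 _ _ Ww Ww'; have lip := lip2 _ _ Ww Ww'.
set g := G2 w - G2 w' in mono lip *.
have cross : - (L * enorm (w - w') * (2 * gamma * m)) <= dotv g (u - u').
  have -> : u - u' = (w - w') + ((u - w) - (u' - w')).
    by apply/rowP => j; rewrite !mxE; ring.
  rewrite dotvDr -[leLHS]add0r lerD// lerNl -dotvNr (le_trans (dotv_le _ _))//.
  by rewrite enormN ler_pM ?enorm_ge0.
have -> : enorm (u - u' - gamma *: g) ^+ 2 =
    a ^+ 2 - 2 * gamma * dotv g (u - u') + gamma ^+ 2 * enorm g ^+ 2.
  rewrite /a; move: (u - u') (g) => y z; rewrite enorm2 !dotvE -!enorm2 (dotvC y z); ring.
set b := enorm (w - w') in b_le cross lip *.
have b0 : 0 <= b by exact: enorm_ge0.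
have g2 : enorm g ^+ 2 <= (L * (2 * a)) ^+ 2.
  rewrite ler_pXn2r ?nnegrE ?enorm_ge0 ?mulr_ge0 ?(ltW L0)//.
  by rewrite (le_trans lip)// ler_pM2l.
have cross' : - dotv g (u - u') <= L * (2 * a) * (2 * gamma * m).
  rewrite lerNl (le_trans _ cross)// lerN2 ler_wpM2r ?ler_pM2l//.
  by rewrite !mulr_ge0 ?(ltW gamma0) ?(ltW m0).
have cross2 : 2 * gamma * (- dotv g (u - u')) <= 2 * gamma * (L * (2 * a) * (2 * gamma * m)).
  by rewrite ler_pM2l// mulr_gt0.
have g22 : gamma ^+ 2 * enorm g ^+ 2 <= gamma ^+ 2 * (L * (2 * a)) ^+ 2.
  by rewrite ler_wpM2l ?sqr_ge0.
set p := gamma ^+ 2 * L ^+ 2; set q := gamma ^+ 2 * L * m.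
have p0 : 0 <= p by rewrite mulr_ge0 ?sqr_ge0.
have q0 : 0 <= q by rewrite !mulr_ge0 ?(ltW gamma0) ?(ltW L0) ?(ltW m0).
have -> : a + 2 * gamma ^+ 2 * L ^+ 2 * a + 4 * gamma ^+ 2 * L * m = a + 2 * p * a + 4 * q.
  by rewrite /p /q; ring.
have E1 : 2 * gamma * (L * (2 * a) * (2 * gamma * m)) = 8 * a * q by rewrite /q; ring.
have E2 : gamma ^+ 2 * (L * (2 * a)) ^+ 2 = 4 * p * a ^+ 2 by rewrite /p; ring.
rewrite E1 in cross2; rewrite E2 in g22.
have -> : (a + 2 * p * a + 4 * q) ^+ 2 =
    a ^+ 2 + 4 * p * a ^+ 2 + 8 * a * q + (2 * p * a + 4 * q) ^+ 2 by ring.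
have := sqr_ge0 (2 * p * a + 4 * q).
by move: cross2 g22; rewrite mulrN; lra.
Qed.

(** The noise is common to both runs and cancels. *)
Lemma half_step_expansion (g g' x u u' : 'rV[R]_d) :
  W u -> enorm g <= M -> enorm g' <= M ->
  enorm (Pi (u - gamma *: (g + x)) - Pi (u' - gamma *: (g' + x))) <=
    enorm (u - u') + 2 * gamma * M.
Proof.
move=> Wu gM g'M; have W0 : W !=set0 by exists u.
rewrite (le_trans (euclid_proj_nonexp cW convW W0 _ _))//.
have -> : u - gamma *: (g + x) - (u' - gamma *: (g' + x)) =
    (u - u') - gamma *: (g - g').
  by apply/rowP => j; rewrite !mxE; ring.
rewrite (le_trans (enormB _ _))// lerD2l enormZ gtr0_norm//.
have : gamma * enorm (g - g') <= gamma * (M + M).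
  by rewrite ler_pM2l// (le_trans (enormB _ _))// lerD.
lra.
Qed.

Variables (G1 G2 G1' G2' : nat -> 'rV[R]_d -> 'rV[R]_d) (x1 x2 : nat -> 'rV[R]_d).
Variables (hit1 hit2 : nat -> bool) (u0 : 'rV[R]_d).
Hypotheses (G1P : forall t, monotone_class W L M (G1 t))
  (G2P : forall t, monotone_class W L M (G2 t))
  (G1'P : forall t, monotone_class W L M (G1' t))
  (G2'P : forall t, monotone_class W L M (G2' t)).
Hypotheses (G1E : forall t, ~~ hit1 t -> G1 t = G1' t)
  (G2E : forall t, ~~ hit2 t -> G2 t = G2' t).
Hypothesis Wu0 : W u0.

Local Notation u := (nseg_u W (fun=> gamma) (fun t v => G1 t v + x1 t)
  (fun t v => G2 t v + x2 t) u0).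
Local Notation u' := (nseg_u W (fun=> gamma) (fun t v => G1' t v + x1 t)
  (fun t v => G2' t v + x2 t) u0).
Local Notation w := (nseg_w W (fun=> gamma) (fun t v => G1 t v + x1 t)
  (fun t v => G2 t v + x2 t) u0).
Local Notation w' := (nseg_w W (fun=> gamma) (fun t v => G1' t v + x1 t)
  (fun t v => G2' t v + x2 t) u0).

(** How much one step can separate two runs: $2\gamma M$ for each index that
    hits the modified data point, and the second-order terms otherwise. *)
Definition drift t : R :=
  2 * gamma * M * (hit1 t)%:R + 2 * gamma * M * (hit2 t)%:R +
  2 * gamma ^+ 2 * L ^+ 2 * D + 4 * gamma ^+ 2 * L * (M + enorm (x1 t)).

Lemma drift_ge0 t : 0 <= drift t.
Proof.
have D0 : 0 <= D by rewrite -(enorm0 R d) -(subrr u0) DW.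
have := enorm_ge0 (x1 t) => x0.
by rewrite !addr_ge0// !mulr_ge0 ?ler0n ?(ltW gamma0) ?(ltW L0) ?addr_ge0 ?(ltW M0).
Qed.

Lemma nseg_u_stable t : enorm (u t - u' t) <= \sum_(s < t) drift s.+1.
Proof.
have W0 : W !=set0 by exists u0.
have uin k := nseg_u_in gamma cW (fun t v => G1 t v + x1 t)
  (fun t v => G2 t v + x2 t) Wu0 k.
have uin' k := nseg_u_in gamma cW (fun t v => G1' t v + x1 t)
  (fun t v => G2' t v + x2 t) Wu0 k.
have win k := nseg_w_in gamma cW (fun t v => G1 t v + x1 t)
  (fun t v => G2 t v + x2 t) Wu0 k.
have win' k := nseg_w_in gamma cW (fun t v => G1' t v + x1 t)
  (fun t v => G2' t v + x2 t) Wu0 k.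
elim: t => [|t IHt]; first by rewrite subrr enorm0 big_ord0.
rewrite big_ord_recr/=.
have [/andP[h1 h2]|/nandP hit] := boolP (~~ hit1 t.+1 && ~~ hit2 t.+1).
  have wE' : w' t.+1 = Pi (u' t - gamma *: (G1 t.+1 (u' t) + x1 t.+1)).
    by rewrite (G1E h1).
  have uE' : u' t.+1 = Pi (u' t - gamma *: (G2 t.+1 (w' t.+1) + x2 t.+1)).
    by rewrite (G2E h2); exact: nseg_uS.
  have step : enorm (u t.+1 - u' t.+1) <= enorm (u t - u' t) +
      2 * gamma ^+ 2 * L ^+ 2 * D + 4 * gamma ^+ 2 * L * (M + enorm (x1 t.+1)).
    rewrite [X in enorm (_ - X)]uE' [X in enorm (X - _)]nseg_uS.
    exact: (extragradient_step_stable _ (G1P _) (G2P _) (uin t) (uin' t) erefl wE').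
  have drE : drift t.+1 = 2 * gamma ^+ 2 * L ^+ 2 * D +
      4 * gamma ^+ 2 * L * (M + enorm (x1 t.+1)).
    by rewrite /drift (negbTE h1) (negbTE h2) !mulr0 !add0r.
  by rewrite drE addrA (le_trans step)// lerD2r lerD2r.
have exp := @half_step_expansion (G2 t.+1 (w t.+1)) (G2' t.+1 (w' t.+1)) (x2 t.+1)
  (u t) (u' t) (uin t).
have {}exp : enorm (u t.+1 - u' t.+1) <= enorm (u t - u' t) + 2 * gamma * M.
  by apply: exp; [case: (G2P t.+1) => _ _; apply|case: (G2'P t.+1) => _ _; apply].
have : 2 * gamma * M <= drift t.+1.
  have D0 : 0 <= D by rewrite -(enorm0 R d) -(subrr u0) DW.
  have x0 := enorm_ge0 (x1 t.+1).
  have r1 : 0 <= 2 * gamma ^+ 2 * L ^+ 2 * D.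
    by rewrite !mulr_ge0 ?(ltW gamma0) ?(ltW L0) ?(ltW M0).
  have r2 : 0 <= 4 * gamma ^+ 2 * L * (M + enorm (x1 t.+1)).
    by rewrite !mulr_ge0 ?(ltW gamma0) ?(ltW L0) ?(ltW M0) ?addr_ge0 ?(ltW M0).
  have r3 : 0 <= 2 * gamma * M by rewrite !mulr_ge0 ?(ltW gamma0) ?(ltW M0).
  rewrite /drift; case: hit; rewrite negbK => ->;
    [case: (hit2 _)|case: (hit1 _)]; rewrite /= ?mulr1 ?mulr0; lra.
lra.
Qed.

Lemma nseg_w_stable t :
  enorm (w t.+1 - w' t.+1) <= \sum_(s < t) drift s.+1 + 2 * gamma * M.
Proof.
have uin k := nseg_u_in gamma cW (fun t v => G1 t v + x1 t)
  (fun t v => G2 t v + x2 t) Wu0 k.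
have uin' k := nseg_u_in gamma cW (fun t v => G1' t v + x1 t)
  (fun t v => G2' t v + x2 t) Wu0 k.
rewrite (le_trans _ (lerD (nseg_u_stable t) (lexx _)))//.
by apply: half_step_expansion => //;
  [case: (G1P t.+1) => _ _; apply|case: (G1'P t.+1) => _ _; apply].
Qed.

Lemma nseg_mean_stable n : (0 < n)%N ->
  enorm (n%:R^-1 *: \sum_(t < n) w t.+1 - n%:R^-1 *: \sum_(t < n) w' t.+1) <=
  \sum_(s < n) drift s.+1 + 2 * gamma * M.
Proof.
move=> n0; rewrite -scalerBr -sumrB enormZ.
have nR : 0 < n%:R :> R by rewrite ltr0n.
rewrite gtr0_norm ?invr_gt0// mulrC ler_pdivrMr//.
rewrite (le_trans (enorm_sum _ _ _))//.
have -> : (\sum_(s < n) drift s.+1 + 2 * gamma * M) * n%:R =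
  \sum_(t < n) (\sum_(s < n) drift s.+1 + 2 * gamma * M).
  by rewrite sumr_const card_ord mulr_natr.
apply: ler_sum => t _; rewrite (le_trans (nseg_w_stable t))// lerD2r.
have natE k : \sum_(s < k) drift s.+1 = \sum_(0 <= s < k) drift s.+1.
  by rewrite big_mkord.
rewrite !natE [leRHS](@big_cat_nat _ _ _ t)//= ?lerDl; last exact: ltnW.
by apply: sumr_ge0 => s _; exact: drift_ge0.
Qed.

End stability.

(** * Measurability of the iterates *)

(** Measurability may be checked on each piece of a countable partition. *)
Lemma measurable_countable_family (dO : measure_display) (O : measurableType dO)
    (R : realType) (I : countType) (c : O -> I) (g : I -> O -> R) :
  (forall i, measurable (c @^-1` [set i])) ->
  (forall o, measurable_fun setT (g (c o))) ->
  measurable_fun setT (fun o => g (c o) o).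
Proof.
move=> mc mg _ B mB; rewrite setTI.
have -> : (fun o => g (c o) o) @^-1` B =
    \bigcup_i (c @^-1` [set i] `&` (g i @^-1` B)).
  apply/seteqP; split=> [ o /= Bo|o [i _ [/= <- //]]].
  by exists (c o).
apply: countable_bigcupT_measurable; first exact: countableP.
move=> i; have [-> |/set0P[ o /= co]] := eqVneq (c @^-1` [set i]) set0.
  by rewrite set0I.
apply: measurableI => //.
by have := mg o measurableT B mB; rewrite setTI co.
Qed.

Section caratheodory.
Variables (dO : measure_display) (O : measurableType dO) (R : realType) (d : nat).
Implicit Types (V : O -> 'rV[R]_d) (G : O -> 'rV[R]_d -> 'rV[R]_d).

Definition measurable_vec V := forall j, measurable_fun setT (fun o => V o 0 j).

Definition lattice_cell (m : nat) (v : 'rV[R]_d) : {ffun 'I_d -> int} :=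
  [ffun j => Num.floor (m.+1%:R * v 0 j)].

Lemma measurable_lattice_cell m V z : measurable_vec V ->
  measurable ((fun o => lattice_cell m (V o)) @^-1` [set z]).
Proof.
move=> mV.
have -> : (fun o => lattice_cell m (V o)) @^-1` [set z] =
    \bigcap_(j in [set: 'I_d]) (fun o => m.+1%:R * V o 0 j) @^-1`
       `[(z j)%:~R, (z j + 1)%:~R[%classic.
  apply/seteqP; split=> [ o /= <- j _ /=|o /= h].
    by rewrite ffunE in_itv/= floor_itv.
  apply/ffunP => j; rewrite ffunE; apply/eqP; rewrite floor_eq.
  by have := h j I; rewrite /= in_itv.
apply: fin_bigcap_measurable => [|j _]; first exact: finite_finset.
have mf : measurable_fun setT (fun o => m.+1%:R * V o 0 j).
  by apply: measurable_funM => //; exact: measurable_cst.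
by rewrite -[X in measurable X]setTI; exact: mf.
Qed.

Lemma lattice_cell_close m (v v' : 'rV[R]_d) :
  lattice_cell m v = lattice_cell m v' ->
  enorm (v - v') <= d%:R * m.+1%:R^-1.
Proof.
move=> vv'; apply: enorm_le_bound; first by rewrite invr_ge0.
move=> j; rewrite !mxE.
have := congr1 (fun f : {ffun 'I_d -> int} => f j) vv'; rewrite !ffunE => E.
have /andP[a1 a2] := floor_itv (m.+1%:R * v 0 j).
have /andP[b1 b2] := floor_itv (m.+1%:R * v' 0 j).
rewrite E in a1 a2; rewrite intrD in a2 b2.
have m0 : 0 < m.+1%:R :> R by rewrite ltr0Sn.
rewrite -(ler_pM2l m0) mulfV ?gt_eqF// -{1}(ger0_norm (ltW m0)) -normrM.
by rewrite ler_norml mulrBr; apply/andP; split; lra.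
Qed.

(** A function measurable in one argument and Lipschitz in the other is the
    limit of the functions obtained by moving the second argument to a point
    chosen in its cell of the lattice $\frac1{m+1}\mathbb Z^d$; there are
    countably many cells. *)
Lemma measurable_caratheodory (W : set 'rV[R]_d) (G : O -> 'rV[R]_d -> R) (K : R) V :
  (forall v, W v -> measurable_fun setT (G^~ v)) ->
  (forall o v v', W v -> W v' -> `|G o v - G o v'| <= K * enorm (v - v')) ->
  (forall o, W (V o)) -> measurable_vec V ->
  measurable_fun setT (fun o => G o (V o)).
Proof.
move=> mG lipG WV mV.
pose p m z := xget 0 [set v | W v /\ lattice_cell m v = z].
have pP m o : W (p m (lattice_cell m (V o))) /\
    lattice_cell m (p m (lattice_cell m (V o))) = lattice_cell m (V o).
  by rewrite /p; case: xgetP => [x _ []//|/(_ (V o))[]].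
apply: (@measurable_fun_cvg _ _ _ _
  (fun m o => G o (p m (lattice_cell m (V o))))).
  move=> m; apply: (measurable_countable_family (c := fun o => lattice_cell m (V o))
    (g := fun z o => G o (p m z))).
    by move=> z; exact: measurable_lattice_cell.
  by move=> o; apply: mG; case: (pP m o).
move=> o _; apply/subr_cvg0 => /=.
apply: (@norm_cvg0 _ R^o).
apply: (@squeeze_cvgr _ _ _ _ (fun=> 0) (fun m => `|K| * d%:R * m.+1%:R^-1)).
- apply: nearW => m; rewrite normr_ge0/= (le_trans (lipG _ _ _ _ _))//.
    by case: (pP m o).
  rewrite (@le_trans _ _ (`|K| * enorm (p m (lattice_cell m (V o)) - V o)))//.
    by rewrite ler_wpM2r ?enorm_ge0// ler_norm.
  rewrite -mulrA ler_wpM2l//.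
  by apply: lattice_cell_close; case: (pP m o).
- exact: cvg_cst.
- rewrite -(mulr0 (`|K| * d%:R)); apply: cvgMr.
  exact: cvg_harmonic.
Qed.

Lemma measurable_vecD V V' : measurable_vec V -> measurable_vec V' ->
  measurable_vec (fun o => V o + V' o).
Proof.
move=> mV mV' j; under eq_fun do rewrite mxE.
exact: measurable_funD.
Qed.

Lemma measurable_vecZ a V : measurable_vec V ->
  measurable_vec (fun o => a *: V o).
Proof.
move=> mV j; under eq_fun do rewrite mxE.
by apply: measurable_funM => //; exact: measurable_cst.
Qed.

Lemma measurable_vecB V V' : measurable_vec V -> measurable_vec V' ->
  measurable_vec (fun o => V o - V' o).
Proof.
move=> mV mV'; apply: measurable_vecD => // j; under eq_fun do rewrite mxE.
exact: measurableT_comp.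
Qed.

Lemma measurable_vec_cst v : measurable_vec (fun=> v).
Proof. by move=> j; exact: measurable_cst. Qed.

Lemma measurable_vec_sum (I : Type) (s : seq I) (V : I -> O -> 'rV[R]_d) :
  (forall i, measurable_vec (V i)) -> measurable_vec (fun o => \sum_(i <- s) V i o).
Proof.
move=> mV j; under eq_fun do rewrite summxE.
by apply: measurable_sum => i; exact: mV.
Qed.

Lemma measurable_dotv V V' : measurable_vec V -> measurable_vec V' ->
  measurable_fun setT (fun o => dotv (V o) (V' o)).
Proof. by move=> mV mV'; apply: measurable_sum => j; exact: measurable_funM. Qed.

(** The operators to which a random point of [W] may be fed. *)
Definition random_operator (W : set 'rV[R]_d) (L : R) G :=
  (forall v, W v -> measurable_vec (G^~ v)) /\
  (forall o v v', W v -> W v' -> enorm (G o v - G o v') <= L * enorm (v - v')).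

Lemma measurable_random_operator W L G V : random_operator W L G ->
  (forall o, W (V o)) -> measurable_vec V -> measurable_vec (fun o => G o (V o)).
Proof.
move=> [mG lipG] WV mV j.
apply: (@measurable_caratheodory W (fun o v => G o v 0 j) L V) => //.
- by move=> v Wv; exact: mG.
- move=> o v v' Wv Wv'; rewrite (le_trans _ (lipG o _ _ Wv Wv'))//.
  by rewrite (le_trans _ (normr_coord_le _ j))// !mxE.
Qed.

Lemma random_operatorD W L G V : random_operator W L G -> measurable_vec V ->
  random_operator W L (fun o v => G o v + V o).
Proof.
move=> [mG lipG] mV; split=> [v Wv|o v v' Wv Wv'].
  by apply: measurable_vecD => //; exact: mG.
by rewrite opprD addrACA subrr addr0 lipG.
Qed.

Variables (W : set 'rV[R]_d).
Hypotheses (cW : compact W) (convW : convex_set W).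

Lemma measurable_euclid_proj V : W !=set0 -> measurable_vec V ->
  measurable_vec (fun o => euclid_proj W (V o)).
Proof.
move=> W0 mV; apply: (@measurable_random_operator setT 1 (fun=> euclid_proj W)) => //.
split=> [v _|_ v v' _ _]; first exact: measurable_vec_cst.
by rewrite mul1r euclid_proj_nonexp.
Qed.

Variables (L gamma : R) (F1 F2 : nat -> O -> 'rV[R]_d -> 'rV[R]_d) (u0 : 'rV[R]_d).
Variables (T1 T2 : nat).
Hypothesis Wu0 : W u0.
Hypothesis F1P : forall t, (0 < t <= T1)%N -> random_operator W L (F1 t).
Hypothesis F2P : forall t, (0 < t <= T2)%N -> random_operator W L (F2 t).
Local Notation u o := (nseg_u W (fun=> gamma) (F1^~ o) (F2^~ o) u0).
Local Notation w o := (nseg_w W (fun=> gamma) (F1^~ o) (F2^~ o) u0).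

Let W0 : W !=set0. Proof. by exists u0. Qed.

Lemma measurable_nseg_w_of_u t : (t.+1 <= T1)%N ->
  measurable_vec (fun o => u o t) -> measurable_vec (fun o => w o t.+1).
Proof.
move=> tT mu; apply: measurable_euclid_proj => //; apply: measurable_vecB => //.
apply: measurable_vecZ; apply: (measurable_random_operator (F1P _)) => // o.
exact: nseg_u_in.
Qed.

Lemma measurable_nseg_u t : (t <= T1)%N -> (t <= T2)%N ->
  measurable_vec (fun o => u o t).
Proof.
elim: t => [|t IHt] tT1 tT2; first exact: measurable_vec_cst.
have mu := IHt (ltnW tT1) (ltnW tT2).
apply: measurable_euclid_proj => //; apply: measurable_vecB => //.
apply: measurable_vecZ; apply: (measurable_random_operator (F2P _)) => //.
  by move=> o; exact: nseg_w_in.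
exact: measurable_nseg_w_of_u.
Qed.

Lemma measurable_nseg_w t : (t.+1 <= T1)%N -> (t <= T2)%N ->
  measurable_vec (fun o => w o t.+1).
Proof.
by move=> tT1 tT2; apply: measurable_nseg_w_of_u => //; apply: measurable_nseg_u => //;
  exact: ltnW.
Qed.

Variable Phi : O -> 'rV[R]_d -> 'rV[R]_d.
Hypothesis PhiP : random_operator W L Phi.

Lemma measurable_deviation t : (t.+1 <= T1)%N -> (t.+1 <= T2)%N ->
  measurable_vec (fun o => deviation W gamma (F1^~ o) (F2^~ o) u0 (Phi o) t).
Proof.
move=> tT1 tT2; have mw := measurable_nseg_w tT1 (ltnW tT2).
by apply: measurable_vecB; [apply: (measurable_random_operator PhiP)|
  apply: (measurable_random_operator (F2P _))] => // o; exact: nseg_w_in.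
Qed.

Lemma measurable_ghost t : (t <= T1)%N -> (t <= T2)%N ->
  measurable_vec (fun o => ghost W gamma (F1^~ o) (F2^~ o) u0 (Phi o) t).
Proof.
elim: t => [|t IHt] tT1 tT2; first exact: measurable_vec_cst.
apply: measurable_euclid_proj => //; apply: measurable_vecB.
  exact: IHt (ltnW tT1) (ltnW tT2).
by apply: measurable_vecZ; exact: measurable_deviation.
Qed.

End caratheodory.

(** * Integrals of bounded functions, and resampling one data point *)

Section bounded_integrals.
Variables (dT : measure_display) (T : measurableType dT) (R : realType).
Variable P : probability T R.
Implicit Types (f g : T -> R) (B : R).

Lemma bounded_integrable f B : measurable_fun setT f -> (forall x, `|f x| <= B) ->
  P.-integrable setT (EFin \o f).
Proof.
move=> mf fB; apply: measurable_bounded_integrable => //.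
  by rewrite -ge0_fin_numE// fin_num_measure.
exists B; split; first exact: num_real.
by move=> x Bx y _; exact: le_trans (fB y) (ltW Bx).
Qed.

Lemma Rintegral_prob_cst (c : R) : \int[P]_x c = c.
Proof. by rewrite Rintegral_cst//= (probability_setT P) mulr1. Qed.

Lemma bounded_Rintegral f B : measurable_fun setT f -> (forall x, `|f x| <= B) ->
  `|\int[P]_x f x| <= B.
Proof.
move=> mf fB; have intf := bounded_integrable mf fB.
rewrite (le_trans (le_normr_Rintegral _ intf))// -[leRHS]Rintegral_prob_cst.
apply: le_Rintegral => //.
- by apply: (@bounded_integrable _ B) => [|x]; [exact: measurableT_comp|rewrite normr_id].
- by apply: (@bounded_integrable _ `|B|); [exact: measurable_cst|].
Qed.

Lemma Rintegral_sum (I : Type) (s : seq I) (f : I -> T -> R) :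
  (forall i, P.-integrable setT (EFin \o f i)) ->
  \int[P]_x (\sum_(i <- s) f i x) = \sum_(i <- s) \int[P]_x f i x.
Proof.
move=> intf; elim: s => [|i s IHs].
  by rewrite big_nil; under eq_Rintegral do rewrite big_nil; exact: Rintegral_prob_cst.
under eq_Rintegral do rewrite big_cons.
rewrite big_cons RintegralD// ?IHs//.
apply: (eq_integrable _ (fun x => (\sum_(i <- s) (f i x)%:E)%E)) => //.
  by move=> x _ /=; rewrite sumEFin.
by apply: integrable_sum => // j _; exact: intf.
Qed.

Lemma integral_Rintegral f : P.-integrable setT (EFin \o f) ->
  (\int[P]_x (f x)%:E)%E = (\int[P]_x f x)%:E.
Proof. by move=> intf; rewrite fineK//; exact: integrable_fin_num. Qed.

End bounded_integrals.

(** Tonelli's theorem applies once the bounded function is shifted to a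
    nonnegative one. *)
Lemma measurable_partial_integral (dS dT : measure_display) (S : measurableType dS)
    (T : measurableType dT) (R : realType) (P : probability T R)
    (f : S * T -> R) (B : R) :
  measurable_fun setT f -> (forall p, `|f p| <= B) ->
  measurable_fun setT (fun x => \int[P]_y f (x, y)).
Proof.
move=> mf fB.
have mfx x : measurable_fun setT (fun y => f (x, y)).
  by apply: (measurableT_comp mf); exact: measurable_pair1.
have fB0 p : 0 <= f p + B by have := fB p; rewrite ler_norml; lra.
rewrite (_ : (fun x => _) = (fun x => fine (\int[P]_y (f (x, y) + B)%:E) - B)).
  apply: measurable_funB => //; apply: measurableT_comp => //.
  apply: (@measurable_fun_fubini_tonelli_F _ _ _ _ _ P (fun p => (f p + B)%:E)) => //.
  by apply/measurable_EFinP; apply: measurable_funD => //; exact: measurable_cst.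
apply/funext => x; rewrite -/(Rintegral P setT (fun y => f (x, y) + B)).
rewrite RintegralD//; last 2 first.
- by apply: bounded_integrable.
- by apply: (bounded_integrable _ (B := `|B|)); [exact: measurable_cst|].
by rewrite Rintegral_prob_cst addrK.
Qed.

Section resampling.
Variables (R : realType) (dZ : measure_display) (Z : measurableType dZ).
Variable P : probability Z R.

Definition resample (n : nat) (k : 'I_n) (S : n.-tuple Z) (b : Z) : n.-tuple Z :=
  [tuple if i == k then b else tnth S i | i < n].

Lemma tnth_resample n (k : 'I_n) S b i :
  tnth (resample k S b) i = if i == k then b else tnth S i.
Proof. by rewrite tnth_mktuple. Qed.

Lemma measurable_resample n (k : 'I_n) :
  measurable_fun setT (fun p : n.-tuple Z * Z => resample k p.1 p.2).
Proof.
apply/measurable_fun_tnthP => i; rewrite /comp/=.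
under eq_fun do rewrite tnth_resample.
case: (i == k); first exact: measurable_snd.
by apply: (measurableT_comp (measurable_tnth i)); exact: measurable_fst.
Qed.

Lemma resample0_tcons n (b0 b : Z) (S : n.-tuple Z) :
  resample ord0 (tcons (b0, S)) b = tcons (b, S).
Proof.
apply: eq_from_tnth => i; rewrite tnth_resample.
have [->|i0] := eqVneq i ord0; first by rewrite tnth0.
have [j ->] : exists j, i = lift ord0 j by case: (unliftP ord0 i) i0 => [j ->|->]; [exists j|rewrite eqxx].
by rewrite !tnthS.
Qed.

Lemma resampleS_tcons n (k : 'I_n) (b0 b : Z) (S : n.-tuple Z) :
  resample (lift ord0 k) (tcons (b0, S)) b = tcons (b0, resample k S b).
Proof.
apply: eq_from_tnth => i; rewrite tnth_resample.
case: (unliftP ord0 i) => [j ->|->]; last by rewrite !tnth0.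
by rewrite (inj_eq lift_inj) !tnthS tnth_resample.
Qed.

Lemma ge0_integral_iidS n (H : n.+1.-tuple Z -> \bar R) :
  measurable_fun setT H -> (forall S, 0 <= H S)%E ->
  (\int[iid P n.+1]_S H S = \int[P]_b \int[iid P n]_S H (tcons (b, S)))%E.
Proof.
move=> mH H0; rewrite /= ge0_integral_distribution//.
rewrite fubini_tonelli1//; last by move=> p; exact: H0.
by apply: (measurableT_comp mH); exact: measurable_tcons.
Qed.

(** Redrawing one coordinate of an i.i.d. sample does not change its law. *)
Lemma ge0_integral_resample n (k : 'I_n) (H : n.-tuple Z -> \bar R) :
  measurable_fun setT H -> (forall S, 0 <= H S)%E ->
  (\int[iid P n]_S H S = \int[iid P n]_S \int[P]_b H (resample k S b))%E.
Proof.
elim: n => [|n IHn] in k H *; first by case: k.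
move=> mH H0.
have mJ : measurable_fun setT (fun S => \int[P]_b H (resample k S b))%E.
  apply: (@measurable_fun_fubini_tonelli_F _ _ _ _ _ P
    (fun p => H (resample k p.1 p.2))) => //.
  by apply: (measurableT_comp mH); exact: measurable_resample.
have mHc : measurable_fun setT (fun p => H (tcons p)).
  by apply: (measurableT_comp mH); exact: measurable_tcons.
rewrite !ge0_integral_iidS//; last by move=> S; exact: integral_ge0.
case: (unliftP ord0 k) => [k' ->|->].
  apply: eq_integral => b0 _.
  under [in RHS]eq_integral do under eq_integral do rewrite resampleS_tcons.
  apply: (IHn k' (fun S => H (tcons (b0, S)))) => //.
  by apply: (measurableT_comp mHc); exact: measurable_pair1.
under [in RHS]eq_integral => b0 _.
  under eq_integral do under eq_integral do rewrite resample0_tcons.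
  over.
rewrite integral_cst//= (probability_setT P) mule1.
exact: (fubini_tonelli (fun p => H (tcons p))).
Qed.

(** The nonnegative case, applied to $H+B$. *)
Lemma Rintegral_resample n (k : 'I_n) (H : n.-tuple Z -> R) (B : R) :
  measurable_fun setT H -> (forall S, `|H S| <= B) ->
  \int[iid P n]_S H S = \int[iid P n]_S \int[P]_b H (resample k S b).
Proof.
move=> mH HB.
have HB0 S : 0 <= H S + B by have := HB S; rewrite ler_norml; lra.
have mHB : measurable_fun setT (fun S => (H S + B)%:E).
  by apply/measurable_EFinP; apply: measurable_funD => //; exact: measurable_cst.
have intB (dT : measure_display) (T : measurableType dT) (Q : probability T R) :
    Q.-integrable setT (EFin \o (fun=> B)).
  by apply: (bounded_integrable _ (B := `|B|)); [exact: measurable_cst|].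
have mr : measurable_fun setT (fun p : n.-tuple Z * Z => H (resample k p.1 p.2)).
  by apply: (measurableT_comp mH); exact: measurable_resample.
have mrS S : measurable_fun setT (fun b => H (resample k S b)).
  exact: (measurableT_comp mr (measurable_pair1 S)).
have := @ge0_integral_resample n k (fun S => (H S + B)%:E) mHB HB0.
move=> /(congr1 fine).
rewrite -/(Rintegral _ _ _) RintegralD//; [|exact: bounded_integrable mH HB|exact: intB].
rewrite Rintegral_prob_cst.
have innerE S : (\int[P]_b (H (resample k S b) + B)%:E)%E =
    (\int[P]_b H (resample k S b) + B)%:E.
  rewrite integral_Rintegral; last first.
    apply: (bounded_integrable _ (B := (B + `|B|))) => [|b].
      by apply: measurable_funD => //; exact: measurable_cst.
    by rewrite (le_trans (ler_normD _ _))// lerD2r.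
  rewrite RintegralD ?Rintegral_prob_cst//; last exact: intB.
  by apply: bounded_integrable.
under eq_integral do rewrite innerE.
rewrite -/(Rintegral _ _ (fun S => _ + B)) RintegralD//; [|apply: (bounded_integrable _ (B := B))|exact: intB].
- by rewrite Rintegral_prob_cst => /addIr.
- exact: (@measurable_partial_integral _ _ _ _ _ P
    (fun p => H (resample k p.1 p.2)) B mr (fun=> HB _)).
- by move=> S; apply: bounded_Rintegral.
Qed.

(** Stability implies generalization: if redrawing the $k$-th data point moves
    the loss at a fresh point by at most $c_k$, then the mean loss exceeds the
    empirical one by at most the mean of the $c_k$, because after redrawing
    the $k$-th point that point plays the role of the fresh one. *)
Lemma generalization n (Q : Z * n.-tuple Z -> R) (B : R) (c : 'I_n -> R) :
  (0 < n)%N -> measurable_fun setT Q -> (forall p, `|Q p| <= B) ->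
  (forall k S b, Q (b, S) - Q (b, resample k S b) <= c k) ->
  \int[iid P n]_S \int[P]_b Q (b, S) <=
  \int[iid P n]_S (n%:R^-1 * \sum_(k < n) Q (tnth S k, S)) +
  n%:R^-1 * \sum_(k < n) c k.
Proof.
move=> n0 mQ QB Qc.
have nR : 0 < n%:R :> R by rewrite ltr0n.
have mQ' : measurable_fun setT (fun p : n.-tuple Z * Z => Q (p.2, p.1)).
  by apply: (measurableT_comp mQ); exact: measurable_fun_pair.
have mQS S : measurable_fun setT (fun b => Q (b, S)).
  exact: (measurableT_comp mQ' (measurable_pair1 S)).
have mk k : measurable_fun setT (fun S : n.-tuple Z => Q (tnth S k, S)).
  apply: (measurableT_comp mQ); apply: measurable_fun_pair => //.
  exact: measurable_tnth.
have mr k : measurable_fun setT (fun p : n.-tuple Z * Z => Q (p.2, resample k p.1 p.2)).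
  apply: (measurableT_comp mQ); apply: measurable_fun_pair => //.
  exact: measurable_resample.
have intk k : (iid P n).-integrable setT (EFin \o (fun S => Q (tnth S k, S))).
  by apply: (bounded_integrable _ (B := B)).
have mJ : measurable_fun setT (fun S => \int[P]_b Q (b, S)).
  exact: (@measurable_partial_integral _ _ _ _ _ P
    (fun p => Q (p.2, p.1)) B mQ' (fun=> QB _)).
have key k : \int[iid P n]_S \int[P]_b Q (b, S) - c k <=
    \int[iid P n]_S Q (tnth S k, S).
  rewrite [leRHS](@Rintegral_resample n k _ B)//.
  rewrite -[X in _ - X](Rintegral_prob_cst (iid P n) (c k)) -RintegralB//; last 2 first.
  - apply: (bounded_integrable _ (B := B)); first exact: mJ.
    by move=> S; apply: bounded_Rintegral.
  - by apply: (bounded_integrable _ (B := (`|c k|))); [exact: measurable_cst|].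
  have mrk S : measurable_fun setT (fun b => Q (b, resample k S b)).
    exact: (measurableT_comp (mr k) (measurable_pair1 S)).
  apply: le_Rintegral => //.
  - apply: (bounded_integrable _ (B := (B + `|c k|))) => [|S].
      by apply: measurable_funB => //; exact: measurable_cst.
    rewrite (le_trans (ler_normB _ _))// lerD2r.
    by apply: bounded_Rintegral.
  - apply: (bounded_integrable _ (B := B)) => [|S].
      under eq_fun do under eq_Rintegral do rewrite tnth_resample eqxx.
      exact: (@measurable_partial_integral _ _ _ _ _ P
        (fun p => Q (p.2, resample k p.1 p.2)) B (mr k) (fun=> QB _)).
    by under eq_Rintegral do rewrite tnth_resample eqxx; exact: (bounded_Rintegral P (mrk S)).
  move=> S _; under [in leRHS]eq_Rintegral do rewrite tnth_resample eqxx.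
  rewrite -[X in _ - X](Rintegral_prob_cst P (c k)) -RintegralB//; last 2 first.
  - exact: (bounded_integrable _ (B := B)).
  - by apply: (bounded_integrable _ (B := (`|c k|))); [exact: measurable_cst|].
  apply: le_Rintegral => //.
  - apply: (bounded_integrable _ (B := (B + `|c k|))) => [|b].
      by apply: measurable_funB => //; exact: measurable_cst.
    by rewrite (le_trans (ler_normB _ _))// lerD2r.
  - exact: (bounded_integrable _ (B := B)).
  by move=> b _; have := Qc k S b; lra.
rewrite RintegralZl//; last first.
  apply: (@bounded_integrable _ _ _ _ _ (\sum_(k < n) B)) => [|S].
    exact: measurable_sum.
  by rewrite (le_trans (ler_norm_sum _ _ _))// ler_sum.
rewrite Rintegral_sum// -mulrDr -big_split/= mulrC ler_pdivlMr//.
rewrite mulr_natr -[in X in _ *+ X](card_ord n) -sumr_const.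
by apply: ler_sum => k _; have := key k; lra.
Qed.

End resampling.

(** * Independence *)

(** Change of variables when the law of $X$ is only known as a set function. *)
Lemma eq_integral_distribution (dT : measure_display) (T : measurableType dT)
    (R : realType) (P : probability T R) (dV : measure_display) (V : measurableType dV)
    (X : {mfun T >-> V}) (nu : {measure set V -> \bar R}) (f : V -> \bar R) :
  (forall A, measurable A -> P (X @^-1` A) = nu A) ->
  measurable_fun setT f -> P.-integrable setT (f \o X) ->
  (\int[nu]_v f v = \int[P]_t f (X t))%E.
Proof.
move=> lawX mf intf.
transitivity (\int[distribution P X]_v f v)%E; last exact: integral_distribution.
by apply: eq_measure_integral => A mA _; rewrite -lawX.
Qed.

(** Two independent variables have the product of their laws as joint law, and
    Fubini's theorem computes the mean of their product. *)
Section product_law.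
Variables (dT : measure_display) (T : measurableType dT) (R : realType).
Variable P : probability T R.
Local Open Scope ereal_scope.

Lemma integral_mul_independent (X Y : {mfun T >-> R}) :
  (forall A B, measurable A -> measurable B ->
    P (X @^-1` A `&` Y @^-1` B) = P (X @^-1` A) * P (Y @^-1` B)) ->
  P.-integrable setT (EFin \o X) -> P.-integrable setT (EFin \o Y) ->
  P.-integrable setT (fun t => (X t * Y t)%:E) ->
  \int[P]_t (X t * Y t)%:E = (\int[P]_t (X t)%:E) * (\int[P]_t (Y t)%:E).
Proof.
move=> indep intX intY intXY.
have mXY : measurable_fun setT (fun t => (X t, Y t)).
  by apply: measurable_fun_pair; exact: measurable_funPT.
pose XY : {mfun T >-> (R * R)%type} := HB.pack (fun t => (X t, Y t))
  (isMeasurableFun.Build _ _ _ _ _ mXY).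
have lawE C : measurable C ->
    (distribution P X \x distribution P Y) C = distribution P XY C.
  by apply: product_measure_unique => A B mA mB; rewrite /= /pushforward -indep.
have mf : measurable_fun setT (fun p : R * R => (p.1 * p.2)%:E).
  by apply/measurable_EFinP; apply: measurable_funM.
have lawE' A : measurable A -> P (XY @^-1` A) = (distribution P X \x distribution P Y) A.
  by move=> mA; rewrite lawE.
have := eq_integral_distribution lawE' mf intXY.
rewrite /= => <-.
rewrite -integral12_prod_meas1; last first.
  apply/integrableP; split=> //.
  rewrite (_ : \int[_]_x _ = \int[distribution P XY]_p `|(p.1 * p.2)%:E|).
    rewrite ge0_integral_distribution//; last exact: measurableT_comp.
    by case/integrableP : intXY.
  by apply: eq_measure_integral => A mA _; exact: lawE.
have idX (Z : {mfun T >-> R}) : P.-integrable setT (EFin \o Z) ->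
    \int[distribution P Z]_y y%:E = \int[P]_t (Z t)%:E.
  by move=> intZ; rewrite integral_distribution//; exact/measurable_EFinP.
have intid (Z : {mfun T >-> R}) : P.-integrable setT (EFin \o Z) ->
    (distribution P Z).-integrable setT EFin.
  move=> intZ; apply: integrable_pushforward => //; exact/measurable_EFinP.
under eq_integral => x _.
  rewrite /fubini_F/=; under eq_integral do rewrite EFinM.
  rewrite integralZl//; last exact: intid.
  rewrite idX// muleC.
  over.
have -> : \int[P]_t (Y t)%:E = (\int[P]_t Y t)%:E%R by rewrite integral_Rintegral.
by rewrite integralZl//=; [rewrite idX// muleC|exact: intid].
Qed.

End product_law.

(** Independence of one member of a family from all the others together: the
    events independent of a given event of the member form a Dynkin system,
    which contains the finite intersections of events of the others. *)
Lemma independent_of_others (R : realType) (dT : measure_display)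
    (T : measurableType dT) (P : probability T R) (K : finType)
    (G : K -> set_system T) (c : K) (A B : set T) :
  mutually_independent P G ->
  (forall k, G k setT) -> (forall k, setI_closed (G k)) ->
  (forall k, G k `<=` measurable) ->
  <<s \bigcup_(k in [set k | k != c]) G k >> A -> G c B ->
  P (A `&` B) = (P A * P B)%E.
Proof.
move=> indep GT GI Gm sA GB.
(* the finite intersections, with one event for each of the other members *)
pose box (E : K -> set T) := \bigcap_(k in [set k | k != c]) E k.
pose boxes : set_system T := [set box E | E in [set E | forall k, G k (E k)]].
have boxI : setI_closed boxes.
  move=> _ _ [E GE <-] [E' GE' <-].
  by exists (fun k => E k `&` E' k); [move=> k; exact: GI|rewrite /box bigcapI].
have boxm E : boxes E -> measurable E.
  move=> [{}E GE <-]; apply: fin_bigcap_measurable => [|k _].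
    exact: finite_finset.
  exact: Gm.
have mB : measurable B by exact: Gm GB.
pose D : set_system T := [set E | measurable E /\ P (E `&` B) = (P E * P B)%E].
have Gsub : \bigcup_(k in [set k | k != c]) G k `<=` boxes.
  move=> E [k kc GE]; exists (fun k' => if k' == k then E else setT).
    by move=> k'; case: eqP => [->|].
  apply/seteqP; split => [x /(_ k kc)|x Ex k' _]; first by rewrite eqxx.
  by case: eqP.
suff : <<s \bigcup_(k in [set k | k != c]) G k >> `<=` D by move=> /(_ _ sA)[].
apply: (@subset_trans _ <<s boxes >>); first exact: sub_sigma_algebra2.
rewrite -setI_closed_g_dynkin_g_sigma_algebra//.
apply: smallest_sub.
  split.
  - by split=> //; rewrite setTI (probability_setT P) mul1e.
  - move=> E [mE indE]; split; first exact: measurableC.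
    rewrite probability_setC// muleBl; last 2 first.
    + by rewrite fin_num_measure.
    + by rewrite fin_num_adde_defl// fin_numN fin_num_measure.
    rewrite mul1e -indE.
    have -> : P B = (P (E `&` B) + P (~` E `&` B))%E.
      rewrite -measureU//; [|exact: measurableI| |].
      + by rewrite -setIUl setUv setTI.
      + by apply: measurableI => //; exact: measurableC.
      + by rewrite setIACA setICr set0I.
    by rewrite addeAC subee ?add0e// fin_num_measure//; exact: measurableI.
  - move=> E tE DE; have mE k : measurable (E k) by case: (DE k).
    split; first exact: bigcup_measurable.
    rewrite setI_bigcupl measure_bigcup//; last 2 first.
    + by move=> k _; exact: measurableI.
    + by apply: trivIset_setIr.
    rewrite measure_bigcup//.
    have PBE : P B = (fine (P B))%:E by rewrite fineK// fin_num_measure.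
    rewrite muleC PBE -nneseriesZl//.
    apply: eq_eseriesr => k _; apply: (eq_trans (proj2 (DE k))).
    by rewrite muleC -PBE.
move=> _ [E GE <-]; split; first by apply: boxm; exists E.
pose E' k := if k == c then B else E k.
have GE' k : G k (E' k) by rewrite /E'; case: eqP => [->|].
have := indep [set: K]%SET E' (fun k _ => GE' k).
have -> : \bigcap_(k in [set k | k \in [set: K]%SET]) E' k = box E `&` B.
  apply/seteqP; split => x.
    move=> xE; split.
      by move=> k /= /negbTE kc; have := xE k; rewrite /E' kc /=; apply; rewrite inE.
    by have := xE c; rewrite /E' eqxx; apply; rewrite /= inE.
  move=> [xE xB] k _; rewrite /E'; have [_ //|kc] := eqVneq k c.
  exact: xE.
move=> ->; rewrite (bigD1 c)/= ?inE// /E' eqxx muleC; congr (_ * _)%E.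
have := indep (~: [set c])%SET E (fun k _ => GE k).
have -> : \bigcap_(k in [set k | k \in (~: [set c])%SET]) E k = box E.
  by apply/seteqP; split=> x xE k kc; apply: xE; move: kc; rewrite /= !inE.
move=> ->; apply: eq_big => k; first by rewrite !inE.
by move=> /andP[_ /negbTE ->].
Qed.

(** A centered variable of one member of an independent family is orthogonal to
    the bounded functions of all the others. *)
Lemma centered_orthogonal (R : realType) (dT : measure_display)
    (T : measurableType dT) (P : probability T R) (K : finType)
    (G : K -> set_system T) (c : K) (X : T -> R) (Y : T -> R) (b : R) :
  mutually_independent P G ->
  (forall k, G k setT) -> (forall k, setI_closed (G k)) ->
  (forall k, G k `<=` measurable) ->
  (forall B, measurable B -> G c (X @^-1` B)) ->
  P.-integrable setT (EFin \o X) -> \int[P]_t X t = 0 ->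
  measurable_fun setT
    (Y : g_sigma_algebraType (\bigcup_(k in [set k | k != c]) G k) -> R) ->
  (forall t, `|Y t| <= b) ->
  P.-integrable setT (fun t => (X t * Y t)%:E) /\ \int[P]_t (X t * Y t) = 0.
Proof.
move=> indep GT GI Gm GX intX X0 mY Yb.
have sub A : <<s \bigcup_(k in [set k | k != c]) G k >> A -> measurable A.
  apply: smallest_sub; first exact: sigma_algebra_measurable.
  by move=> E [k _]; exact: Gm.
have mY' : measurable_fun setT Y.
  by move=> _ B mB; rewrite setTI; apply: sub; rewrite -[X in <<s _ >> X]setTI; exact: mY.
have mX : measurable_fun setT X by apply/measurable_EFinP; exact: measurable_int intX.
pose XM : {mfun T >-> R} := HB.pack X (isMeasurableFun.Build _ _ _ _ _ mX).
pose YM : {mfun T >-> R} := HB.pack Y (isMeasurableFun.Build _ _ _ _ _ mY').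
have intXY : P.-integrable setT (fun t => (X t * Y t)%:E).
  apply: (eq_integrable _ ((EFin \o X) \* (EFin \o Y))%E) => //.
  apply: integrableMl => //.
  exists b; split; first exact: num_real.
  by move=> x bx y _; exact: le_trans (Yb y) (ltW bx).
have intY : P.-integrable setT (EFin \o Y) by apply: (bounded_integrable _ mY' Yb).
split=> //.
have := @integral_mul_independent _ T R P XM YM _ intX intY intXY.
rewrite /= /Rintegral => ->.
  by rewrite (integral_Rintegral intX) X0 mul0e.
move=> A B mA mB; rewrite setIC muleC.
apply: (independent_of_others (c := c) indep) => //; last exact: GX.
by rewrite -[X in <<s _ >> X]setTI; exact: mY.
Qed.

(** * Moments of the Gaussian noise *)

(** Integration against a density, by Tonelli's theorem applied to
    $\mathbf 1[0\le r<f(x)]$, whose integral over $r$ is $f(x)$. *)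
Lemma ge0_integral_density (R : realType) (nu : probability (measurableTypeR R) R)
    (p f : R -> R) :
  measurable_fun setT p -> (forall x, 0 <= p x) ->
  (forall A, measurable A -> nu A = \int[lebesgue_measure]_(x in A) (p x)%:E)%E ->
  measurable_fun setT f -> (forall x, 0 <= f x) ->
  (\int[nu]_x (f x)%:E = \int[lebesgue_measure]_x (f x * p x)%:E)%E.
Proof.
move=> mp p0 nuE mf f0.
pose S := [set q : measurableTypeR R * measurableTypeR R | 0 <= q.2 < f q.1].
have mS : measurable S.
  rewrite (_ : S = [set q | 0 <= q.2] `&` [set q | q.2 < f q.1]); last first.
    by apply/seteqP; split => q /= /andP.
  have mf1 : measurable_fun setT (fun q : measurableTypeR R * measurableTypeR R => f q.1).
    by apply: (measurableT_comp mf); exact: measurable_fst.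
  apply: measurableI.
    rewrite -[X in measurable X]setTI.
    have : measurable_fun setT
        (fun q : measurableTypeR R * measurableTypeR R => 0 <= q.2).
      by apply: measurable_fun_ler => //; exact: measurable_snd.
    by move=> /(_ measurableT [set true]); exact.
  rewrite -[X in measurable X]setTI.
  have : measurable_fun setT
      (fun q : measurableTypeR R * measurableTypeR R => q.2 < f q.1).
    by apply: measurable_fun_ltr => //; exact: measurable_snd.
  by move=> /(_ measurableT [set true]); exact.
have layer x : (\int[lebesgue_measure]_r (\1_S (x, r))%:E = (f x)%:E)%E.
  transitivity (\int[lebesgue_measure]_r (\1_(`[0%R, f x[%classic : set R) r)%:E)%E.
    by apply: eq_integral => r _; rewrite !indicE; congr (_%:R%:E); apply/idP/idP;
      rewrite !inE /S /= in_itv.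
  rewrite integral_indic//= setIT lebesgue_measure_itv/= lte_fin.
  by have := f0 x; rewrite le_eqVlt => /orP[/eqP <-|->]; rewrite ?ltxx// oppr0 adde0.
have mSx r : measurable [set x : measurableTypeR R | S (x, r)].
  have := measurable_ysection r mS; congr measurable.
  by apply/seteqP; split=> x; rewrite /ysection/= ?inE.
transitivity (\int[nu]_x \int[lebesgue_measure]_r (\1_S (x, r))%:E)%E.
  by apply: eq_integral => x _; rewrite layer.
have mind : measurable_fun setT (fun q => (\1_S q)%:E : \bar R).
  by apply/measurable_EFinP; exact: measurable_indic.
rewrite (fubini_tonelli (fun q => (\1_S q)%:E))//.
transitivity (\int[lebesgue_measure]_r \int[lebesgue_measure]_x
    ((\1_S (x, r))%:E * (p x)%:E))%E.
  apply: eq_integral => r _.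
  transitivity (\int[nu]_x (\1_[set x | S (x, r)] x)%:E)%E.
    by apply: eq_integral => x _; rewrite !indicE; congr (_%:R%:E); apply/idP/idP; rewrite !inE.
  rewrite integral_indic//= setIT nuE// integral_mkcond; apply: eq_integral => x _.
  rewrite patchE indicE (_ : ((x, r) \in S) = (x \in [set x | S (x, r)])).
    by case: ifP => _; rewrite ?mul1e ?mul0e.
  by apply/idP/idP; rewrite !inE.
rewrite -(fubini_tonelli (fun q : measurableTypeR R * measurableTypeR R =>
    ((\1_S q)%:E * (p q.1)%:E)%E))//; last 2 first.
- apply: emeasurable_funM => //; apply/measurable_EFinP.
  by apply: (measurableT_comp mp); exact: measurable_fst.
- by move=> q; apply: mule_ge0; rewrite lee_fin ?p0// indicE ler0n.
apply: eq_integral => x _ /=.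
rewrite ge0_integralZr//.
- by rewrite layer EFinM.
- exact: (measurableT_comp mind (measurable_pair1 x)).
- by rewrite lee_fin p0.
Qed.

(** $y^2\le 4s^2e^{y^2/4s^2}$ turns $y^2$ times the density of $N(0,s^2)$ into a
    multiple of the density of $N(0,2s^2)$. *)
Lemma sqr_normal_pdf_le (R : realType) (s x : R) : 0 < s ->
  x ^+ 2 * normal_pdf 0 s x <= 6 * s ^+ 2 * normal_pdf 0 (Num.sqrt 2 * s) x.
Proof.
move=> s0.
have r0 : 0 < Num.sqrt 2 :> R by rewrite sqrtr_gt0.
have r2 : Num.sqrt 2 ^+ 2 = 2 :> R by rewrite sqr_sqrtr.
have r32 : Num.sqrt 2 <= 3 / 2 :> R.
  rewrite -(@ler_pXn2r _ 2) ?nnegrE ?(ltW r0)// r2; lra.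
have rs0 : 0 < Num.sqrt 2 * s by exact: mulr_gt0.
rewrite !normal_pdfE ?gt_eqF// /normal_peak /normal_fun !subr0 exprMn r2.
set k := (Num.sqrt (s ^+ 2 * pi *+ 2))^-1.
have -> : (Num.sqrt (2 * s ^+ 2 * pi *+ 2))^-1 = k / Num.sqrt 2.
  rewrite /k -invfM; congr (_^-1).
  rewrite -sqrtrM; last first.
    by rewrite mulrn_wge0// mulr_ge0 ?sqr_ge0 ?pi_ge0.
  by congr Num.sqrt; rewrite !mulrnAl; congr (_ *+ 2); ring.
have k0 : 0 <= k by rewrite invr_ge0 sqrtr_ge0.
have s2 : 0 < s ^+ 2 by rewrite exprn_gt0.
pose y := x ^+ 2 / (4 * s ^+ 2).
have xE : x ^+ 2 = 4 * s ^+ 2 * y by rewrite /y; field; rewrite gt_eqF.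
have -> : - x ^+ 2 / (s ^+ 2 *+ 2) = - y - y by rewrite xE; field; rewrite gt_eqF.
have -> : - x ^+ 2 / (2 * s ^+ 2 *+ 2) = - y by rewrite xE; field; rewrite gt_eqF.
rewrite expRD; set e := expR (- y).
have e0 : 0 < e by exact: expR_gt0.
have ye : y * e <= 1.
  rewrite -(@ler_pM2r _ (expR y)) ?expR_gt0// mul1r -mulrA -expRD addNr expR0 mulr1.
  by have := expR_ge1Dx y; lra.
rewrite xE.
have -> : 6 * s ^+ 2 * (k / Num.sqrt 2 * e) = 3 * Num.sqrt 2 * (s ^+ 2 * k * e).
  have -> : (Num.sqrt 2)^-1 = Num.sqrt 2 / 2 :> R.
    apply: (mulIf (lt0r_neq0 r0)); rewrite mulVf ?lt0r_neq0//.
    by rewrite mulrAC -expr2 r2 divff.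
  by field.
have -> : 4 * s ^+ 2 * y * (k * (e * e)) = 4 * (y * e) * (s ^+ 2 * k * e) by ring.
apply: ler_wpM2r; first by rewrite !mulr_ge0// ltW.
have : 4 / 3 <= Num.sqrt 2 :> R.
  rewrite -(@ler_pXn2r _ 2) ?nnegrE ?(ltW r0) ?divr_ge0// r2; lra.
nra.
Qed.

Section normal_moments.
Variables (R : realType) (dT : measure_display) (T : measurableType dT).
Variables (P : probability T R) (s : R) (X : T -> R).
Hypotheses (s0 : 0 < s) (normX : normal_rv P 0 s X).

Lemma normal_second_moment : (\int[P]_t (X t ^+ 2)%:E <= (6 * s ^+ 2)%:E)%E.
Proof.
have [mX lawX] := normX.
have mX' : measurable_fun setT (X : T -> measurableTypeR R) by exact: mX.
pose XM : {mfun T >-> measurableTypeR R} := HB.pack X (isMeasurableFun.Build _ _ _ _ _ mX').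
have msq : measurable_fun setT (fun x : R => (x ^+ 2)%:E).
  by apply/measurable_EFinP; exact: measurable_funX.
have -> : (\int[P]_t (X t ^+ 2)%:E = \int[normal_prob 0 s]_x (x ^+ 2)%:E)%E.
  transitivity (\int[distribution P XM]_x (x ^+ 2)%:E)%E.
    by rewrite ge0_integral_distribution// => x; rewrite lee_fin sqr_ge0.
  by apply: eq_measure_integral => A mA _; exact: lawX.
have mpdf t := @measurable_normal_pdf R 0 t.
have msqr : measurable_fun setT (fun x : R => x ^+ 2) by exact: measurable_funX.
rewrite (@ge0_integral_density R (normal_prob 0 s) (normal_pdf 0 s) (fun x => x ^+ 2) (mpdf s)
  (normal_pdf_ge0 0 s) (fun A mA => erefl) msqr (fun x => sqr_ge0 x)).
apply: (@le_trans _ _ (\int[lebesgue_measure]_x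
    ((6 * s ^+ 2)%:E * (normal_pdf 0 (Num.sqrt 2 * s) x)%:E))%E).
  apply: ge0_le_integral => //.
  - by move=> x _; rewrite lee_fin mulr_ge0 ?sqr_ge0 ?normal_pdf_ge0.
  - by apply/measurable_EFinP; exact: (measurable_funM msqr (mpdf s)).
  - by apply/measurable_EFinP; apply: measurable_funM => //; exact: mpdf.
  - by move=> x _; rewrite -EFinM lee_fin sqr_normal_pdf_le.
rewrite ge0_integralZl//.
- by rewrite integral_normal_pdf mule1.
- by apply/measurable_EFinP; exact: mpdf.
- by move=> x _; rewrite lee_fin normal_pdf_ge0.
- by rewrite lee_fin mulr_ge0 ?sqr_ge0.
Qed.

Lemma normal_sqr_integrable : P.-integrable setT (fun t => (X t ^+ 2)%:E).
Proof.
have [mX _] := normX.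
apply/integrableP; split.
  by apply/measurable_EFinP; exact: measurable_funX.
under eq_integral do rewrite /= ger0_norm ?sqr_ge0//.
by rewrite (le_lt_trans normal_second_moment)// ltry.
Qed.

Lemma normal_integrable : P.-integrable setT (EFin \o X).
Proof.
have [mX _] := normX.
apply: (@le_integrable _ _ _ P setT measurableT _ (fun t => (1 + X t ^+ 2)%:E)) => //.
- exact/measurable_EFinP.
- move=> t _; rewrite /= lee_fin [leRHS]ger0_norm ?addr_ge0 ?sqr_ge0//.
  rewrite -[X t ^+ 2]real_normK ?num_real//.
  by have := normr_ge0 (X t); have := sqr_ge0 (`|X t| - 1); nra.
- apply: (eq_integrable _ ((EFin \o (fun=> 1%R)) \+ (fun t => (X t ^+ 2)%:E))%E) => //.
  apply: integrableD => //; last exact: normal_sqr_integrable.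
  by apply: (bounded_integrable _ (B := 1)) => [|t]; [exact: measurable_cst|rewrite normr1].
Qed.

(** $N(0,s^2)$ is symmetric. *)
Lemma normal_mean : \int[P]_t X t = 0.
Proof.
have [mX lawX] := normX; have intX := normal_integrable.
have mN : measurable_fun setT (fun t => - X t : measurableTypeR R).
  by have : measurable_fun setT (fun t => - X t) by exact: measurableT_comp.
have mX' : measurable_fun setT (X : T -> measurableTypeR R) by exact: mX.
pose XM : {mfun T >-> measurableTypeR R} := HB.pack X (isMeasurableFun.Build _ _ _ _ _ mX').
pose NM : {mfun T >-> measurableTypeR R} := HB.pack (fun t => - X t) (isMeasurableFun.Build _ _ _ _ _ mN).
have mid : measurable_fun setT (EFin : R -> \bar R) by exact/measurable_EFinP.
have symm A : measurable A -> P (NM @^-1` A) = normal_prob 0 s A.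
  move=> mA; rewrite -[NM @^-1` A]/(X @^-1` (-%R @^-1` A)).
  have mNA : measurable (-%R @^-1` A : set R).
    rewrite -[X in measurable X]setTI.
    by have : measurable_fun setT (-%R : R -> R) by []; exact.
  rewrite lawX// /normal_prob.
  have mopp : measurable_fun setT (-%R : measurableTypeR R -> measurableTypeR R).
    exact: (@oppr_measurable R setT).
  pose phi : {mfun measurableTypeR R >-> measurableTypeR R} :=
    HB.pack (-%R : R -> R) (isMeasurableFun.Build _ _ _ _ _ mopp).
  transitivity (\int[pushforward lebesgue_measure phi]_(y in A) (normal_pdf 0 s y)%:E)%E.
    rewrite ge0_integral_pushforward//.
    - apply: eq_integral => x _ /=.
      by rewrite !normal_pdfE ?gt_eqF// /normal_fun !subr0 sqrrN.
    - by apply/measurable_EFinP/measurable_funTS; exact: measurable_normal_pdf.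
    - by move=> y _; rewrite lee_fin normal_pdf_ge0.
  apply: eq_measure_integral => B mB _; exact: lebesgue_measureN.
have intN : P.-integrable setT (EFin \o NM).
  apply: (eq_integrable _ (-%E \o (EFin \o X))%E) => //; exact: integrableN.
have E1 := eq_integral_distribution (X := XM) lawX mid intX.
have E2 := eq_integral_distribution (X := NM) symm mid intN.
have : \int[P]_t X t = \int[P]_t (- X t).
  by rewrite /Rintegral; congr fine; rewrite -[LHS]E1 -[RHS]E2.
have -> : \int[P]_t (- X t) = - \int[P]_t X t.
  under eq_Rintegral do rewrite -mulN1r.
  by rewrite RintegralZl// mulN1r.
lra.
Qed.

End normal_moments.

(** * The weak gap for fixed internal randomness *)

Section sampled_operators.
Variables (R : realType) (d n : nat) (dZ : measure_display) (Z : measurableType dZ).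
Variables (W : set 'rV[R]_d) (D L M : R) (F : Z -> 'rV[R]_d -> 'rV[R]_d).
Hypothesis sviF : svi_instance W D L M F.
Hypotheses (L0 : 0 < L) (M0 : 0 < M) (n0 : (0 < n)%N).

Definition empirical (S : n.-tuple Z) (v : 'rV[R]_d) : 'rV[R]_d :=
  n%:R^-1 *: \sum_(k < n) F (tnth S k) v.

Let nR : 0 < n%:R :> R. Proof. by rewrite ltr0n. Qed.

Lemma enorm_mean_le (f : 'I_n -> 'rV[R]_d) (B : R) : (forall k, enorm (f k) <= B) ->
  enorm (n%:R^-1 *: \sum_(k < n) f k) <= B.
Proof.
move=> fB; rewrite enormZ gtr0_norm ?invr_gt0// mulrC ler_pdivrMr//.
rewrite (le_trans (enorm_sum _ _ _))// (le_trans (ler_sum _ (fun k _ => fB k)))//.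
by rewrite sumr_const card_ord mulr_natr.
Qed.

Lemma empirical_bound S v : W v -> enorm (empirical S v) <= M.
Proof.
move=> Wv; apply: enorm_mean_le => k.
by case: sviF => _ _ _ /(_ (tnth S k))[_ _ FM] _; exact: FM.
Qed.

Section random.
Variables (dO : measure_display) (O : measurableType dO).
Variables (s : O -> n.-tuple Z) (i : O -> 'I_n) (x : O -> 'rV[R]_d).
Hypotheses (ms : measurable_fun setT s)
  (mi : forall k, measurable (i @^-1` [set k])) (mx : measurable_vec x).

Lemma measurable_sampled v k : W v -> measurable_vec (fun o => F (tnth (s o) k) v).
Proof.
move=> Wv j; case: sviF => _ _ _ _ /(_ v j Wv) mF.
apply: (measurableT_comp mF).
exact: (measurableT_comp (measurable_tnth k) ms).
Qed.

Lemma random_sampled : random_operator W L (fun o v => F (tnth (s o) (i o)) v + x o).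
Proof.
apply: random_operatorD => //; split=> [v Wv j|o v v' Wv Wv'].
  apply: (measurable_countable_family (g := fun k o => F (tnth (s o) k) v 0 j)) => // o.
  exact: measurable_sampled.
by case: sviF => _ _ _ /(_ (tnth (s o) (i o)))[_ lip _] _; exact: lip.
Qed.

Lemma random_empirical : random_operator W L (fun o => empirical (s o)).
Proof.
split=> [v Wv|o v v' Wv Wv'].
  by apply: measurable_vecZ; apply: measurable_vec_sum => k; exact: measurable_sampled.
rewrite -scalerBr -sumrB; apply: enorm_mean_le => k.
by case: sviF => _ _ _ /(_ (tnth (s o) k))[_ lip _] _; exact: lip.
Qed.

End random.

Section fixed_randomness.
Variables (gamma : R) (T : nat) (j1 j2 : nat -> 'I_n) (x1 x2 : nat -> 'rV[R]_d).
Variables (u0 : 'rV[R]_d).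
Hypotheses (gamma0 : 0 < gamma) (gL : gamma * L <= 1) (T0 : (0 < T)%N) (Wu0 : W u0).

Let F1 (S : n.-tuple Z) t v := F (tnth S (j1 t)) v + x1 t.
Let F2 (S : n.-tuple Z) t v := F (tnth S (j2 t)) v + x2 t.

Definition nseg_iterate S := nseg_w W (fun=> gamma) (F1 S) (F2 S) u0.
Definition nseg_ghost S := ghost W gamma (F1 S) (F2 S) u0 (empirical S).
Definition nseg_deviation S := deviation W gamma (F1 S) (F2 S) u0 (empirical S).
Definition nseg_output S := T%:R^-1 *: \sum_(t < T) nseg_iterate S t.+1.
Definition noise_term S :=
  \sum_(t < T) dotv (nseg_deviation S t) (nseg_iterate S t.+1 - nseg_ghost S t).

Let TR : 0 < T%:R :> R. Proof. by rewrite ltr0n. Qed.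
Let cW : compact W. Proof. by case: sviF. Qed.
Let convW : convex_set W. Proof. by case: sviF. Qed.
Let W0 : W !=set0. Proof. by exists u0. Qed.
Let DW w1 w2 : W w1 -> W w2 -> enorm (w1 - w2) <= D.
Proof. by move=> ? ?; case: sviF => _ _ -> _ _; exact: le_diameter. Qed.
Let FM b v : W v -> enorm (F b v) <= M.
Proof. by move=> Wv; case: sviF => _ _ _ /(_ b)[_ _ bnd] _; exact: bnd. Qed.
Let Fmono b : monotone_class W L M (F b). Proof. by case: sviF. Qed.

Lemma nseg_iterate_in S t : W (nseg_iterate S t).
Proof. exact: nseg_w_in. Qed.

Lemma nseg_ghost_in S t : W (nseg_ghost S t).
Proof. exact: ghost_in. Qed.

Lemma nseg_output_in S : W (nseg_output S).
Proof.
have [||//] := @convex_mean R d W (fun=> 0) (fun t => nseg_iterate S t.+1) T T0 convW.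
- by move=> x y t _ _ _; rewrite !mulr0 addr0.
- by move=> t _; exact: nseg_iterate_in.
Qed.

Lemma nseg_deviation_le S t :
  enorm (nseg_deviation S t) <= 2 * M + enorm (x2 t.+1).
Proof.
rewrite /nseg_deviation /deviation opprD addrA (le_trans (enormB _ _))// lerD2r.
rewrite (le_trans (enormB _ _))// mulr2n mulrDl mul1r lerD//.
  by apply: empirical_bound; exact: nseg_iterate_in.
by apply: FM; exact: nseg_iterate_in.
Qed.

Variable g : Z -> 'rV[R]_d -> 'rV[R]_d -> R.
Hypothesis gconv : forall b w x y t, W w -> W x -> W y -> 0 <= t <= 1 ->
  g b (t *: x + (1 - t) *: y) w <= t * g b x w + (1 - t) * g b y w.
Hypothesis g_le : forall b v w, W v -> W w -> g b v w <= dotv (F b v) (v - w).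
Hypothesis g_lip : forall b v v' w, W v -> W v' -> W w ->
  `|g b v w - g b v' w| <= 2 * M * enorm (v - v').
Hypothesis g_diag : forall b w, W w -> g b w w = 0.
Hypothesis mg : forall v w, W v -> W w -> measurable_fun setT (fun b => g b v w).

(** The regret part of the bound: the factors of $\gamma$ come from
    $|F+\xi|^2\le2M^2+2|\xi|^2$, and from $|\Delta|^2\le8M^2+2|\xi_2|^2$ for the
    deviations. *)
Definition optimization_bound : R :=
  D ^+ 2 / (gamma * T%:R) + gamma / T%:R * \sum_(t < T)
    (7 * M ^+ 2 + enorm (x1 t.+1) ^+ 2 + 3 * enorm (x2 t.+1) ^+ 2).

(** Jensen's inequality passes from the averaged output to the iterates, where
    the loss is at most $\langle F_\beta(w_t),w_t-w\rangle$; averaging over the data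
    turns $F_\beta$ into the empirical operator. *)
Lemma empirical_gap S w : W w ->
  n%:R^-1 * \sum_(k < n) g (tnth S k) (nseg_output S) w <=
  optimization_bound + T%:R^-1 * noise_term S.
Proof.
move=> Ww.
have jensen k : g (tnth S k) (nseg_output S) w <=
    T%:R^-1 * \sum_(t < T) dotv (F (tnth S k) (nseg_iterate S t.+1))
       (nseg_iterate S t.+1 - w).
  have [||_ h] := @convex_mean R d W (fun v => g (tnth S k) v w)
      (fun t => nseg_iterate S t.+1) T T0 convW.
  - by move=> x y t Wx Wy t01; exact: gconv.
  - by move=> t _; exact: nseg_iterate_in.
  rewrite (le_trans h)// ler_wpM2l ?invr_ge0 ?(ltW TR)//; apply: ler_sum => t _.
  by apply: g_le => //; exact: nseg_iterate_in.
apply: (@le_trans _ _ (n%:R^-1 * \sum_(k < n) (T%:R^-1 *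
   \sum_(t < T) dotv (F (tnth S k) (nseg_iterate S t.+1)) (nseg_iterate S t.+1 - w)))).
  by rewrite ler_wpM2l ?invr_ge0 ?(ltW nR)// ler_sum.
have -> : n%:R^-1 * \sum_(k < n) (T%:R^-1 * \sum_(t < T)
      dotv (F (tnth S k) (nseg_iterate S t.+1)) (nseg_iterate S t.+1 - w)) =
    T%:R^-1 * \sum_(t < T) dotv (empirical S (nseg_iterate S t.+1))
       (nseg_iterate S t.+1 - w).
  rewrite -mulr_sumr mulrCA exchange_big/=; congr (_ * _).
  rewrite mulr_sumr; apply: eq_bigr => t _.
  by rewrite dotvZl dotv_suml.
have := @extragradient_gap R d W D gamma cW convW DW gamma0 (F1 S) (F2 S) u0 Wu0
  (empirical S) w T Ww.
rewrite -(ler_pM2l (x := T%:R^-1)) ?invr_gt0// => /le_trans; apply.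
rewrite !mulrDr lerD2r /optimization_bound.
have -> : T%:R^-1 * (D ^+ 2 / gamma) = D ^+ 2 / (gamma * T%:R).
  by field; rewrite !gt_eqF.
rewrite lerD2l mulrA [T%:R^-1 * gamma]mulrC ler_wpM2l//.
  by rewrite divr_ge0 ?(ltW gamma0) ?(ltW TR).
apply: ler_sum => t _.
have iW := nseg_iterate_in S t.+1.
have uW := nseg_u_in gamma cW (F1 S) (F2 S) Wu0 t.
have h2 := sqr_enormD (F (tnth S (j2 t.+1)) (nseg_iterate S t.+1)) (x2 t.+1).
have h1 := sqr_enormD (F (tnth S (j1 t.+1))
   (nseg_u W (fun=> gamma) (F1 S) (F2 S) u0 t)) (x1 t.+1).
have b2 := FM (tnth S (j2 t.+1)) iW.
have b1 := FM (tnth S (j1 t.+1)) uW.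
have bdev := nseg_deviation_le S t.
have sq (a b : R) : 0 <= a -> a <= b -> a ^+ 2 <= b ^+ 2.
  by move=> a0 ab; rewrite ler_pXn2r ?nnegrE ?(le_trans a0).
have {}b2 := sq _ _ (enorm_ge0 _) b2.
have {}b1 := sq _ _ (enorm_ge0 _) b1.
have {}bdev := sq _ _ (enorm_ge0 _) bdev.
have := sqr_ge0 (2 * M - enorm (x2 t.+1)) => cross.
rewrite -/(nseg_deviation S) -/(nseg_iterate S).
move: h1 h2 b1 b2 bdev cross; rewrite /F1 /F2.
set A1 := enorm _ ^+ 2; set A2 := enorm _ ^+ 2; nra.
Qed.

Definition stability_bound : R :=
  \sum_(t < T) (4 * gamma * M / n%:R + 2 * gamma ^+ 2 * L ^+ 2 * D +
    4 * gamma ^+ 2 * L * (M + enorm (x1 t.+1))) + 2 * gamma * M.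

Let hit (j : nat -> 'I_n) k t := j t == k.
Let drift_at k := drift D L M gamma x1 (hit j1 k) (hit j2 k).

Lemma nseg_output_stable S k b :
  enorm (nseg_output S - nseg_output (resample k S b)) <=
  \sum_(t < T) drift_at k t.+1 + 2 * gamma * M.
Proof.
apply: (@nseg_mean_stable R d W D L M gamma cW convW DW gamma0 L0 M0 gL
  (fun t => F (tnth S (j1 t))) (fun t => F (tnth S (j2 t)))
  (fun t => F (tnth (resample k S b) (j1 t)))
  (fun t => F (tnth (resample k S b) (j2 t)))) => //.
- by move=> t /negbTE jk; rewrite tnth_resample -/(hit j1 k t) jk.
- by move=> t /negbTE jk; rewrite tnth_resample -/(hit j2 k t) jk.
Qed.

(** Each step uses two data points, so the redrawn point is hit $2T/n$ times on
    average over its position, whatever the sampled indices are. *)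
Lemma mean_drift : n%:R^-1 * \sum_(k < n) (\sum_(t < T) drift_at k t.+1 + 2 * gamma * M) =
  stability_bound.
Proof.
have hitE (j : nat -> 'I_n) t : \sum_(k < n) (hit j k t)%:R = 1 :> R.
  rewrite (bigD1 (j t))//= /hit eqxx big1 ?addr0// => k kj.
  by rewrite eq_sym (negbTE kj).
have meanC (a : R) : n%:R^-1 * (a *+ n) = a.
  by rewrite -(mulr_natl a) mulKf// gt_eqF.
rewrite big_split/= sumr_const card_ord exchange_big/= mulrDr meanC; congr (_ + _).
rewrite mulr_sumr; apply: eq_bigr => t _.
rewrite /drift_at /drift !big_split/= !sumr_const !card_ord -!mulr_sumr !hitE.
by rewrite !mulrDr !meanC; field; rewrite gt_eqF.
Qed.

Definition mean_gap (P : probability Z R) v w : R := \int[P]_b g b v w.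

(** The loss vanishes on the diagonal and is Lipschitz. *)
Lemma g_bound b v w : W v -> W w -> `|g b v w| <= 2 * M * D.
Proof.
move=> Wv Ww; have := g_lip b Wv Ww Ww; rewrite g_diag// subr0 => /le_trans; apply.
by rewrite ler_wpM2l ?DW// mulr_ge0// ltW.
Qed.

Let random1 (dO : measure_display) (O : measurableType dO) (s : O -> n.-tuple Z)
  (j : 'I_n) (x : 'rV[R]_d) : measurable_fun setT s ->
  random_operator W L (fun o v => F (tnth (s o) j) v + x).
Proof.
move=> ms; apply: (random_sampled (i := fun=> j) (x := fun=> x) ms).
- by move=> k; rewrite preimage_cst; case: ifP.
- exact: measurable_vec_cst.
Qed.

Lemma measurable_nseg_output (dO : measure_display) (O : measurableType dO)
  (s : O -> n.-tuple Z) : measurable_fun setT s ->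
  measurable_vec (fun o => nseg_output (s o)).
Proof.
move=> ms; apply: measurable_vecZ; apply: measurable_vec_sum => t.
apply: (@measurable_nseg_w _ O R d W cW convW L gamma
  (fun t o => F1 (s o) t) (fun t o => F2 (s o) t) u0 t.+1 t.+1) => // t' _; exact: random1.
Qed.

Lemma measurable_noise_term : measurable_fun setT noise_term.
Proof.
have mid : measurable_fun setT (id : n.-tuple Z -> n.-tuple Z) by exact: measurable_id.
apply: measurable_sum => t; apply: measurable_dotv.
  apply: (@measurable_deviation _ _ R d W cW convW L gamma
    (fun t S => F1 S t) (fun t S => F2 S t) u0 t.+1 t.+1) => //.
  - by move=> t' _; exact: (random1 _ _ mid).
  - by move=> t' _; exact: (random1 _ _ mid).
  - exact: (random_empirical mid).
apply: measurable_vecB.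
  apply: (@measurable_nseg_w _ _ R d W cW convW L gamma
    (fun t S => F1 S t) (fun t S => F2 S t) u0 t.+1 t.+1) => // t' _.
    exact: (random1 _ _ mid).
  exact: (random1 _ _ mid).
apply: (@measurable_ghost _ _ R d W cW convW L gamma
    (fun t S => F1 S t) (fun t S => F2 S t) u0 t.+1 t.+1) => //.
- by move=> t' _; exact: (random1 _ _ mid).
- by move=> t' _; exact: (random1 _ _ mid).
- exact: (random_empirical mid).
Qed.

Lemma noise_term_bound S :
  `|noise_term S| <= \sum_(t < T) (2 * M + enorm (x2 t.+1)) * D.
Proof.
rewrite (le_trans (ler_norm_sum _ _ _))//; apply: ler_sum => t _.
rewrite (le_trans (normr_dotv_le _ _))// ler_pM ?enorm_ge0 ?nseg_deviation_le//.
by apply: DW; [exact: nseg_iterate_in|exact: nseg_ghost_in].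
Qed.

(** Empirical regret plus stability.  The right-hand side does not depend on the
    comparator, which is why the supremum over comparators may stand inside the
    expectation over the internal randomness. *)
Lemma weak_gap_fixed (P : probability Z R) w : W w ->
  \int[iid P n]_S mean_gap P (nseg_output S) w <=
  optimization_bound + 2 * M * stability_bound +
  T%:R^-1 * \int[iid P n]_S noise_term S.
Proof.
move=> Ww.
pose Q (p : Z * n.-tuple Z) := g p.1 (nseg_output p.2) w.
have mQ : measurable_fun setT Q.
  apply: (@measurable_caratheodory _ _ R d W (fun p v => g p.1 v w) (2 * M)
    (fun p : Z * n.-tuple Z => nseg_output p.2)).
  - by move=> v Wv; apply: (measurableT_comp (mg Wv Ww)); exact: measurable_fst.
  - by move=> p v v' Wv Wv'; exact: g_lip.
  - by move=> p; exact: nseg_output_in.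
  - by apply: measurable_nseg_output; exact: measurable_snd.
have QB p : `|Q p| <= 2 * M * D by apply: g_bound => //; exact: nseg_output_in.
have := @generalization R _ Z P n Q _
  (fun k => 2 * M * (\sum_(t < T) drift_at k t.+1 + 2 * gamma * M)) n0 mQ QB.
have stab k S b : Q (b, S) - Q (b, resample k S b) <=
    2 * M * (\sum_(t < T) drift_at k t.+1 + 2 * gamma * M).
  rewrite (le_trans (ler_norm _))// (le_trans (g_lip _ _ _ Ww))//; try exact: nseg_output_in.
  by rewrite ler_wpM2l ?nseg_output_stable// mulr_ge0// ltW.
move=> /(_ stab) /le_trans; apply.
rewrite -mulr_sumr mulrCA mean_drift addrAC lerD2r.
have intN : (iid P n).-integrable setT (EFin \o (fun S => T%:R^-1 * noise_term S)).
  apply: (bounded_integrable _ (B := `|T%:R^-1| * \sum_(t < T) (2 * M + enorm (x2 t.+1)) * D)).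
    by apply: measurable_funM; [exact: measurable_cst|exact: measurable_noise_term].
  by move=> S; rewrite normrM ler_wpM2l ?noise_term_bound.
have intN' : (iid P n).-integrable setT (EFin \o noise_term).
  exact: (bounded_integrable _ measurable_noise_term noise_term_bound).
rewrite -RintegralZl// -[X in X + _](Rintegral_prob_cst (iid P n)) -RintegralD//; last first.
  by apply: (bounded_integrable _ (B := `|optimization_bound|)); [exact: measurable_cst|].
apply: le_Rintegral => //; last by move=> S _; exact: empirical_gap.
- have mk k : measurable_fun setT (fun S : n.-tuple Z => Q (tnth S k, S)).
    apply: (measurableT_comp mQ); apply: measurable_fun_pair => //.
    exact: measurable_tnth.
  apply: (bounded_integrable _ (B := 2 * M * D)).
    by apply: measurable_funM; [exact: measurable_cst|apply: measurable_sum].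
  move=> S; rewrite normrM gtr0_norm ?invr_gt0// mulrC ler_pdivrMr//.
  rewrite (le_trans (ler_norm_sum _ _ _))// (le_trans (ler_sum _ (fun k _ => QB _)))//.
  by rewrite sumr_const card_ord mulr_natr.
- apply: (bounded_integrable _ (B := `|optimization_bound| +
    `|T%:R^-1| * \sum_(t < T) (2 * M + enorm (x2 t.+1)) * D)).
    apply: measurable_funD; first exact: measurable_cst.
    by apply: measurable_funM; [exact: measurable_cst|exact: measurable_noise_term].
  move=> S; rewrite (le_trans (ler_normD _ _))// lerD2l normrM ler_wpM2l//.
  exact: noise_term_bound.
Qed.

End fixed_randomness.
End sampled_operators.

(** * The noise terms are centered *)

Section joint_measurability.
Variables (R : realType) (d n : nat) (dZ : measure_display) (Z : measurableType dZ).
Variables (W : set 'rV[R]_d) (D L M : R) (F : Z -> 'rV[R]_d -> 'rV[R]_d).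
Hypothesis sviF : svi_instance W D L M F.
Hypothesis n0 : (0 < n)%N.
Variables (gamma : R) (u0 : 'rV[R]_d).
Hypothesis Wu0 : W u0.
Variables (dO : measure_display) (O : measurableType dO).
Variables (i1 i2 : nat -> O -> 'I_n) (xi1 xi2 : nat -> O -> 'rV[R]_d).

(** The iterates as functions of the pair of internal randomness and data. *)
Definition random_iterate (p : O * n.-tuple Z) (t : nat) : 'rV[R]_d :=
  nseg_iterate W F gamma (i1^~ p.1) (i2^~ p.1) (xi1^~ p.1) (xi2^~ p.1) u0 p.2 t.
Definition random_ghost (p : O * n.-tuple Z) (t : nat) : 'rV[R]_d :=
  nseg_ghost W F gamma (i1^~ p.1) (i2^~ p.1) (xi1^~ p.1) (xi2^~ p.1) u0 p.2 t.

Lemma random_iterate_in p t : W (random_iterate p t).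
Proof. by apply: nseg_w_in => //; case: sviF. Qed.

Lemma random_ghost_in p t : W (random_ghost p t).
Proof. by apply: ghost_in => //; case: sviF. Qed.

Definition measurable_index (i : O -> 'I_n) := forall k, measurable (i @^-1` [set k]).

(** The point $w_{t+1}$ uses the first half of step $t+1$ but not the second one,
    and the auxiliary point $v_t$ uses the steps up to $t$ only. *)
Lemma measurable_past (t : nat) :
  (forall s, (0 < s <= t.+1)%N -> measurable_index (i1 s) /\ measurable_vec (xi1 s)) ->
  (forall s, (0 < s <= t)%N -> measurable_index (i2 s) /\ measurable_vec (xi2 s)) ->
  measurable_vec (random_iterate^~ t.+1) /\ measurable_vec (random_ghost^~ t).
Proof.
have [cW convW _ _ _] := sviF.
have op (i : nat -> O -> 'I_n) xi s : measurable_index (i s) -> measurable_vec (xi s) ->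
    random_operator W L (fun (p : O * n.-tuple Z) v => F (tnth p.2 (i s p.1)) v + xi s p.1).
  move=> mi mxi; apply: (random_sampled sviF (i := fun p : O * n.-tuple Z => i s p.1)
    (x := fun p : O * n.-tuple Z => xi s p.1)).
  - exact: measurable_snd.
  - move=> k; have := @measurable_fst _ _ O (n.-tuple Z) measurableT _ (mi k).
    by rewrite setTI.
  - by move=> j; apply: (measurableT_comp (mxi j)); exact: measurable_fst.
move=> H1 H2; split.
- apply: (@measurable_nseg_w _ _ R d W cW convW L gamma
    (fun s (p : O * n.-tuple Z) v => F (tnth p.2 (i1 s p.1)) v + xi1 s p.1)
    (fun s (p : O * n.-tuple Z) v => F (tnth p.2 (i2 s p.1)) v + xi2 s p.1)
    u0 t.+1 t) => // s.
    by move=> /H1[]; exact: op.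
  by move=> /H2[]; exact: op.
- apply: (@measurable_ghost _ _ R d W cW convW L gamma
    (fun s (p : O * n.-tuple Z) v => F (tnth p.2 (i1 s p.1)) v + xi1 s p.1)
    (fun s (p : O * n.-tuple Z) v => F (tnth p.2 (i2 s p.1)) v + xi2 s p.1)
    u0 t t _ _ _ (fun p => empirical F p.2)) => //.
  + by move=> s /andP[s0 st]; apply: op; apply H1; rewrite s0 ltnW.
  + by move=> s /H2[]; exact: op.
  + by apply: (random_empirical sviF n0); exact: measurable_snd.
Qed.

End joint_measurability.

Section centered_noise.
Variables (R : realType) (d n : nat) (dZ dO : measure_display).
Variables (Z : measurableType dZ) (O : measurableType dO).
Variables (P : probability Z R) (PA : probability O R).
Variables (W : set 'rV[R]_d) (D L M : R) (F : Z -> 'rV[R]_d -> 'rV[R]_d).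
Hypothesis sviF : svi_instance W D L M F.
Hypotheses (L0 : 0 < L) (M0 : 0 < M) (n0 : (0 < n)%N).
Variables (gamma sigma : R) (T : nat) (u0 : 'rV[R]_d).
Hypotheses (Wu0 : W u0) (sigma0 : 0 < sigma).
Variables (i1 i2 : nat -> O -> 'I_n) (xi1 xi2 : nat -> O -> 'rV[R]_d).
Hypothesis rnd : nseg_randomness PA T (fun=> sigma) i1 i2 xi1 xi2.

Let K : finType := (('I_T + 'I_T) + ('I_T * 'I_d + 'I_T * 'I_d))%type.

Definition coordinate_events (k : K) : set_system O :=
  match k with
  | inl (inl t) => preimage_set_system setT (i1 t.+1) setT
  | inl (inr t) => preimage_set_system setT (i2 t.+1) setT
  | inr (inl (t, j)) => preimage_set_system setT (fun o => xi1 t.+1 o 0 j) measurable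
  | inr (inr (t, j)) => preimage_set_system setT (fun o => xi2 t.+1 o 0 j) measurable
  end.

Let indep : mutually_independent PA coordinate_events.
Proof. by case: rnd. Qed.

Lemma preimage_set_systemI (U V : Type) (f : U -> V) (E : set_system V) :
  setI_closed E -> setI_closed (preimage_set_system setT f E).
Proof.
move=> EI _ _ [A EA <-] [B EB <-]; exists (A `&` B); first exact: EI.
by rewrite !setTI preimage_setI.
Qed.

Lemma coordinate_eventsT k : coordinate_events k setT.
Proof.
by case: k => [[t|t]|[[t j]|[t j]]]; exists setT => //; rewrite setTI.
Qed.

Lemma coordinate_eventsI k : setI_closed (coordinate_events k).
Proof.
by case: k => [[t|t]|[[t j]|[t j]]]; apply: preimage_set_systemI => // A B mA mB;
  exact: measurableI.
Qed.

Let unif t : (0 < t <= T)%N -> unif_rv PA (i1 t) /\ unif_rv PA (i2 t).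
Proof. by case: rnd => + _ _; apply. Qed.

Let norm t j : (0 < t <= T)%N -> normal_rv PA 0 sigma (fun o => xi1 t o 0 j) /\
  normal_rv PA 0 sigma (fun o => xi2 t o 0 j).
Proof. by case: rnd => _ + _; apply. Qed.

Let ordT (t : 'I_T) : (0 < t.+1 <= T)%N. Proof. exact: ltn_ord. Qed.

Lemma measurable_index_preimage (i : O -> 'I_n) (A : set 'I_n) :
  measurable_index i -> measurable (i @^-1` A).
Proof.
move=> mi.
have -> : i @^-1` A = \bigcup_(k in A) (i @^-1` [set k]).
  apply/seteqP; split=> [ x Ax|x [k Ak /= ixk]]; first by exists (i x).
  by rewrite /preimage/= ixk.
by apply: fin_bigcup_measurable.
Qed.

Lemma coordinate_events_measurable k : coordinate_events k `<=` measurable.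
Proof.
case: k => [[t|t]|[[t j]|[t j]]] A [B mB <-]; rewrite setTI.
- by apply: measurable_index_preimage => k; case: (unif (ordT t)) => /(_ k)[].
- by apply: measurable_index_preimage => k; case: (unif (ordT t)) => _ /(_ k)[].
- by case: (norm j (ordT t)) => -[mX _] _; rewrite -[X in measurable X]setTI; exact: mX.
- by case: (norm j (ordT t)) => _ [mX _]; rewrite -[X in measurable X]setTI; exact: mX.
Qed.

(** The outcomes seen through all coordinates of the randomness but [c]. *)
Definition others (c : K) :=
  g_sigma_algebraType (\bigcup_(k in [set k | k != c]) coordinate_events k).

Lemma others_measurable c k (A : set O) : k != c -> coordinate_events k A ->
  measurable (A : set (others c)).
Proof. by move=> kc kA; apply: sub_sigma_algebra; exists k. Qed.

(** If [c] is the index or a noise coordinate of the second half of step $t+1$,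
    then $w_{t+1}$ and $v_t$ are functions of the data and of the other coordinates. *)
Lemma past_measurable (c : K) (t : 'I_T) :
  c = inl (inr t) \/ (exists j, c = inr (inr (t, j))) ->
  measurable_vec (random_iterate W F gamma u0 (O := others c) i1 i2 xi1 xi2 ^~ t.+1) /\
  measurable_vec (random_ghost W F gamma u0 (O := others c) i1 i2 xi1 xi2 ^~ t).
Proof.
move=> ct; apply: (measurable_past sviF n0) => // s.
  move=> /andP[s0 st].
  have sT : (s.-1 < T)%N by rewrite prednK// (leq_trans st).
  split.
    move=> k; apply: (@others_measurable c (inl (inl (Ordinal sT)))).
      by case: ct => [->|[j ->]].
    by exists [set k] => //; rewrite /= prednK// setTI.
  move=> j _ B mB; apply: (@others_measurable c (inr (inl (Ordinal sT, j)))).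
    by case: ct => [->|[j' ->]].
  by exists B => //; rewrite /= prednK.
move=> /andP[s0 st].
have sT : (s.-1 < T)%N by rewrite prednK// (leq_trans st)// ltnW.
have neq : (Ordinal sT == t) = false.
  by apply/eqP => /(congr1 val)/= E; move: st; rewrite -E leqNgt prednK ?leqnn.
split.
  move=> k; apply: (@others_measurable c (inl (inr (Ordinal sT)))).
    case: ct => [->|[j ->]//].
    by apply/eqP => -[]/(congr1 (fun x : 'I_T => x == t)); rewrite neq eqxx.
  by exists [set k] => //; rewrite /= prednK// setTI.
move=> j _ B mB; apply: (@others_measurable c (inr (inr (Ordinal sT, j)))).
  case: ct => [->//|[j' ->]].
  by apply/eqP => -[]/(congr1 (fun x : 'I_T => x == t)); rewrite neq eqxx.
by exists B => //; rewrite /= prednK.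
Qed.

Let DW w1 w2 : W w1 -> W w2 -> enorm (w1 - w2) <= D.
Proof. by move=> W1 W2; case: sviF => cW _ -> _ _; apply: le_diameter => //; exists w1. Qed.
Let FM b v : W v -> enorm (F b v) <= M.
Proof. by move=> Wv; case: sviF => _ _ _ /(_ b)[_ _ bnd] _; exact: bnd. Qed.

Local Notation iter := (random_iterate W F gamma u0 i1 i2 xi1 xi2).
Local Notation shadow := (random_ghost W F gamma u0 i1 i2 xi1 xi2).
Let lag (p : O * n.-tuple Z) t := iter p t.+1 - shadow p t.

Let iterW p t : W (iter p t).
Proof. exact: (random_iterate_in sviF). Qed.
Let shadowW p t : W (shadow p t).
Proof. exact: (random_ghost_in sviF). Qed.

Let lag_le p t : enorm (lag p t) <= D.
Proof. exact: DW. Qed.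

Let index_part (k : 'I_n) t (p : O * n.-tuple Z) : R :=
  dotv (F (tnth p.2 k) (iter p t.+1)) (lag p t).
Let noise_part (j : 'I_d) t (p : O * n.-tuple Z) : R := lag p t 0 j.

Let D0 : 0 <= D.
Proof. by rewrite -(enorm0 R d) -(subrr u0); exact: DW. Qed.

Let index_part_le k t p : `|index_part k t p| <= M * D.
Proof. by rewrite (le_trans (normr_dotv_le _ _))// ler_pM ?enorm_ge0 ?FM. Qed.

Let noise_part_le j t p : `|noise_part j t p| <= D.
Proof. by rewrite (le_trans (normr_coord_le _ _)). Qed.

Lemma parts_measurable (dO' : measure_display) (O' : measurableType dO')
    (i1' i2' : nat -> O' -> 'I_n) (xi1' xi2' : nat -> O' -> 'rV[R]_d) t :
  measurable_vec (random_iterate W F gamma u0 i1' i2' xi1' xi2' ^~ t.+1) ->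
  measurable_vec (random_ghost W F gamma u0 i1' i2' xi1' xi2' ^~ t) ->
  (forall k, measurable_fun setT (fun p : O' * n.-tuple Z =>
    dotv (F (tnth p.2 k) (random_iterate W F gamma u0 i1' i2' xi1' xi2' p t.+1))
      (random_iterate W F gamma u0 i1' i2' xi1' xi2' p t.+1 -
       random_ghost W F gamma u0 i1' i2' xi1' xi2' p t))) /\
  (forall j, measurable_fun setT (fun p : O' * n.-tuple Z =>
      (random_iterate W F gamma u0 i1' i2' xi1' xi2' p t.+1 -
       random_ghost W F gamma u0 i1' i2' xi1' xi2' p t) 0 j)).
Proof.
move=> mi mg; have mlag := measurable_vecB mi mg; split=> [k|j]; last exact: mlag.
apply: measurable_dotv => //.
have op : random_operator W L (fun (p : O' * n.-tuple Z) v => F (tnth p.2 k) v + 0).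
  apply: (random_sampled sviF (i := fun _ : O' * n.-tuple Z => k)
    (x := fun _ : O' * n.-tuple Z => 0)).
  - exact: measurable_snd.
  - by move=> k'; rewrite preimage_cst; case: ifP.
  - exact: measurable_vec_cst.
have := measurable_random_operator op _ mi.
move=> /(_ (fun p => random_iterate_in sviF _ Wu0 _ _ _ _ p _)).
by under eq_fun do rewrite addr0.
Qed.

(** $1/n-\mathbf 1[i_2=k]$ is centered, and the data average of the other factor
    depends on the other coordinates only. *)
Lemma centered_index (k : 'I_n) (t : 'I_T) :
  let X o := n%:R^-1 - (i2 t.+1 o == k)%:R in
  let Y o := \int[iid P n]_S index_part k t (o, S) in
  PA.-integrable setT (fun o => (X o * Y o)%:E) /\ \int[PA]_o (X o * Y o) = 0.
Proof.
move=> X Y; pose c : K := inl (inr t).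
have [mi mg] := @past_measurable c t (or_introl erefl).
have [mk mj] := parts_measurable mi mg.
have [mXk PXk] := (unif (ordT t)).2 k.
have mind : measurable_fun setT (fun o => (i2 t.+1 o == k)%:R : R).
  rewrite (_ : (fun _ => _) = \1_(i2 t.+1 @^-1` [set k])).
    exact: measurable_indic.
  apply/funext => o'; rewrite indicE; congr (_%:R); congr nat_of_bool.
  by apply/eqP/idP; rewrite inE.
apply: (centered_orthogonal (c := c) (b := M * D) indep).
- exact: coordinate_eventsT.
- exact: coordinate_eventsI.
- exact: coordinate_events_measurable.
- move=> B _; exists [set m | B (n%:R^-1 - (m == k)%:R)] => //.
  by rewrite setTI.
- apply: (bounded_integrable _ (B := n%:R^-1 + 1)).
    by apply: measurable_funB => //; exact: measurable_cst.
  move=> o'; rewrite (le_trans (ler_normB _ _))// lerD// ?ger0_norm ?invr_ge0//.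
  by rewrite ?lern1; case: eqP; rewrite ?normr0 ?normr1 ?ler01.
- rewrite RintegralB//; last 2 first.
  + by apply: (bounded_integrable _ (B := `|n%:R^-1|)); [exact: measurable_cst|].
  + apply: (bounded_integrable _ (B := 1)) => // o'.
    by rewrite ger0_norm//; case: eqP; rewrite ?ler01.
  rewrite Rintegral_prob_cst /Rintegral.
  rewrite (_ : (fun x => _) = fun x => (\1_(i2 t.+1 @^-1` [set k]) x)%:E).
    by rewrite integral_indic//= setIT PXk subrr.
  apply/funext => o'; rewrite indicE; congr (_%:R%:E); congr nat_of_bool.
  by apply/eqP/idP; rewrite inE.
- exact: (@measurable_partial_integral _ _ (others c) (n.-tuple Z) R (iid P n)
    (index_part k t) (M * D) (mk k) (index_part_le k t)).
- move=> o'; apply: bounded_Rintegral => //.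
  exact: (measurableT_comp (mk k) (measurable_pair1 (o' : others c))).
Qed.

Lemma centered_gaussian (j : 'I_d) (t : 'I_T) :
  let X o := xi2 t.+1 o 0 j in
  let Y o := \int[iid P n]_S noise_part j t (o, S) in
  PA.-integrable setT (fun o => (X o * Y o)%:E) /\ \int[PA]_o (X o * Y o) = 0.
Proof.
move=> X Y; pose c : K := inr (inr (t, j)).
have [mi mg] := @past_measurable c t (or_intror (ex_intro _ j erefl)).
have [mk mj] := parts_measurable mi mg.
have normX := (norm j (ordT t)).2.
apply: (centered_orthogonal (c := c) (b := D) indep).
- exact: coordinate_eventsT.
- exact: coordinate_eventsI.
- exact: coordinate_events_measurable.
- by move=> B mB; exists B => //; rewrite setTI.
- exact: (normal_integrable sigma0 normX).
- exact: (normal_mean sigma0 normX).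
- exact: (@measurable_partial_integral _ _ (others c) (n.-tuple Z) R (iid P n)
    (noise_part j t) D (mj j) (noise_part_le j t)).
- move=> o'; apply: bounded_Rintegral => //.
  exact: (measurableT_comp (mj j) (measurable_pair1 (o' : others c))).
Qed.

Definition random_noise o S :=
  noise_term W F gamma T (i1^~ o) (i2^~ o) (xi1^~ o) (xi2^~ o) u0 S.

(** The deviation is $\sum_k(1/n-\mathbf 1[i_2=k])F_{\beta_k}(w)-\xi_2$: a
    combination of centered coordinates, whose coefficients involve the past. *)
Lemma random_noiseE o :
  \int[iid P n]_S random_noise o S =
  \sum_(t < T) (\sum_(k < n) (n%:R^-1 - (i2 t.+1 o == k)%:R) *
      \int[iid P n]_S index_part k t (o, S) -
    \sum_(j < d) xi2 t.+1 o 0 j * \int[iid P n]_S noise_part j t (o, S)).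
Proof.
have parts (t : 'I_T) :
    (forall k, (iid P n).-integrable setT (EFin \o (fun S => index_part k t (o, S)))) /\
    (forall j, (iid P n).-integrable setT (EFin \o (fun S => noise_part j t (o, S)))).
  have [mi mg] := @past_measurable (inl (inr t)) t (or_introl erefl).
  have [mk mj] := parts_measurable mi mg; split=> [k|j].
    apply: (bounded_integrable _ (B := M * D)) => //.
    exact: (measurableT_comp (mk k) (measurable_pair1 (o : others (inl (inr t))))).
  apply: (bounded_integrable _ (B := D)) => //.
  exact: (measurableT_comp (mj j) (measurable_pair1 (o : others (inl (inr t))))).
have pointwise S : random_noise o S =
    \sum_(t < T) (\sum_(k < n) (n%:R^-1 - (i2 t.+1 o == k)%:R) * index_part k t (o, S) -
      \sum_(j < d) xi2 t.+1 o 0 j * noise_part j t (o, S)).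
  apply: eq_bigr => t _.
  rewrite /nseg_deviation /deviation opprD addrA dotvBl; congr (_ - _).
  rewrite dotvBl dotvZl dotv_suml.
  under [in RHS]eq_bigr do rewrite mulrBl.
  rewrite sumrB -mulr_sumr; congr (_ - _).
  rewrite (bigD1 (i2 t.+1 o))//= eqxx mul1r big1 ?addr0// => k.
  by rewrite eq_sym => /negbTE ->; rewrite mul0r.
under eq_Rintegral do rewrite pointwise.
have intZ (c : R) (f : n.-tuple Z -> R) : (iid P n).-integrable setT (EFin \o f) ->
    (iid P n).-integrable setT (EFin \o (fun S => c * f S)).
  by move=> intf; apply: (eq_integrable _ (fun S => (c%:E * (EFin \o f) S)%E)) => //;
    exact: integrableZl.
have intS (m : nat) (f : 'I_m -> n.-tuple Z -> R) :
    (forall i, (iid P n).-integrable setT (EFin \o f i)) ->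
    (iid P n).-integrable setT (EFin \o (fun S => \sum_(i < m) f i S)).
  move=> intf; apply: (eq_integrable _ (fun S => (\sum_(i < m) (f i S)%:E)%E)) => //.
    by move=> S _ /=; rewrite sumEFin.
  by apply: integrable_sum => // i _; exact: intf.
have intK (t : 'I_T) : (iid P n).-integrable setT (EFin \o (fun S =>
    \sum_(k < n) (n%:R^-1 - (i2 t.+1 o == k)%:R) * index_part k t (o, S))).
  by apply: intS => k; apply: intZ; case: (parts t).
have intJ (t : 'I_T) : (iid P n).-integrable setT (EFin \o (fun S =>
    \sum_(j < d) xi2 t.+1 o 0 j * noise_part j t (o, S))).
  by apply: intS => j; apply: intZ; case: (parts t).
rewrite Rintegral_sum; last first.
  by move=> t; exact: (integrableB measurableT (intK t) (intJ t)).
apply: eq_bigr => t _; rewrite RintegralB//.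
rewrite Rintegral_sum; last by move=> k; apply: intZ; case: (parts t).
rewrite Rintegral_sum; last by move=> j; apply: intZ; case: (parts t).
congr (_ - _); apply: eq_bigr => k _.
  by rewrite RintegralZl//; case: (parts t).
by rewrite RintegralZl//; case: (parts t).
Qed.

Lemma random_noise_centered :
  PA.-integrable setT (fun o => (\int[iid P n]_S random_noise o S)%:E) /\
  \int[PA]_o \int[iid P n]_S random_noise o S = 0.
Proof.
have intS (m : nat) (f : 'I_m -> O -> R) :
    (forall i, PA.-integrable setT (EFin \o f i)) ->
    PA.-integrable setT (EFin \o (fun o => \sum_(i < m) f i o)).
  move=> intf; apply: (eq_integrable _ (fun o => (\sum_(i < m) (f i o)%:E)%E)) => //.
    by move=> S _ /=; rewrite sumEFin.
  by apply: integrable_sum => // i _; exact: intf.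
have intK (t : 'I_T) := intS n _ (fun k => (centered_index k t).1).
have intJ (t : 'I_T) := intS d _ (fun j => (centered_gaussian j t).1).
have int_t (t : 'I_T) := integrableB measurableT (intK t) (intJ t).
split.
  apply: (eq_integrable _ (EFin \o (fun o => \sum_(t < T) (\sum_(k < n)
     (n%:R^-1 - (i2 t.+1 o == k)%:R) * \int[iid P n]_S index_part k t (o, S) -
    \sum_(j < d) xi2 t.+1 o 0 j * \int[iid P n]_S noise_part j t (o, S))))) => //.
    by move=> o' _; rewrite /= random_noiseE.
  by apply: intS => t; exact: int_t.
under eq_Rintegral do rewrite random_noiseE.
rewrite Rintegral_sum; last by move=> t; exact: int_t.
rewrite big1// => t _; rewrite RintegralB//.
rewrite Rintegral_sum; last by move=> k; case: (centered_index k t).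
rewrite Rintegral_sum; last by move=> k; case: (centered_gaussian k t).
rewrite big1 => [|k _]; last by case: (centered_index k t).
by rewrite big1 => [|k _]; [rewrite subrr|case: (centered_gaussian k t)].
Qed.

End centered_noise.

(** * Step size and rate *)

Section rate.
Variables (R : realType) (d n : nat) (D L M eps eta : R).
Hypotheses (n0 : (0 < n)%N) (D0 : 0 < D) (L0 : 0 < L) (M0 : 0 < M) (eps0 : 0 < eps).
Hypothesis eta01 : 0 < eta < 1.

Let N : R := n%:R.
Let kappa : R := Num.sqrt (d%:R * ln eta^-1) / eps.
Let mu : R := Num.max (Num.sqrt N) kappa.
Let m : R := Num.min (D / M) L^-1.
Let gamma := nseg_stepsize d n D L M eps eta.
Let sigma := nseg_sigma M eps eta.

Let lneta : 0 < ln eta^-1.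
Proof. by case/andP: eta01 => e0 e1; rewrite ln_gt0// invf_gt1. Qed.

Let N1 : 1 <= N. Proof. by rewrite ler1n. Qed.
Let N0 : 0 < N. Proof. exact: lt_le_trans N1. Qed.
Let kappa0 : 0 <= kappa. Proof. by rewrite divr_ge0 ?sqrtr_ge0 ?(ltW eps0). Qed.
Let sqrtN1 : 1 <= Num.sqrt N. Proof. by rewrite -sqrtr1 ler_wsqrtr. Qed.
Let mu1 : 1 <= mu. Proof. by rewrite le_max sqrtN1. Qed.
Let mu0 : 0 < mu. Proof. exact: lt_le_trans mu1. Qed.
Let kappa_mu : kappa <= mu. Proof. by rewrite le_max lexx orbT. Qed.

Let mu2 : N <= mu ^+ 2.
Proof.
rewrite -[leLHS](sqr_sqrtr (ltW N0)) ler_pXn2r ?nnegrE ?sqrtr_ge0 ?(ltW mu0)//.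
by rewrite le_max lexx.
Qed.

Let m0 : 0 < m. Proof. by rewrite lt_min divr_gt0//= invr_gt0. Qed.
Let mM : M * m <= D. Proof. by rewrite mulrC -ler_pdivlMr// ge_min lexx. Qed.
Let mL : L * m <= 1. Proof. by rewrite mulrC -ler_pdivlMr// div1r ge_min lexx orbT. Qed.

Let gammaE : gamma = m / (N * mu). Proof. by []. Qed.

Lemma stepsize_gt0 : 0 < gamma.
Proof. by rewrite gammaE divr_gt0// mulr_gt0. Qed.

Lemma stepsize_lipschitz : gamma * L <= 1.
Proof.
rewrite gammaE mulrAC ler_pdivrMr ?mulr_gt0// mul1r mulrC (le_trans mL)//.
by rewrite -[leLHS]mulr1 ler_pM.
Qed.

Lemma sigma_gt0 : 0 < sigma.
Proof. by rewrite sqrtr_gt0 divr_gt0 ?mulr_gt0 ?exprn_gt0. Qed.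

(** The second moment of a noise vector, each coordinate contributing at most
    $6\sigma^2$, equals $48M^2\kappa^2$ with $\kappa=\sqrt{d\ln(1/\eta)}/\varepsilon$. *)
Lemma total_noise : d%:R * (6 * sigma ^+ 2) = 48 * M ^+ 2 * kappa ^+ 2.
Proof.
rewrite sqr_sqrtr; last by rewrite divr_ge0 ?mulr_ge0 ?(ltW M0) ?(ltW eps0) ?(ltW lneta).
rewrite /kappa expr_div_n sqr_sqrtr; last by rewrite mulr_ge0 ?ler0n ?(ltW lneta).
by field; rewrite gt_eqF.
Qed.

Let rho := mu / N.

Let rhoE : rho = Num.max (Num.sqrt N)^-1 (Num.sqrt (d%:R * ln eta^-1) / (N * eps)).
Proof.
rewrite /rho maxr_pMl ?invr_ge0 ?ltW//; congr Num.max; last first.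
  by rewrite /kappa -mulrA -invfM [eps * N]mulrC.
rewrite -{2}(sqr_sqrtr (ltW N0)) expr2 invfM mulrA divff ?mul1r//.
by rewrite gt_eqF// (lt_le_trans ltr01).
Qed.

Let rho0 : 0 < rho. Proof. by rewrite divr_gt0. Qed.
Let imu_rho : mu^-1 <= rho.
Proof. by rewrite ler_pdivlMr// ler_pdivrMl// -expr2. Qed.
Let iNmu_rho : (N * mu)^-1 <= rho.
Proof.
rewrite (le_trans _ imu_rho)// lef_pV2 ?posrE ?mulr_gt0//.
by rewrite -[leLHS]mul1r ler_pM2r.
Qed.

Lemma rate_ge : (M * D + L * D ^+ 2) * rho <= nseg_rate d n D L M eps eta.
Proof.
rewrite rhoE lerDl divr_ge0 ?powR_ge0//.
by rewrite !mulr_ge0 ?ltW.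
Qed.

(** The constants of the bound for fixed randomness, where $|\xi_1|$ is first
    bounded by $(M\mu+|\xi_1|^2/M\mu)/2$, the balance at which
    its mean has the right order. *)
Definition const_coef : R := D ^+ 2 / (gamma * N ^+ 2) + 7 * gamma * M ^+ 2 +
  2 * M * (N ^+ 2 * (4 * gamma * M / N + 2 * gamma ^+ 2 * L ^+ 2 * D +
    4 * gamma ^+ 2 * L * (M + M * mu / 2)) + 2 * gamma * M).
Definition noise1_coef : R := gamma / N ^+ 2 + 4 * gamma ^+ 2 * L / mu.
Definition noise2_coef : R := 3 * gamma / N ^+ 2.

Lemma const_coef_ge0 : 0 <= noise1_coef /\ 0 <= noise2_coef.
Proof.
rewrite /noise1_coef /noise2_coef; have := stepsize_gt0; move: mu0 N0.
generalize gamma mu N => g m' N' m'0 N'0 g0.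
by split; rewrite ?addr_ge0 ?divr_ge0 ?mulr_ge0 ?exprn_ge0 ?(ltW g0) ?(ltW L0)
  ?(ltW N'0) ?(ltW m'0).
Qed.

(** Young's inequality. *)
Lemma noise_young (a : R) : a <= (M * mu + a ^+ 2 / (M * mu)) / 2.
Proof.
have Mmu : 0 < M * mu by rewrite mulr_gt0.
rewrite ler_pdivlMr// -(ler_pM2r Mmu) [leRHS]mulrDl divfK ?gt_eqF//.
by have := sqr_ge0 (a - M * mu); nra.
Qed.

(** With $m=\min(D/M,1/L)$ and $\mu=\max(\sqrt n,\kappa)$ the step size is
    $m/(n\mu)$, where $Mm\le D$, $Lm\le1$, $D^2/m\le MD+LD^2$ and
    $1/\mu\le\mu/n$.  The first term contributes $(MD+LD^2)\mu/n$ and all others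
    together $419\,MD\mu/n$. *)
Lemma rate_bound :
  const_coef + N ^+ 2 * ((noise1_coef + noise2_coef) * (48 * M ^+ 2 * kappa ^+ 2)) <=
  420 * nseg_rate d n D L M eps eta.
Proof.
rewrite (le_trans _ (ler_wpM2l _ rate_ge))//.
have [c1 c2] := const_coef_ge0.
have kmu : 48 * M ^+ 2 * kappa ^+ 2 <= 48 * M ^+ 2 * mu ^+ 2.
  apply: ler_wpM2l; first by rewrite mulr_ge0// sqr_ge0.
  by rewrite ler_pXn2r// nnegrE (ltW mu0).
apply: (@le_trans _ _ (const_coef + N ^+ 2 * ((noise1_coef + noise2_coef) * (48 * M ^+ 2 * mu ^+ 2)))).
  by rewrite lerD2l ler_wpM2l ?sqr_ge0// ler_wpM2l// addr_ge0.
have Nn0 : N != 0 by rewrite gt_eqF.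
have mun0 : mu != 0 by rewrite gt_eqF.
have mn0 : m != 0 by rewrite gt_eqF.
(* every term is written with the bounded products M m, L m and with powers of 1/mu *)
have -> : const_coef + N ^+ 2 * ((noise1_coef + noise2_coef) * (48 * M ^+ 2 * mu ^+ 2)) =
    D ^+ 2 / m * rho + 11 * (M * (M * m)) * (N * mu)^-1 +
    (8 * (M * (M * m)) + 4 * (M * (M * m)) * (L * m) +
     192 * (M * (M * m)) * (L * m)) * mu^-1 +
    4 * (M * D) * (L * m) ^+ 2 * (mu^-1 * mu^-1) +
    8 * (M * (M * m)) * (L * m) * (mu^-1 * mu^-1) + 192 * (M * (M * m)) * rho.
  rewrite /const_coef /noise1_coef /noise2_coef gammaE /rho.
  by field; rewrite Nn0 mun0 mn0.
have Dm : D ^+ 2 / m <= M * D + L * D ^+ 2.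
  rewrite ler_pdivrMr// /m /Num.min; case: ifP => _.
    have -> : (M * D + L * D ^+ 2) * (D / M) = D ^+ 2 + L * D ^+ 3 / M.
      by field; rewrite gt_eqF.
    by rewrite lerDl divr_ge0 ?mulr_ge0 ?exprn_ge0 ?ltW.
  have -> : (M * D + L * D ^+ 2) / L = D ^+ 2 + M * D / L by field; rewrite gt_eqF.
  by rewrite lerDl divr_ge0 ?mulr_ge0 ?ltW.
set X := M * (M * m).
have X0 : 0 <= X by rewrite !mulr_ge0 ?ltW.
have XE : X <= M * D by rewrite ler_pM2l.
set Y := L * m; have Y0 : 0 <= Y by rewrite mulr_ge0 ?ltW.
have XY : X * Y <= M * D.
  by rewrite -[leRHS]mulr1 ler_pM.
set E := M * D in XE XY Dm *; have E0 : 0 <= E by rewrite mulr_ge0 ?ltW.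
have EY : E * Y ^+ 2 <= E.
  by rewrite -[leRHS]mulr1 ler_wpM2l// expr_le1.
have imu0 : 0 <= mu^-1 by rewrite invr_ge0 ltW.
have imu2 : mu^-1 * mu^-1 <= rho.
  rewrite (le_trans _ imu_rho)// -[leRHS]mulr1 ler_wpM2l// invf_le1//.
have step (a b c e : R) : 0 <= a -> a <= b -> 0 <= c -> c <= e -> a * c <= b * e.
  by move=> *; rewrite ler_pM.
have t1 : D ^+ 2 / m * rho <= (E + L * D ^+ 2) * rho by rewrite ler_wpM2r ?(ltW rho0).
have t2 : 11 * X * (N * mu)^-1 <= 11 * E * rho.
  apply: step => //; [by rewrite mulr_ge0|by rewrite ler_wpM2l|].
  by rewrite invr_ge0 (ltW (mulr_gt0 N0 mu0)).
have t3 : (8 * X + 4 * X * Y + 192 * X * Y) * mu^-1 <= (204 * E) * rho.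
  by have XY0 := mulr_ge0 X0 Y0; apply: step => //; lra.
have t4 : 4 * E * Y ^+ 2 * (mu^-1 * mu^-1) <= 4 * E * rho.
  have EY0 : 0 <= E * Y ^+ 2 by rewrite mulr_ge0// sqr_ge0.
  by apply: step => //; [lra|lra|exact: mulr_ge0].
have t5 : 8 * X * Y * (mu^-1 * mu^-1) <= 8 * E * rho.
  have XY0 := mulr_ge0 X0 Y0.
  by apply: step => //; [lra|lra|exact: mulr_ge0].
have t6 : 192 * X * rho <= 192 * E * rho.
  by rewrite ler_wpM2r ?(ltW rho0)// ler_wpM2l.
have LD0 : 0 <= L * D ^+ 2 * rho by exact: mulr_ge0 (mulr_ge0 (ltW L0) (sqr_ge0 D)) (ltW rho0).
lra.
Qed.

End rate.

(** * The weak gap in expectation *)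

(** The supremum over the comparators need not be measurable in the internal
    randomness, so monotonicity is read off the definition: the integral of a
    nonnegative function is a supremum over the simple functions below it. *)
Lemma le_integral_any (dT : measure_display) (T : measurableType dT) (R : realType)
    (mu : {measure set T -> \bar R}) (f g : T -> \bar R) :
  (forall x, f x <= g x)%E -> (\int[mu]_x f x <= \int[mu]_x g x)%E.
Proof.
move=> fg.
have mono (h k : T -> \bar R) : (forall x, 0 <= h x)%E -> (forall x, h x <= k x)%E ->
    (\int[mu]_x h x <= \int[mu]_x k x)%E.
  move=> h0 hk; rewrite !ge0_integralTE//; last first.
    by move=> x; rewrite (le_trans (h0 x)).
  apply: ge_ereal_sup => _ [s sh <-]; apply: ereal_sup_ubound.
  by exists s => // x; rewrite (le_trans (sh x)).
rewrite integralE [leRHS]integralE; apply: leeB; apply: mono => // x.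
- by rewrite !funeposE ge_max le_max fg/= le_max lexx orbT.
- by rewrite !funenegE ge_max le_max leeN2 fg/= le_max lexx orbT.
Qed.

Section abstract_weak_gap.
Variables (R : realType) (d n : nat) (D L M eps eta : R) (dZ dO : measure_display).
Variables (Z : measurableType dZ) (O : measurableType dO).
Variables (P : probability Z R) (PA : probability O R).
Variables (W : set 'rV[R]_d) (F : Z -> 'rV[R]_d -> 'rV[R]_d) (u0 : 'rV[R]_d).
Variables (i1 i2 : nat -> O -> 'I_n) (xi1 xi2 : nat -> O -> 'rV[R]_d).
Let gamma := nseg_stepsize d n D L M eps eta.
Let sigma := nseg_sigma M eps eta.
Let T := (n ^ 2)%N.
Hypotheses (n0 : (0 < n)%N) (D0 : 0 < D) (L0 : 0 < L) (M0 : 0 < M) (eps0 : 0 < eps).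
Hypothesis eta01 : 0 < eta < 1.
Hypothesis sviF : svi_instance W D L M F.
Hypothesis Wu0 : W u0.
Hypothesis rnd : nseg_randomness PA T (fun=> sigma) i1 i2 xi1 xi2.

(** What the two problems have in common: the loss $g_\beta(v,w)$ of the
    output $v$ against the comparator $w$. *)
Definition gap_function (g : Z -> 'rV[R]_d -> 'rV[R]_d -> R) : Prop :=
  [/\ forall b w x y t, W w -> W x -> W y -> 0 <= t <= 1 ->
        g b (t *: x + (1 - t) *: y) w <= t * g b x w + (1 - t) * g b y w,
      forall b v w, W v -> W w -> g b v w <= dotv (F b v) (v - w),
      forall b v v' w, W v -> W v' -> W w ->
        `|g b v w - g b v' w| <= 2 * M * enorm (v - v'),
      forall b w, W w -> g b w w = 0
    & forall v w, W v -> W w -> measurable_fun setT (fun b => g b v w)].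

Variable g : Z -> 'rV[R]_d -> 'rV[R]_d -> R.
Hypothesis gapg : gap_function g.

Let output o S := nseg W F u0 (fun=> gamma) T i1 i2 xi1 xi2 o S.

Let T0 : (0 < T)%N. Proof. by rewrite expn_gt0 n0. Qed.
Let TE : T%:R = n%:R ^+ 2 :> R. Proof. by rewrite natrX. Qed.
Let gamma0 : 0 < gamma. Proof. exact: stepsize_gt0. Qed.
Let sigma0 : 0 < sigma. Proof. exact: sigma_gt0. Qed.

Lemma nsegE o S : output o S =
  nseg_output W F gamma T (i1^~ o) (i2^~ o) (xi1^~ o) (xi2^~ o) u0 S.
Proof.
rewrite /output /nseg /nseg_output !big_add1/=; set w := nseg_iterate _ _ _ _ _ _ _ _ _.
have -> : \sum_(0 <= t < T) gamma *: w t.+1 = gamma *: \sum_(t < T) w t.+1.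
  by rewrite big_mkord scaler_sumr.
rewrite scalerA sumr_const_nat subn0 -(mulr_natl gamma) invfM -mulrA mulVf ?gt_eqF//.
by rewrite mulr1.
Qed.

Lemma nseg_in o S : W (output o S).
Proof. by rewrite nsegE; apply: (nseg_output_in sviF). Qed.

Lemma mean_gap_integrable o w : W w ->
  (iid P n).-integrable setT (EFin \o (fun S => mean_gap g P (output o S) w)).
Proof.
move=> Ww; have [_ _ g_lip g_diag mg] := gapg.
have gB b S : `|g b (output o S) w| <= 2 * M * D.
  by apply: (g_bound sviF M0 Wu0) => //; exact: nseg_in.
have mQ : measurable_fun setT (fun p : n.-tuple Z * Z => g p.2 (output o p.1) w).
  apply: (@measurable_caratheodory _ _ R d W (fun p v => g p.2 v w) (2 * M)
    (fun p : n.-tuple Z * Z => output o p.1)).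
  - by move=> v Wv; apply: (measurableT_comp (mg _ _ Wv Ww)); exact: measurable_snd.
  - by move=> p v v' Wv Wv'; exact: g_lip.
  - by move=> p; exact: nseg_in.
  - rewrite (_ : (fun p => _) = fun p : n.-tuple Z * Z =>
      nseg_output W F gamma T (i1^~ o) (i2^~ o) (xi1^~ o) (xi2^~ o) u0 p.1).
      by apply: (measurable_nseg_output sviF) => //; exact: measurable_fst.
    by apply/funext => p; rewrite nsegE.
apply: (bounded_integrable _ (B := 2 * M * D)).
  exact: (@measurable_partial_integral _ _ _ _ _ P
    (fun p : n.-tuple Z * Z => g p.2 (output o p.1) w) (2 * M * D) mQ (fun=> gB _ _)).
move=> S; apply: bounded_Rintegral => //.
exact: (measurableT_comp mQ (measurable_pair1 S)).
Qed.

Let c0 := const_coef d n D L M eps eta.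
Let c1 := noise1_coef d n D L M eps eta.
Let c2 := noise2_coef d n D L M eps eta.
Let square o := \sum_(t < T) (c1 * enorm (xi1 t.+1 o) ^+ 2 + c2 * enorm (xi2 t.+1 o) ^+ 2).
Let noise o := \int[iid P n]_S random_noise W F gamma T u0 i1 i2 xi1 xi2 o S.

(** The noise norm enters the stability bound linearly; Young's inequality
    leaves only squared norms, whose means are known. *)
Lemma fixed_randomness_bound o :
  optimization_bound D M gamma T (xi1^~ o) (xi2^~ o) +
  2 * M * stability_bound n D L M gamma T (xi1^~ o) <= c0 + square o.
Proof.
set N : R := n%:R; have N0 : 0 < N by rewrite ltr0n.
set mu := Num.max (Num.sqrt N) (Num.sqrt (d%:R * ln eta^-1) / eps).
have mu0 : 0 < mu by rewrite lt_max sqrtr_gt0 N0.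
pose s := 4 * gamma * M / N + 2 * gamma ^+ 2 * L ^+ 2 * D.
pose e := 7 * gamma * M ^+ 2 / N ^+ 2 +
  2 * M * (s + 4 * gamma ^+ 2 * L * (M + M * mu / 2)).
have c0E : c0 = D ^+ 2 / (gamma * N ^+ 2) + \sum_(t < T) e + 2 * M * (2 * gamma * M).
  rewrite sumr_const card_ord -(mulr_natl e) TE -/N /c0 /const_coef -/gamma -/N -/mu /e /s.
  by field; rewrite !gt_eqF.
rewrite c0E /optimization_bound /stability_bound TE -/N.
set S1 := \sum_(_ < T) (7 * _ + _ + _); set S2 := \sum_(_ < T) (_ + _ + _).
suff : gamma / N ^+ 2 * S1 + 2 * M * S2 <= \sum_(t < T) e + square o.
  by set A := D ^+ 2 / _; lra.
rewrite /square !mulr_sumr -!big_split/=; apply: ler_sum => t _.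
have := noise_young d eps eta n0 M0 (enorm (xi1 t.+1 o)).
rewrite -/N -/mu; set a := enorm (xi1 _ _); set b := enorm (xi2 _ _) => young.
have k0 : 0 <= 2 * M * (4 * gamma ^+ 2 * L).
  apply: mulr_ge0; first by rewrite mulr_ge0 ?(ltW M0).
  by apply: mulr_ge0 (ltW L0); rewrite mulr_ge0// sqr_ge0.
have := ler_wpM2l k0 young.
have -> : 2 * M * (4 * gamma ^+ 2 * L) * ((M * mu + a ^+ 2 / (M * mu)) / 2) =
    2 * M * (4 * gamma ^+ 2 * L) * (M * mu / 2) + 4 * gamma ^+ 2 * L / mu * a ^+ 2.
  by field; rewrite !gt_eqF.
rewrite /c1 /c2 /noise1_coef /noise2_coef -/gamma -/N -/mu /e /s.
set q := gamma / N ^+ 2.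
have -> : 7 * gamma * M ^+ 2 / N ^+ 2 = 7 * M ^+ 2 * q by rewrite /q; ring.
have -> : 3 * gamma / N ^+ 2 = 3 * q by rewrite /q; ring.
lra.
Qed.

Let normal t j : (0 < t <= T)%N -> normal_rv PA 0 sigma (fun o => xi1 t o 0 j) /\
  normal_rv PA 0 sigma (fun o => xi2 t o 0 j).
Proof. by case: rnd => _ + _; apply. Qed.

Lemma noise_vector_moment (xi : O -> 'rV[R]_d) :
  (forall j, normal_rv PA 0 sigma (fun o => xi o 0 j)) ->
  PA.-integrable setT (EFin \o (fun o => enorm (xi o) ^+ 2)) /\
  \int[PA]_o (enorm (xi o) ^+ 2) <=
    48 * M ^+ 2 * (Num.sqrt (d%:R * ln eta^-1) / eps) ^+ 2.
Proof.
move=> nxi.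
have int2 j : PA.-integrable setT (EFin \o (fun o => xi o 0 j ^+ 2)).
  exact: (normal_sqr_integrable sigma0 (nxi j)).
have E : (fun o => enorm (xi o) ^+ 2) = (fun o => \sum_(j < d) xi o 0 j ^+ 2).
  by apply/funext => o; rewrite enorm2_sum.
rewrite E; split.
  apply: (eq_integrable _ (fun o => (\sum_(j < d) (xi o 0 j ^+ 2)%:E)%E)) => //.
    by move=> S _ /=; rewrite sumEFin.
  by apply: integrable_sum => // j _; exact: int2.
rewrite Rintegral_sum// -(total_noise d M0 eps0 eta01).
rewrite -[d in leRHS](card_ord d) mulr_natl -sumr_const; apply: ler_sum => j _.
rewrite -lee_fin -integral_Rintegral//.
exact: (normal_second_moment sigma0 (nxi j)).
Qed.

Lemma weak_gap_bound :
  (\int[PA]_o ereal_sup [set \int[iid P n]_S (mean_gap g P (output o S) w)%:E | w in W]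
    <= (420 * nseg_rate d n D L M eps eta)%:E)%E.
Proof.
have [gconv g_le g_lip g_diag mg] := gapg.
have [int_noise noise0] := random_noise_centered P sviF n0 gamma Wu0 sigma0 rnd.
have mom1 (t : 'I_T) := noise_vector_moment (fun j => (normal j (ltn_ord t : (0 < t.+1 <= T)%N)).1).
have mom2 (t : 'I_T) := noise_vector_moment (fun j => (normal j (ltn_ord t : (0 < t.+1 <= T)%N)).2).
have intZ c f : PA.-integrable setT (EFin \o f) ->
    PA.-integrable setT (EFin \o (fun o => c * f o)).
  by move=> intf; apply: (eq_integrable _ (fun o => (c%:E * (EFin \o f) o)%E)) => //;
    exact: integrableZl.
have int12 (t : 'I_T) : PA.-integrable setT
    (EFin \o (fun o => c1 * enorm (xi1 t.+1 o) ^+ 2 + c2 * enorm (xi2 t.+1 o) ^+ 2)).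
  exact: (integrableD measurableT (intZ c1 _ (mom1 t).1) (intZ c2 _ (mom2 t).1)).
have int_square : PA.-integrable setT (EFin \o square).
  apply: (eq_integrable _ (fun o => (\sum_(t < T) (c1 * enorm (xi1 t.+1 o) ^+ 2 +
    c2 * enorm (xi2 t.+1 o) ^+ 2)%:E)%E)) => //.
    by move=> S _ /=; rewrite sumEFin.
  by apply: integrable_sum => // t _; exact: int12.
have int_c : PA.-integrable setT (EFin \o (fun=> c0)).
  by apply: (bounded_integrable _ (B := `|c0|)); [exact: measurable_cst|].
have int_cs : PA.-integrable setT (EFin \o (fun o => c0 + square o)).
  exact: (integrableD measurableT int_c int_square).
have int_n : PA.-integrable setT (EFin \o (fun o => T%:R^-1 * noise o)).
  exact: intZ.
pose B o := c0 + square o + T%:R^-1 * noise o.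
apply: (@le_trans _ _ (\int[PA]_o (B o)%:E)%E).
  apply: le_integral_any => o; apply: ge_ereal_sup => _ [w Ww <-].
  rewrite integral_Rintegral; last exact: mean_gap_integrable.
  rewrite lee_fin.
  under eq_Rintegral do rewrite nsegE.
  rewrite (le_trans (weak_gap_fixed sviF L0 M0 n0 (i1^~ o) (i2^~ o) (xi1^~ o) (xi2^~ o)
    gamma0 _ T0 Wu0 gconv g_le g_lip g_diag mg P Ww))//.
    exact: stepsize_lipschitz.
  by rewrite /B lerD2r fixed_randomness_bound.
rewrite integral_Rintegral; last exact: (integrableD measurableT int_cs int_n).
rewrite lee_fin /B RintegralD// RintegralZl// noise0 mulr0 addr0.
rewrite RintegralD// Rintegral_prob_cst Rintegral_sum//.
rewrite (le_trans _ (rate_bound d eta n0 D0 L0 M0 eps0))// lerD2l -TE.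
rewrite mulr_natl -[in X in _ *+ X](card_ord T) -sumr_const; apply: ler_sum => t _.
have [c1_ge0 c2_ge0] := const_coef_ge0 d eps eta n0 D0 L0 M0.
rewrite RintegralD//; [|exact: (intZ c1 _ (mom1 t).1)|exact: (intZ c2 _ (mom2 t).1)].
rewrite (RintegralZl c1 measurableT (mom1 t).1) (RintegralZl c2 measurableT (mom2 t).1).
by rewrite [leRHS]mulrDl lerD// ler_wpM2l//; [case: (mom1 t)|case: (mom2 t)].
Qed.

End abstract_weak_gap.

(** * Variational inequalities and saddle points *)

Section variational_inequality.
Variables (R : realType) (d : nat) (D L M : R) (dZ : measure_display).
Variables (Z : measurableType dZ) (P : probability Z R) (W : set 'rV[R]_d).
Variable F : Z -> 'rV[R]_d -> 'rV[R]_d.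
Hypotheses (sviF : svi_instance W D L M F) (M0 : 0 < M).

Let gap b v w : R := dotv (F b w) (v - w).

(** Monotonicity replaces $F_\beta(w)$ by $F_\beta(v)$ in $\langle F_\beta(w),v-w\rangle$. *)
Lemma vi_gap_function : gap_function M W F gap.
Proof.
have [_ _ _ Fmono mF] := sviF; split.
- move=> b w x y t _ _ _ _; rewrite /gap.
  have -> : t *: x + (1 - t) *: y - w = t *: (x - w) + (1 - t) *: (y - w).
    by apply/rowP => j; rewrite !mxE; ring.
  by rewrite dotvDr !dotvZr.
- move=> b v w Wv Ww; have [mono _ _] := Fmono b.
  by have := mono _ _ Wv Ww; rewrite /gap dotvBl subr_ge0.
- move=> b v v' w _ _ Ww; have [_ _ bnd] := Fmono b.
  rewrite /gap -dotvBr opprB addrA subrK (le_trans (normr_dotv_le _ _))//.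
  rewrite ler_wpM2r ?enorm_ge0// (le_trans (bnd _ Ww))//.
  by rewrite mulr2n mulrDl mul1r lerDl ltW.
- by move=> b w _; rewrite /gap subrr dotv0.
- move=> v w _ Ww; apply: measurable_dotv; last exact: measurable_vec_cst.
  by move=> j; exact: mF.
Qed.

(** The loss is linear in the operator, so its mean is the loss of the mean. *)
Lemma mean_operatorE v w : W w -> dotv (mean_operator P F w) (v - w) = mean_gap gap P v w.
Proof.
move=> Ww; have [_ _ _ Fmono mF] := sviF.
have intF j : P.-integrable setT (EFin \o (fun b => F b w 0 j)).
  apply: (bounded_integrable _ (B := M)); first exact: mF.
  move=> b; rewrite (le_trans (normr_coord_le _ _))//.
  by case: (Fmono b) => _ _; exact.
rewrite /mean_gap /gap /dotv Rintegral_sum; last first.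
  move=> j; apply: (eq_integrable _ (fun b => (((v - w) 0 j)%:E * (F b w 0 j)%:E)%E)) => //.
    by move=> b _; rewrite /= -EFinM mulrC.
  by apply: integrableZl => //; exact: intF.
by apply: eq_bigr => j _; rewrite RintegralZr// mxE unlock.
Qed.

End variational_inequality.

Section gradients.
Variables (R : realType) (d : nat) (X : set 'rV[R]_d) (f : 'rV[R]_d -> R).
Hypotheses (convX : convex_set X) (convf : convex_function X f).

Lemma convex_function_comb x y (t : R) : X x -> X y -> 0 <= t <= 1 ->
  f (t *: x + (1 - t) *: y) <= t * f x + (1 - t) * f y.
Proof.
move=> Xx Xy /andP[t0 t1]; have := convf (Itv01 t0 t1) (mem_set Xx) (mem_set Xy).
by rewrite /conv/= /Itv.num_sem.
Qed.

(** The difference quotient of a convex function is smallest at the base point: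
    a violation at $z$ would persist, undiminished, along the segment down to
    $x$, against the definition of the gradient. *)
Lemma gradient_le x z g : X x -> X z -> is_gradient X f x g ->
  dotv g (z - x) <= f z - f x.
Proof.
move=> Xx Xz gradg.
have [->|zx] := eqVneq z x; first by rewrite !subrr dotv0.
have delta0 : 0 < enorm (z - x) by rewrite enorm_gt0 subr_eq0.
set delta := enorm (z - x) in delta0.
rewrite leNgt; apply/negP => lt.
pose s := dotv g (z - x) - (f z - f x).
have s0 : 0 < s by rewrite subr_gt0.
have e0 : 0 < s / delta by rewrite divr_gt0.
have /cvgrPdist_lt/(_ _ e0) := gradg.
rewrite near_withinE /dnbhs near_withinE => /nbhs_ballP[r /= r0 ballr].
pose lam := Num.min 1 (r / (2 * delta)).
have lam0 : 0 < lam by rewrite lt_min ltr01 divr_gt0 ?mulr_gt0.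
have lam1 : lam <= 1 by rewrite ge_min lexx.
have lamr : lam * delta < r.
  have : lam * delta <= r / 2.
    rewrite -ler_pdivlMr// (le_trans (_ : _ <= r / (2 * delta))) ?ge_min ?lexx ?orbT//.
    by rewrite invfM mulrA.
  by move/le_lt_trans; apply; rewrite ltr_pdivrMr// ltr_pMr// ltr1n.
pose y := lam *: z + (1 - lam) *: x.
have yx : y - x = lam *: (z - x) by apply/rowP => j; rewrite !mxE; ring.
have Xy : X y by apply: convex_set_comb => //; rewrite ltW.
have ynx : y != x.
  by rewrite -subr_eq0 yx scaler_eq0 negb_or gt_eqF//= subr_eq0.
have ball_y : ball x r y.
  split=> // i j; rewrite /ball/= distrC ord1.
  have -> : y 0 j - x 0 j = (y - x) 0 j by rewrite [RHS]mxE [(- x) 0 j]mxE.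
  by rewrite (le_lt_trans (normr_coord_le _ _))// yx enormZ gtr0_norm.
have := ballr y ball_y ynx Xy.
rewrite sub0r normrN yx enormZ (gtr0_norm lam0) -/delta dotvZr.
have ub : f y - f x - lam * dotv g (z - x) <= - (lam * s).
  have := convex_function_comb Xz Xx (_ : 0 <= lam <= 1).
  rewrite -/y (ltW lam0) lam1 => /(_ isT); rewrite /s; lra.
rewrite ltNge => /negP; apply.
rewrite ler0_norm; last first.
  rewrite pmulr_lle0 ?invr_gt0 ?mulr_gt0//.
  by rewrite (le_trans ub)// oppr_le0 mulr_ge0 ?ltW.
rewrite -mulNr ler_pdivlMr ?mulr_gt0//.
have -> : s / delta * (lam * delta) = lam * s by field; rewrite gt_eqF.
by rewrite lerNr.
Qed.

End gradients.

Lemma is_gradientN (R : realType) (d : nat) (X : set 'rV[R]_d) (f : 'rV[R]_d -> R) x g :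
  is_gradient X f x g -> is_gradient X (fun z => - f z) x (- g).
Proof.
rewrite /is_gradient => /(@cvgN _ R^o); rewrite oppr0; apply: cvg_trans.
apply: near_eq_cvg; apply: nearW => z /=.
by rewrite fctE dotvNl; set i := (enorm _)^-1; ring.
Qed.

Section row_blocks.
Variables (R : realType) (d1 d2 : nat).
Implicit Types (a c : 'rV[R]_d1) (b e : 'rV[R]_d2).

Lemma dotv_row_mx a b c e : dotv (row_mx a b) (row_mx c e) = dotv a c + dotv b e.
Proof.
rewrite /dotv big_split_ord/=; congr (_ + _); apply: eq_bigr => j _.
  by rewrite !row_mxEl.
by rewrite !row_mxEr.
Qed.

Lemma enorm_row_mxl a b : enorm a <= enorm (row_mx a b).
Proof. by rewrite ler_wsqrtr// dotv_row_mx lerDl dotvv_ge0. Qed.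

Lemma enorm_row_mxr a b : enorm b <= enorm (row_mx a b).
Proof. by rewrite ler_wsqrtr// dotv_row_mx lerDr dotvv_ge0. Qed.

Lemma enorm_lsubmx (v : 'rV[R]_(d1 + d2)) : enorm (lsubmx v) <= enorm v.
Proof. by rewrite -[in leRHS](hsubmxK v) enorm_row_mxl. Qed.

Lemma enorm_rsubmx (v : 'rV[R]_(d1 + d2)) : enorm (rsubmx v) <= enorm v.
Proof. by rewrite -[in leRHS](hsubmxK v) enorm_row_mxr. Qed.

End row_blocks.

Section saddle_point.
Variables (R : realType) (d1 d2 : nat) (D Lx Ly M : R) (dZ : measure_display).
Variables (Z : measurableType dZ) (P : probability Z R).
Variables (X : set 'rV[R]_d1) (Y : set 'rV[R]_d2).
Variables (f : Z -> 'rV[R]_d1 -> 'rV[R]_d2 -> R).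
Variables (gx : Z -> 'rV[R]_d1 -> 'rV[R]_d2 -> 'rV[R]_d1).
Variables (gy : Z -> 'rV[R]_d1 -> 'rV[R]_d2 -> 'rV[R]_d2).
Hypotheses (sspf : ssp_instance P X Y D Lx Ly M f gx gy) (M0 : 0 < M).

Let gap b (v w : 'rV[R]_(d1 + d2)) : R :=
  f b (lsubmx v) (rsubmx w) - f b (lsubmx w) (rsubmx v).

Let W := setXmx X Y.

Let WX v : W v -> X (lsubmx v).
Proof. by move=> [x Xx [y Yy <-]]; rewrite row_mxKl. Qed.

Let WY v : W v -> Y (rsubmx v).
Proof. by move=> [x Xx [y Yy <-]]; rewrite row_mxKr. Qed.

Let bounds b x y : X x -> Y y -> enorm (gx b x y) <= M /\ enorm (gy b x y) <= M.
Proof.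
move=> Xx Yy; have [_ _ _ _ [_ [_ _ _ /(_ b)[_ _ bnd] _]]] := sspf.
have Wxy : W (row_mx x y) by exists x => //; exists y.
have := bnd _ Wxy; rewrite /sp_operator row_mxKl row_mxKr => h.
split; first exact: le_trans (enorm_row_mxl _ _) h.
by rewrite -enormN; exact: le_trans (enorm_row_mxr _ _) h.
Qed.

Let grad_x b x z y : X x -> X z -> Y y -> dotv (gx b x y) (z - x) <= f b z y - f b x y.
Proof.
move=> Xx Xz Yy; have [[_ cX _ _] [convx _] grads _ _] := sspf.
by apply: (gradient_le cX (convx b y Yy)) => //; case: (grads b x y Xx Yy).
Qed.

Let grad_y b x y z : X x -> Y y -> Y z -> f b x z - f b x y <= dotv (gy b x y) (z - y).
Proof.
move=> Xx Yy Yz; have [[_ _ _ cY] [_ convy] grads _ _] := sspf.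
have [_ /is_gradientN grad] := grads b x y Xx Yy.
have := gradient_le cY (convy b x Xx) Yy Yz grad.
by rewrite dotvNl; lra.
Qed.

Let lip_x b x z y : X x -> X z -> Y y -> f b x y - f b z y <= M * enorm (x - z).
Proof.
move=> Xx Xz Yy; have := grad_x b Xx Xz Yy; have [gM _] := bounds b Xx Yy.
have := dotv_le (- gx b x y) (z - x); rewrite dotvNl enormN (enormBC z).
by have := ler_wpM2r (enorm_ge0 (x - z)) gM; lra.
Qed.

Let lip_y b x y z : X x -> Y y -> Y z -> f b x z - f b x y <= M * enorm (z - y).
Proof.
move=> Xx Yy Yz; have := grad_y b Xx Yy Yz; have [_ gM] := bounds b Xx Yy.
have := dotv_le (gy b x y) (z - y).
by have := ler_wpM2r (enorm_ge0 (z - y)) gM; lra.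
Qed.

(** Add the gradient inequality in $x$ to the one in $y$, both at the point
    $v=(x_1,y_1)$, after inserting $f_\beta(x_1,y_1)$ between the two values. *)
Lemma sp_gap_function : gap_function M W (sp_operator gx gy) gap.
Proof.
have [[_ cX _ cY] [convx convy] _ _ [intf _]] := sspf.
have lip b v v' w : W v -> W v' -> W w -> gap b v w - gap b v' w <= 2 * M * enorm (v - v').
  move=> Wv Wv' Ww.
  have h1 := lip_x b (WX Wv) (WX Wv') (WY Ww).
  have h2 := lip_y b (WX Ww) (WY Wv) (WY Wv').
  have h3 := ler_wpM2l (ltW M0) (enorm_lsubmx (v - v')).
  have h4 := ler_wpM2l (ltW M0) (enorm_rsubmx (v - v')).
  rewrite linearB/= in h3; rewrite linearB/= in h4.
  by rewrite (enormBC (rsubmx v')) in h2; rewrite /gap; lra.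
split.
- move=> b w x y t Ww Wx Wy t01; rewrite /gap !linearD/= !linearZ/=.
  have := convex_function_comb (convx b _ (WY Ww)) (WX Wx) (WX Wy) t01.
  have := convex_function_comb (convy b _ (WX Ww)) (WY Wx) (WY Wy) t01.
  lra.
- move=> b v w Wv Ww.
  have h1 := grad_x b (WX Wv) (WX Ww) (WY Wv).
  have h2 := grad_y b (WX Wv) (WY Wv) (WY Ww).
  rewrite /sp_operator -[in X in dotv _ X](hsubmxK (v - w)) dotv_row_mx dotvNl.
  rewrite !linearB/= -[lsubmx v - _]opprB dotvNr -[rsubmx v - _]opprB dotvNr opprK.
  by rewrite /gap; lra.
- move=> b v v' w Wv Wv' Ww; rewrite ler_norml lip// andbT lerNl opprB.
  by rewrite enormBC lip.
- by move=> b w _; rewrite /gap subrr.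
- move=> v w Wv Ww; apply: measurable_funB; apply/measurable_EFinP.
    exact: measurable_int (intf _ _ (WX Wv) (WY Ww)).
  exact: measurable_int (intf _ _ (WX Ww) (WY Wv)).
Qed.

Lemma mean_functionE v x y : W v -> X x -> Y y ->
  mean_function P f (lsubmx v) y - mean_function P f x (rsubmx v) =
  mean_gap gap P v (row_mx x y).
Proof.
move=> Wv Xx Yy; have [_ _ _ _ [intf _]] := sspf.
rewrite /mean_gap /gap row_mxKl row_mxKr RintegralB//.
- by rewrite /mean_function unlock.
- exact: intf (WX Wv) Yy.
- exact: intf Xx (WY Wv).
Qed.

End saddle_point.

Theorem theorem4p4 (R : realType) : exists2 C : R, 0 < C &
  (forall (d n : nat) (D L M eps eta : R)
     (dZ dO : measure_display) (Z : measurableType dZ) (O : measurableType dO)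
     (P : probability Z R) (PA : probability O R)
     (W : set 'rV[R]_d) (F : Z -> 'rV[R]_d -> 'rV[R]_d) (u0 : 'rV[R]_d)
     (i1 i2 : nat -> O -> 'I_n) (xi1 xi2 : nat -> O -> 'rV[R]_d),
     let gamma := fun=> nseg_stepsize d n D L M eps eta in
     let sigma := fun=> nseg_sigma M eps eta in
     let T := (n ^ 2)%N in
     (0 < n)%N -> 0 < D -> 0 < L -> 0 < M -> 0 < eps -> 0 < eta < 1 ->
     svi_instance W D L M F ->
     W u0 ->
     nseg_randomness PA T sigma i1 i2 xi1 xi2 ->
     (weak_gap_VI PA (iid P n) W
        (nseg W F u0 gamma T i1 i2 xi1 xi2) (mean_operator P F)
      <= (C * nseg_rate d n D L M eps eta)%:E)%E) /\
  (forall (d1 d2 n : nat) (D Lx Ly M eps eta : R)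
     (dZ dO : measure_display) (Z : measurableType dZ) (O : measurableType dO)
     (P : probability Z R) (PA : probability O R)
     (X : set 'rV[R]_d1) (Y : set 'rV[R]_d2)
     (f : Z -> 'rV[R]_d1 -> 'rV[R]_d2 -> R)
     (gx : Z -> 'rV[R]_d1 -> 'rV[R]_d2 -> 'rV[R]_d1)
     (gy : Z -> 'rV[R]_d1 -> 'rV[R]_d2 -> 'rV[R]_d2)
     (u0 : 'rV[R]_(d1 + d2))
     (i1 i2 : nat -> O -> 'I_n) (xi1 xi2 : nat -> O -> 'rV[R]_(d1 + d2)),
     let W := setXmx X Y in
     let L := Num.sqrt (Lx ^+ 2 + Ly ^+ 2) in
     let gamma := fun=> nseg_stepsize (d1 + d2) n D L M eps eta in
     let sigma := fun=> nseg_sigma M eps eta in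
     let T := (n ^ 2)%N in
     (0 < n)%N -> 0 < D -> 0 < L -> 0 < M -> 0 < eps -> 0 < eta < 1 ->
     ssp_instance P X Y D Lx Ly M f gx gy ->
     W u0 ->
     nseg_randomness PA T sigma i1 i2 xi1 xi2 ->
     (weak_gap_SP PA (iid P n) X Y
        (nseg W (sp_operator gx gy) u0 gamma T i1 i2 xi1 xi2)
        (mean_function P f)
      <= (C * nseg_rate (d1 + d2) n D L M eps eta)%:E)%E).
Proof.
exists 420 => //; split.
- move=> d n D L M eps eta dZ dO Z O P PA W F u0 i1 i2 xi1 xi2 gamma sigma T.
  move=> n0 D0 L0 M0 eps0 eta01 sviF Wu0 rnd.
  have gapF := vi_gap_function sviF M0.
  apply: le_trans (weak_gap_bound P n0 D0 L0 M0 eps0 eta01 sviF Wu0 rnd gapF).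
  apply: le_integral_any => o; apply: ge_ereal_sup => _ [w Ww <-].
  apply: ereal_sup_ubound; exists w => //; rewrite unlock.
  by apply: eq_integral => S _; rewrite (mean_operatorE P sviF).
- move=> d1 d2 n D Lx Ly M eps eta dZ dO Z O P PA X Y f gx gy u0 i1 i2 xi1 xi2.
  move=> W L gamma sigma T n0 D0 L0 M0 eps0 eta01 sspf Wu0 rnd.
  have gapf := sp_gap_function sspf M0.
  have sviF : svi_instance W D L M (sp_operator gx gy) by case: sspf => _ _ _ _ [].
  apply: le_trans (weak_gap_bound P n0 D0 L0 M0 eps0 eta01 sviF Wu0 rnd gapf).
  apply: le_integral_any => o; apply: ge_ereal_sup => _ [x Xx [y Yy <-]].
  apply: ereal_sup_ubound; exists (row_mx x y); first by exists x => //; exists y.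
  rewrite unlock; apply: eq_integral => S _; rewrite (mean_functionE sspf)//.
  exact: (nseg_in eps eta i1 i2 xi1 xi2 n0 D0 L0 M0 sviF Wu0).
Qed.
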